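(* Let $F^1, F^2$ be holomorphic functions of $(t, x^1, x^2, \dot{x}^1, \dot{x}^2)$ and let $(S_F)$ be the system of second order ordinary differential equations $$\ddot{x}^1 = F^1(t,x,\dot{x}), \qquad \ddot{x}^2 = F^2(t,x,\dot{x}), \qquad x=(x^1,x^2),\ \dot{x}=(\dot{x}^1,\dot{x}^2).$$ Then $(S_F)$ is (locally) equivalent to the system $\{\ddot{\bar{x}}^1 = 0,\ \ddot{\bar{x}}^2 = 0\}$ under a point transformation if and only if all of the following identities hold: $$F^2_{\dot{x}^1\dot{x}^1\dot{x}^1} = 0, \qquad F^1_{\dot{x}^2\dot{x}^2\dot{x}^2} = 0,$$ $$F^2_{\dot{x}^2\dot{x}^2\dot{x}^2} - 3 F^1_{\dot{x}^1\dot{x}^2\dot{x}^2} = 0, \qquad F^1_{\dot{x}^1\dot{x}^1\dot{x}^1} - 3 F^2_{\dot{x}^1\dot{x}^1\dot{x}^2} = 0, \qquad F^1_{\dot{x}^1\dot{x}^1\dot{x}^2} - F^2_{\dot{x}^1\dot{x}^2\dot{x}^2} = 0,$$ $$2 D_{t}F^1_{\dot{x}^2} - F^1_{\dot{x}^2} F^1_{\dot{x}^1} - F^2_{\dot{x}^2} F^1_{\dot{x}^2} - 4 F^1_{x^2} = 0,$$ $$-(F^2_{\dot{x}^2})^{2} - 2 D_{t}F^1_{\dot{x}^1} - 4 F^2_{x^2} + 4 F^1_{x^1} + 2 D_{t}F^2_{\dot{x}^2} + (F^1_{\dot{x}^1})^{2} = 0,$$ $$-2 D_{t}F^2_{\dot{x}^1}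 + F^2_{\dot{x}^2} F^2_{\dot{x}^1} + 4 F^2_{x^1} + F^1_{\dot{x}^1} F^2_{\dot{x}^1} = 0,$$ where $$D_t = \frac{\partial}{\partial t} + \dot{x}^1\frac{\partial}{\partial x^1} + \dot{x}^2\frac{\partial}{\partial x^2} + F^1\frac{\partial}{\partial \dot{x}^1} + F^2\frac{\partial}{\partial \dot{x}^2}.$$
   Context: Subscripts denote partial derivatives with respect to the coordinates $(t,x^1,x^2,\dot{x}^1,\dot{x}^2)$ of the first jet space, e.g. $F^1_{\dot{x}^2} = \partial F^1/\partial \dot{x}^2$, and $D_tF^1_{\dot{x}^2}$ means $D_t(F^1_{\dot{x}^2})$. The functions $F^1,F^2$ are holomorphic on a connected open subset of this jet space, and the identities are required to hold identically there. A point transformation is a local biholomorphism $(t,x^1,x^2)\mapsto(\bar t,\bar x^1,\bar x^2)$ of $\mathbb{C}^3$, prolonged in the usual way to the first jet space (where $\dot{\bar x}^i$ is the total derivative of $\bar x^i$ divided by the total derivative of $\bar t$). Equivalence is local: it is understood in a neighbourhood of each point of the first jet space where $F^1,F^2$ are defined. Two systems $(S_F)$ and $(S_{\bar F})$ are equivalent under a point transformation if there is a point transformation mapping solutions of $(S_F)$ to solutions of $(S_{\bar F})$; equivalently, if there are a point transformation (prolonged to first jets) and functions $a_1,\dots,a_{15}$ on the first jet space such that $$\begin{pmatrix} d\dot{\bar{x}}^1 - \bar{F}^1 d\bar{t} \\ d\dot{\bar{x}}^2 - \bar{F}^2 d\bar{t} \\ d\bar{x}^1 - \dot{\bar{x}}^1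 d\bar{t} \\ d\bar{x}^2 - \dot{\bar{x}}^2 d\bar{t} \\ d\bar{t} \end{pmatrix} = \begin{pmatrix} a_1 & a_2 & a_{3} & a_{4} & 0 \\ a_{5} & a_{6} & a_{7} & a_{8} & 0 \\ 0 & 0 & a_{9} & a_{10} & 0 \\ 0 & 0 & a_{11} & a_{12} & 0 \\ 0 & 0 & a_{13} & a_{14} & a_{15} \end{pmatrix} \begin{pmatrix} d\dot{x}^1 - F^1 dt \\ d\dot{x}^2 - F^2 dt \\ dx^1 - \dot{x}^1 dt \\ dx^2 - \dot{x}^2 dt \\ dt \end{pmatrix},$$ where $\bar F^i = \bar F^i(\bar t,\bar x,\dot{\bar x})$, $F^i=F^i(t,x,\dot x)$, and the matrix is invertible. *)

(* Defs.v *)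
From mathcomp Require Import all_boot all_order all_algebra.
From mathcomp Require Import complex.
From mathcomp Require Import all_classical all_reals all_analysis.

Set Implicit Arguments.
Unset Strict Implicit.
Unset Printing Implicit Defensive.

Import Order.TTheory GRing.Theory Num.Theory.
Import numFieldNormedType.Exports.
Local Open Scope classical_set_scope.
Local Open Scope ring_scope.
Local Open Scope complex_scope.

(* The complex numbers, packed as a numeric field: the carrier R[i] has no
   declared normed-module structure, whereas every numClosedFieldType does. *)
Definition Cplx (R : realType) : numClosedFieldType := R[i].

(* The coordinates (t, x^1, x^2) of C^3. *)
Definition bt : 'I_3 := @Ordinal 3 0 isT.
Definition bx1 : 'I_3 := @Ordinal 3 1 isT.
Definition bx2 : 'I_3 := @Ordinal 3 2 isT.

(* The coordinates (t, x^1, x^2, xdot^1, xdot^2) of the first jet space C^5. *)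
Definition jt : 'I_5 := @Ordinal 5 0 isT.
Definition jx1 : 'I_5 := @Ordinal 5 1 isT.
Definition jx2 : 'I_5 := @Ordinal 5 2 isT.
Definition jd1 : 'I_5 := @Ordinal 5 3 isT.
Definition jd2 : 'I_5 := @Ordinal 5 4 isT.

Section Systems.
Variable R : realType.
Local Notation C := (Cplx R).
Local Notation base := 'rV[C]_3.
Local Notation jet := 'rV[C]_5.

(* Differentiability is over the field C, so for an open D this says that f is
   complex differentiable at every point of D. *)
Definition holomorphic_on (V W : normedModType C) (D : set V) (f : V -> W) :
    Prop :=
  forall p, D p -> differentiable f p.

(* Iterated partial derivatives, in the order in which subscripts are written:
   pd [:: i; j] f is (f_i)_j. *)
Definition pd n (s : seq 'I_n) (f : 'rV[C]_n -> C) : 'rV[C]_n -> C :=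
  foldl (fun g i p => 'D_(delta_mx 0 i) g p) f s.

Definition jet_base (p : jet) : base :=
  \row_(i < 3) p 0 (widen_ord (isT : 3 <= 5)%N i).

Definition total_deriv (g : base -> C) (p : jet) : C :=
  pd [:: bt] g (jet_base p) + p 0 jd1 * pd [:: bx1] g (jet_base p)
  + p 0 jd2 * pd [:: bx2] g (jet_base p).

Definition prolong (phi : base -> base) (p : jet) : jet :=
  let D k := total_deriv (fun q => phi q 0 k) p in
  \row_(i < 5) nth 0 [:: phi (jet_base p) 0 bt;
                         phi (jet_base p) 0 bx1;
                         phi (jet_base p) 0 bx2;
                         D bx1 / D bt;
                         D bx2 / D bt] i.

Definition biholomorphic_on (V : set base) (phi : base -> base) : Prop :=
  [/\ open V, open (phi @` V), holomorphic_on V phi &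
      exists2 psi : base -> base,
        holomorphic_on (phi @` V) psi & forall q, V q -> psi (phi q) = q].

(* The 1-forms  dxdot^1 - F^1 dt, dxdot^2 - F^2 dt, dx^1 - xdot^1 dt,
   dx^2 - xdot^2 dt, dt  at the point p, evaluated on the tangent vector v. *)
Definition coframe (F1 F2 : jet -> C) (p v : jet) : 'cV[C]_5 :=
  \col_(i < 5) nth 0 [:: v 0 jd1 - F1 p * v 0 jt;
                         v 0 jd2 - F2 p * v 0 jt;
                         v 0 jx1 - p 0 jd1 * v 0 jt;
                         v 0 jx2 - p 0 jd2 * v 0 jt;
                         v 0 jt] i.

Definition structure_mx (a : nat -> C) : 'M[C]_5 :=
  \matrix_(i < 5, j < 5)
    nth 0 (nth [::]
      [:: [:: a 1%N; a 2%N; a 3%N; a 4%N; 0];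
          [:: a 5%N; a 6%N; a 7%N; a 8%N; 0];
          [:: 0; 0; a 9%N; a 10%N; 0];
          [:: 0; 0; a 11%N; a 12%N; 0];
          [:: 0; 0; a 13%N; a 14%N; a 15%N]] i) j.

(* The left-hand side of the last condition is the barred coframe pulled back
   along the prolongation of phi; total_deriv of the new time is required not
   to vanish so that the quotients in prolong are genuine. *)
Definition point_equivalent_at (U : set jet) (F1 F2 : jet -> C)
    (U' : set jet) (G1 G2 : jet -> C) (p : jet) : Prop :=
  exists (V : set base) (phi : base -> base) (W : set jet)
         (a : nat -> jet -> C),
    [/\ biholomorphic_on V phi,
        open W /\ W p,
        forall q, W q ->
          [/\ U q, V (jet_base q),
              total_deriv (fun x => phi x 0 bt) q != 0 &
              U' (prolong phi q)],
        forall q, W q -> structure_mx (a^~ q) \in unitmx &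
        forall q v, W q ->
          coframe G1 G2 (prolong phi q) ('d (prolong phi) q v)
          = structure_mx (a^~ q) *m coframe F1 F2 q v].

Definition locally_point_equivalent (U : set jet) (F1 F2 : jet -> C)
    (U' : set jet) (G1 G2 : jet -> C) : Prop :=
  forall p, U p -> point_equivalent_at U F1 F2 U' G1 G2 p.

Definition Dt (F1 F2 : jet -> C) (g : jet -> C) (p : jet) : C :=
  pd [:: jt] g p + p 0 jd1 * pd [:: jx1] g p + p 0 jd2 * pd [:: jx2] g p
  + F1 p * pd [:: jd1] g p + F2 p * pd [:: jd2] g p.

End Systems.

(* Main.v *)
(* The straight lines of the flat system are, in any other point coordinates, the
   unparametrized geodesics of a flat connection G on C^3: with u = (1, xd1, xd2),
   F^i = u^i G^0(u,u) - G^i(u,u).  Such F are cubic in the velocities, with third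
   derivatives satisfying the first five identities, while the last three
   expressions are the Jacobi endomorphism R(., u)u of G, read modulo u and up to
   trace; they vanish when G is flat.

   Conversely the first five identities force F to have this geodesic form on a
   polydisc, with a trace-free G, and the last three then say that the Weyl
   projective curvature of G vanishes.  In dimension 3 the Bianchi identity makes
   the Cotton tensor vanish as well, so the tractor system
   d_a s = mu_a,  d_a mu_b = G^c_ab mu_c - P_ab s  is flat.  Four independent
   solutions s^0, ..., s^3 give the linearizing coordinates s^k / s^0.

   The analytic input (holomorphy of partial derivatives, the Frobenius theorem
   for flat linear systems, the inverse function theorem) is derived from complex
   differentiability alone: Goursat's theorem on rectangles gives a second order
   Taylor estimate, whence the first partial derivatives of a holomorphic function
   are holomorphic; Picard iteration with the homotopy operators
   f |-> int_0^1 s^k f(p + s (x - p)) ds then solves the linear systems. *)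
Require Import Defs.
From HB Require Import structures.
From mathcomp Require Import all_boot all_order all_algebra complex ring lra.
From mathcomp Require Import all_classical all_reals all_analysis.
Import Order.TTheory GRing.Theory Num.Theory.
Import numFieldNormedType.Exports.
Set Implicit Arguments.
Unset Strict Implicit.
Unset Printing Implicit Defensive.
Local Open Scope classical_set_scope.
Local Open Scope ring_scope.

(** * Real-valued norms over the complex numbers *)

Section RealNorm.
Variable R : realType.
Local Notation C := (Cplx R).

(** Why quotients of parallel sections straighten the system: along a solution the four functions
    [s] satisfy one and the same scalar equation [s'' = g^0(u,u) s' - P(u,u) s], so their Wronskians
    with [s^0] all obey the same first order linear equation. The new velocities are quotients of
    these Wronskians, hence constant. Making the connection trace-free costs nothing, because [F]
    sees only the projective class; it makes the Schouten tensor symmetric, and this is what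
    flatness of the tractor system demands in its first row. On the analytic side no residue is
    computed: a lower bound for the integral of [1 / (w - h)] over a square already yields Cauchy
    and Taylor estimates with crude constants. Flatness enters the Frobenius theorem only after the
    iteration: Picard solves an integral equation for arbitrary small coefficients, and flatness
    makes the defect of the differential system obey a homogeneous contracting equation. All is done
    in small balls, so polynomial identities in the velocities are known on an open set only, and
    their coefficients are extracted there. *)

Definition cofr (r : R) : C := Complex r 0.

(** The norm of a normed module over [C] lies in [C], whose order is partial; all estimates are
    carried by this real number instead. *)
Definition nm (V : normedModType C) (x : V) : R := complex.Re (`|x| : R[i]).

Lemma cofr_ge0 (r : R) : (0 <= cofr r) = (0 <= r).
Proof. exact: ler0c. Qed.

Lemma cofr_gt0 (r : R) : (0 < cofr r) = (0 < r).
Proof. by rewrite -[0]/(cofr 0) /cofr (ltcR 0 r). Qed.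

Lemma le_cofr (r s : R) : (cofr r <= cofr s) = (r <= s).
Proof. exact: lecR. Qed.

Lemma lt_cofr (r s : R) : (cofr r < cofr s) = (r < s).
Proof. exact: ltcR. Qed.

Lemma cofrD r s : cofr (r + s) = cofr r + cofr s.
Proof. by apply/eqP; rewrite eq_complex /= addr0 !eqxx. Qed.

Lemma cofrM r s : cofr (r * s) = cofr r * cofr s.
Proof. by apply/eqP; rewrite eq_complex /= !mulr0 mul0r subr0 addr0 !eqxx. Qed.

Lemma ge0_cofr (z : C) : 0 <= z -> z = cofr (complex.Re (z : R[i])).
Proof.
move=> z0; apply/eqP; rewrite eq_complex /= eqxx /=.
by have /(ger0_Im) -> := (z0 : 0 <= (z : R[i])).
Qed.

Section Generic.
Variable V : normedModType C.
Implicit Types x y : V.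

Lemma normE x : `|x| = cofr (nm x).
Proof. by apply: ge0_cofr; exact: normr_ge0. Qed.

Lemma nm_ge0 x : 0 <= nm x.
Proof. by rewrite -cofr_ge0 -normE. Qed.

Lemma nmD x y : nm (x + y) <= nm x + nm y.
Proof. by rewrite -le_cofr cofrD -!normE; exact: ler_normD. Qed.

Lemma nm0 : nm (0 : V) = 0.
Proof. by rewrite /nm normr0. Qed.

Lemma nmN x : nm (- x) = nm x.
Proof. by rewrite /nm normrN. Qed.

Lemma nmB x y : nm (x - y) <= nm x + nm y.
Proof. by rewrite -[nm y]nmN nmD. Qed.

Lemma nmBC x y : nm (x - y) = nm (y - x).
Proof. by rewrite -nmN opprB. Qed.

Lemma nm_eq0 x : nm x = 0 -> x = 0.
Proof. by move=> h; apply/eqP; rewrite -normr_eq0 normE h. Qed.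

Lemma nm_gt0 x : (0 < nm x) = (x != 0).
Proof.
rewrite lt_def nm_ge0 andbT; congr (~~ _).
by apply/eqP/eqP => [/nm_eq0|->] //; rewrite nm0.
Qed.

Lemma nmZ (a : C) x : nm (a *: x) = nm (a : C) * nm x.
Proof. by rewrite {1}/nm normrZ !normE -cofrM. Qed.

Lemma nm_sum (I : Type) (s : seq I) (P : pred I) (f : I -> V) :
  nm (\sum_(i <- s | P i) f i) <= \sum_(i <- s | P i) nm (f i).
Proof.
elim/big_rec2: _ => [|i y1 y2 _ h]; first by rewrite nm0.
by apply: (le_trans (nmD _ _)); rewrite lerD2l.
Qed.

Lemma nm_nbhsP x (P : set V) :
  nbhs x P <-> exists2 r : R, 0 < r & forall y, nm (y - x) < r -> P y.
Proof.
split=> [/nbhs_normP[e /= e0 eP]|[r r0 rP]].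
  exists (complex.Re (e : R[i])); first by rewrite -cofr_gt0 -ge0_cofr// ltW.
  move=> y yx; apply: eP; rewrite /= distrC normE.
  by rewrite [e in _ < e]ge0_cofr ?ltW// lt_cofr.
apply/nbhs_normP; exists (cofr r); first by rewrite /= cofr_gt0.
by move=> y; rewrite /= distrC normE lt_cofr; exact: rP.
Qed.

Lemma nm_openP (D : set V) :
  open D <-> forall x, D x -> exists2 r : R, 0 < r & forall y, nm (y - x) < r -> D y.
Proof.
rewrite openE; split=> [h x /h /nm_nbhsP//|h x /h /nm_nbhsP//].
Qed.
End Generic.

Lemma nmM (a b : C) : nm (a * b : C) = nm (a : C) * nm (b : C).
Proof. exact: (nmZ a (b : C^o)). Qed.

Lemma nm1 : nm (1 : C) = 1.
Proof. by rewrite /nm normr1. Qed.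

Lemma nmV (a : C) : nm (a^-1 : C) = (nm (a : C))^-1.
Proof.
have [->|a0] := eqVneq a 0; first by rewrite invr0 nm0 invr0.
have n0 : nm (a : C) != 0 by rewrite gt_eqF// nm_gt0.
by apply: (mulfI n0); rewrite -nmM divff// divff// nm1.
Qed.

Lemma nmX (a : C) n : nm (a ^+ n : C) = nm (a : C) ^+ n.
Proof. by elim: n => [|n ih]; rewrite ?expr0 ?nm1// !exprS nmM ih. Qed.

Lemma nm_cofr (r : R) : nm (cofr r : C) = `|r|.
Proof. by rewrite /nm normc_def /= expr0n /= addr0 sqrtr_sqr. Qed.

Lemma nm_normc (z : C) : nm (z : C) = Num.sqrt ((complex.Re (z : R[i])) ^+ 2 + (complex.Im (z : R[i])) ^+ 2).
Proof. by rewrite /nm normc_def. Qed.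

Lemma Re_le_nm (z : C) : `|complex.Re (z : R[i])| <= nm (z : C).
Proof. by rewrite nm_normc -sqrtr_sqr ler_wsqrtr// lerDl sqr_ge0. Qed.

Lemma Im_le_nm (z : C) : `|complex.Im (z : R[i])| <= nm (z : C).
Proof. by rewrite nm_normc -sqrtr_sqr ler_wsqrtr// lerDr sqr_ge0. Qed.

Lemma nm_i : nm ('i%C : C) = 1.
Proof. by rewrite nm_normc /= expr0n expr1n add0r sqrtr1. Qed.

Lemma nm_le_ReIm (z : C) :
  nm (z : C) <= `|complex.Re (z : R[i])| + `|complex.Im (z : R[i])|.
Proof.
rewrite {1}(complexE (z : R[i])); apply: (le_trans (nmD _ _)).
by rewrite nmM nm_i mul1r !nm_cofr.
Qed.

Section Rows.
Variable n : nat.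
Implicit Types x : 'rV[C]_n.

Lemma nm_coord x i : nm (x 0 i : C) <= nm x.
Proof.
rewrite -le_cofr -!normE -[`|x|]/(mx_norm x) mx_normE -[leLHS]nngE num_le.
exact: (le_bigmax _ (fun i : 'I_1 * 'I_n => `|x i.1 i.2|%:nng) (0, i)).
Qed.

(** A nonzero sup norm is attained at an entry, so a strict bound on the entries stays strict. *)
Lemma nm_row_lt x (r : R) : 0 < r -> (forall i, nm (x 0 i : C) < r) -> nm x < r.
Proof.
move=> r0 h; have r0' := cofr_gt0 r; rewrite r0 in r0'.
have [x0|x0] := eqVneq (nm x) 0; first by rewrite x0.
have : mx_norm x != 0.
  by apply: contraNneq x0 => x0; rewrite /nm -[`|x|]/(mx_norm x) x0.
move=> /mx_norm_neq0 [[i j] /= e]; rewrite -lt_cofr -normE.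
by rewrite -[`|x|]/(mx_norm x) e normE lt_cofr (ord1 i).
Qed.

Lemma nm_row_le x (r : R) : 0 <= r -> (forall i, nm (x 0 i : C) <= r) -> nm x <= r.
Proof.
move=> r0 h; apply/ler_addgt0Pr => e e0; apply/ltW/nm_row_lt => [|i].
  by rewrite ltr_wpDl.
by rewrite (le_lt_trans (h i))// ltrDl.
Qed.
End Rows.

Section Frechet.
Variables V W : normedModType C.

(** A positive element of [C] is real, so quantifying over positive [eps : C] or over positive real
    [e] is the same. *)
Lemma nm_littleoP (G : V -> V) (f : V -> W) :
  (forall eps : C, 0 < eps -> \forall x \near (0 : V), `|f x| <= eps * `|G x|) <->
  forall e : R, 0 < e -> exists2 d : R, 0 < d & forall h, nm h < d -> nm (f h) <= e * nm (G h).
Proof.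
split=> [h e e0|h e e0].
  have e0' : 0 < cofr e by rewrite cofr_gt0.
  have /nm_nbhsP[r r0 rP] := h _ e0'; exists r => // y yr.
  rewrite -le_cofr cofrM -!normE; apply: rP.
  by rewrite subr0.
have e0' : 0 < complex.Re (e : R[i]) by rewrite -cofr_gt0 -ge0_cofr// ltW.
have [d d0 dP] := h _ e0'; apply/nm_nbhsP; exists d => // y; rewrite subr0 => yd.
have := dP _ yd; rewrite -le_cofr cofrM -!normE -ge0_cofr//; exact: ltW.
Qed.
End Frechet.
End RealNorm.

(** * Differentiability on [C^n] through explicit gradients *)

Section FrechetRow.
Variables (R : realType) (n : nat).
Local Notation C := (Cplx R).
Local Notation vec := 'rV[C]_n.

Definition dotc (c : 'I_n -> C) (h : vec) : C := \sum_i h 0 i * c i.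

Lemma dotc_linear c : linear (dotc c : vec -> C^o).
Proof.
move=> a x y; rewrite /dotc scaler_sumr -big_split /=; apply: eq_bigr => i _.
by rewrite !mxE mulrDl /GRing.scale /= mulrA.
Qed.

HB.instance Definition _ c :=
  GRing.isLinear.Build C vec C^o _ (dotc c) (dotc_linear c).

Lemma dotc_delta c i : dotc c (delta_mx 0 i) = c i.
Proof.
rewrite /dotc (bigD1 i)//= mxE !eqxx mul1r big1 ?addr0//.
by move=> j ji; rewrite mxE eqxx (negPf ji) mul0r.
Qed.

Lemma dotc_diff c p : differentiable (dotc c : vec -> C) p.
Proof.
rewrite (_ : dotc c = \sum_i ((fun h : vec => h 0 i) * cst (c i) : vec -> C)).
  apply: differentiable_sum => i; apply: differentiableM.
    exact: differentiable_coord.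
  exact: differentiable_cst.
by apply/funext => h; rewrite fct_sumE /dotc; apply: eq_bigr.
Qed.

Lemma nm_dotc c h M : (forall i, nm (c i : C) <= M) ->
  nm (dotc c h : C) <= n%:R * (nm h * M).
Proof.
move=> cM; apply: (le_trans (nm_sum _ _ _)).
apply: (@le_trans _ _ (\sum_(i < n) nm h * M)).
  apply: ler_sum => i _; rewrite nmM.
  by apply: ler_pM; rewrite ?nm_ge0// nm_coord.
by rewrite sumr_const card_ord mulr_natl.
Qed.

(** Epsilon-delta form of differentiability with prescribed gradient [c]. Derivatives that come from
    estimates are established in this form and transferred by [fd_diff]. *)
Definition fd (f : vec -> C) p (c : 'I_n -> C) := forall e : R, 0 < e ->
  exists2 d : R, 0 < d & forall h, nm h < d ->
    nm (f (p + h) - f p - dotc c h : C) <= e * nm h.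

Definition grad (f : vec -> C) p : 'I_n -> C := fun i => pd [:: i] f p.

Lemma gradE f p : differentiable f p -> 'd f p = dotc (grad f p) :> (vec -> C).
Proof.
move=> df; apply/funext => h; rewrite /dotc {1}(row_sum_delta h) linear_sum.
apply: eq_bigr => i _; rewrite linearZ /grad /pd /= deriveE//.
Qed.

Lemma diff_fd f p : differentiable f p -> fd f p (grad f p).
Proof.
move=> df; have /diff_locally := df; rewrite gradE// => e.
move: e => /eqaddoP /nm_littleoP h' eps /h'[d d0 dP]; exists d => // k /dP /=.
by rewrite !fctE opprD addrA [k + p]addrC.
Qed.

Lemma fd_diff f p c : fd f p c -> differentiable f p /\ grad f p = c.
Proof.
move=> h.
have cont : continuous (dotc c : vec -> C).
  by move=> x; apply: differentiable_continuous; exact: dotc_diff.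
have E : f \o shift p = cst (f p) + dotc c +o_ 0 id.
  apply/eqaddoP; apply: (nm_littleoP (@id vec) _).2 => eps /h[d d0 dP]; exists d => // k /dP /=.
  by rewrite !fctE opprD addrA [k + p]addrC.
have D := @diff_unique C vec C f (dotc c) p cont E.
have df : differentiable f p by apply/diff_locallyP; rewrite D.
split=> //; apply/funext => i.
rewrite /grad /pd /= deriveE// -[RHS]dotc_delta.
by rewrite D.
Qed.

Lemma fd_differentiable f p c : fd f p c -> differentiable f p.
Proof. by case/fd_diff. Qed.

Lemma fd_cont f p c : fd f p c -> forall e, 0 < e ->
  exists2 d : R, 0 < d & forall q, nm (q - p) < d -> nm (f q - f p : C) < e.
Proof.
case/fd_diff => /differentiable_continuous ctf _ e e0.
have /ctf /nm_nbhsP[r r0 rP] : nbhs (f p) [set z : C | nm (z - f p : C) < e].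
  by apply/nm_nbhsP; exists e.
by exists r.
Qed.
End FrechetRow.

(** * Integrals of complex-valued functions *)

Section RealIntegral.
Variable R : realType.
Local Notation mu := (@lebesgue_measure R).
Implicit Types (a b m x y e d : R) (f g : R -> R).

Definition rcont a b f := forall x, a <= x <= b -> forall e, 0 < e ->
  exists2 d, 0 < d & forall y, a <= y <= b -> `|y - x| < d -> `|f y - f x| < e.

Lemma rcont_within a b f : rcont a b f -> {within `[a, b], continuous f}.
Proof.
move=> cf; apply/subspace_continuousP => x /=; rewrite in_itv /= => xab.
apply/cvgrPdist_lt => e e0; have [d d0 dP] := cf x xab e e0.
rewrite /within /=; apply/nbhs_normP; exists d => //= y /= yx.
by rewrite in_itv /= => yab; rewrite distrC; apply: dP => //; rewrite distrC.
Qed.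

Lemma rcont_integrable a b f : rcont a b f -> mu.-integrable `[a, b] (EFin \o f).
Proof.
move=> cf; apply: continuous_compact_integrable; first exact: segment_compact.
exact: rcont_within.
Qed.

Definition rint a b f : R := (\int[mu]_(x in `[a, b]) f x)%R.

Lemma rintD a b f g : rcont a b f -> rcont a b g ->
  rint a b (fun x => f x + g x) = rint a b f + rint a b g.
Proof.
by move=> cf cg; apply: RintegralD => //; exact: rcont_integrable.
Qed.

Lemma rintZ a b r f : rcont a b f -> rint a b (fun x => r * f x) = r * rint a b f.
Proof. by move=> cf; apply: RintegralZl => //; exact: rcont_integrable. Qed.

Lemma eq_rint a b f g : (forall x, a <= x <= b -> f x = g x) -> rint a b f = rint a b g.
Proof. by move=> fg; apply: eq_Rintegral => x; rewrite inE /= in_itv /=; exact: fg. Qed.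

Lemma rcont_cst a b r : rcont a b (fun=> r).
Proof. by move=> x _ e e0; exists 1 => // y _ _; rewrite subrr normr0. Qed.

Lemma rint_cst a b r : a <= b -> rint a b (fun=> r) = r * (b - a).
Proof.
move=> ab; rewrite /rint Rintegral_cst//=.
rewrite lebesgue_measure_itv/= lte_fin; case: ltP => [//|ba].
by rewrite (_ : b = a) ?subrr//; apply/eqP; rewrite eq_le ab ba.
Qed.

Lemma rint_le a b f g : rcont a b f -> rcont a b g ->
  (forall x, a <= x <= b -> f x <= g x) -> rint a b f <= rint a b g.
Proof.
move=> cf cg fg; by apply: le_Rintegral => //; exact: rcont_integrable.
Qed.

Lemma rcontS a b a' b' f : a' <= a -> b <= b' -> rcont a' b' f -> rcont a b f.
Proof.
move=> aa bb cf x /andP[ax xb] e e0.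
have [|d d0 dP] := cf x _ e e0; first by rewrite (le_trans aa ax) (le_trans xb bb).
by exists d => // y /andP[ay yb]; apply: dP; rewrite (le_trans aa ay) (le_trans yb bb).
Qed.

Lemma rint_split a m b f : a <= m -> m <= b -> rcont a b f ->
  rint a b f = rint a m f + rint m b f.
Proof.
move=> am mb cf; apply/eqP; rewrite -subr_eq addrC addrC subr_eq addrC -subr_eq.
rewrite eq_sym /rint; apply/eqP.
have := @Rintegral_itvB R f (BLeft a) (BRight b) m (rcont_integrable cf).
rewrite !bnd_simp => -> //.
rewrite Rintegral_itv_obnd_cbnd//.
apply: (integrableS _ _ _ (rcont_integrable (rcontS am (lexx b) cf))) => //.
by apply: subset_itvr; rewrite bnd_simp.
Qed.

(** First order expansion relative to the segment, one-sided at its ends: interior points give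
    genuine derivatives, the end points give the continuity that the fundamental theorem asks
    for. *)
Definition rder a b (F f : R -> R) := forall x, a <= x <= b -> forall e, 0 < e ->
  exists2 d, 0 < d & forall y, a <= y <= b -> `|y - x| < d ->
    `|F y - F x - (y - x) * f x| <= e * `|y - x|.

Lemma rder_cont a b F f : rder a b F f -> rcont a b F.
Proof.
move=> dF x xab e e0; have [d d0 dP] := dF x xab 1 ltr01.
pose K := `|f x| + 1; have K0 : 0 < K by rewrite ltr_wpDl.
exists (Num.min d (e / K)); first by rewrite lt_min d0 divr_gt0.
move=> y yab; rewrite lt_min => /andP[yd ye].
have := dP y yab yd; rewrite mul1r => h.
rewrite -(subrK ((y - x) * f x) (F y - F x)) (le_lt_trans (ler_normD _ _))//.
rewrite (@le_lt_trans _ _ (`|y - x| * K))//; last by rewrite -ltr_pdivlMr.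
by rewrite normrM /K mulrDr mulr1 addrC lerD2l.
Qed.

Lemma rder_cvg a b F f x : rder a b F f -> a < x < b ->
  h^-1 *: (F (h *: 1 + x) - F x) @[h --> 0^'] --> f x.
Proof.
move=> dF /andP[ax xb]; apply/cvgrPdist_le => e e0.
have xab : a <= x <= b by rewrite !ltW.
have [d d0 dP] := dF x xab e e0.
apply/nbhs_normP; exists (Num.min d (Num.min (x - a) (b - x))).
  by rewrite /= !lt_min d0 !subr_gt0 ax xb.
move=> h /=; rewrite sub0r normrN !lt_min => /andP[hd /andP[h1' h2']] h0.
rewrite /GRing.scale /= mulr1 -(ler_pM2l (_ : 0 < `|h|)) ?normr_gt0//.
have yab : a <= h + x <= b.
  by move: h1' h2'; rewrite !ltr_norml => /andP[? ?] /andP[? ?]; lra.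
have := dP (h + x) yab; rewrite addrK => /(_ hd) H.
by rewrite -normrM mulrBr mulVKf// distrC (mulrC `|h|).
Qed.

Lemma rint_FTC a b F f : a <= b -> rcont a b f -> rder a b F f ->
  rint a b f = F b - F a.
Proof.
rewrite le_eqVlt => /predU1P[<- _ _|ab cf dF].
  by rewrite subrr /rint set_itv1 Rintegral_set1.
rewrite /rint /Rintegral (@continuous_FTC2 _ f F)//; first exact: rcont_within.
  have /(continuous_within_itvP _ ab)[_ h1 h2] := rcont_within (rder_cont dF).
  split=> //= x; rewrite in_itv /= => xab.
  by apply/cvg_ex; exists (f x); exact: (rder_cvg dF xab).
move=> x; rewrite in_itv /= => xab; rewrite derive1E.
by apply: cvg_lim => //; exact: (rder_cvg dF xab).
Qed.
End RealIntegral.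

(** * The complex integral, taken on real and imaginary parts *)

Section ComplexIntegral.
Variable R : realType.
Local Notation C := (Cplx R).
Implicit Types (a b m x y e d : R) (f g : R -> C).

Definition cre (z : C) : R := complex.Re (z : R[i]).
Definition cim (z : C) : R := complex.Im (z : R[i]).
Definition mkc (x y : R) : C := Complex x y.

Lemma creD z w : cre (z + w) = cre z + cre w. Proof. by case: z; case: w. Qed.
Lemma cimD z w : cim (z + w) = cim z + cim w. Proof. by case: z; case: w. Qed.
Lemma creN z : cre (- z) = - cre z. Proof. by case: z. Qed.
Lemma cimN z : cim (- z) = - cim z. Proof. by case: z. Qed.
Lemma creB z w : cre (z - w) = cre z - cre w. Proof. by rewrite creD creN. Qed.
Lemma cimB z w : cim (z - w) = cim z - cim w. Proof. by rewrite cimD cimN. Qed.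
Lemma creM z w : cre (z * w) = cre z * cre w - cim z * cim w.
Proof. by case: z; case: w. Qed.
Lemma cimM z w : cim (z * w) = cre z * cim w + cim z * cre w.
Proof. by case: z => a b; case: w => c d /=; rewrite /cim /=. Qed.
Lemma cre_le z : `|cre z| <= nm (z : C). Proof. exact: Re_le_nm. Qed.
Lemma cim_le z : `|cim z| <= nm (z : C). Proof. exact: Im_le_nm. Qed.
Lemma nm_cre_cim z : nm (z : C) <= `|cre z| + `|cim z|. Proof. exact: nm_le_ReIm. Qed.
Lemma cplxP (z w : C) : cre z = cre w -> cim z = cim w -> z = w.
Proof. by case: z => a b; case: w => c d; rewrite /cre /cim /= => -> ->. Qed.
Lemma cre_mk x y : cre (mkc x y) = x. Proof. by []. Qed.
Lemma cim_mk x y : cim (mkc x y) = y. Proof. by []. Qed.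

Definition ccont a b g := forall x, a <= x <= b -> forall e, 0 < e ->
  exists2 d, 0 < d & forall y, a <= y <= b -> `|y - x| < d -> nm (g y - g x : C) < e.

Lemma ccont_re a b g : ccont a b g -> rcont a b (cre \o g).
Proof.
move=> cg x xab e e0; have [d d0 dP] := cg x xab e e0; exists d => // y yab yx.
by rewrite /= -creB (le_lt_trans (cre_le _))// dP.
Qed.

Lemma ccont_im a b g : ccont a b g -> rcont a b (cim \o g).
Proof.
move=> cg x xab e e0; have [d d0 dP] := cg x xab e e0; exists d => // y yab yx.
by rewrite /= -cimB (le_lt_trans (cim_le _))// dP.
Qed.

Lemma ccont_cst a b c : ccont a b (fun=> c).
Proof. by move=> x _ e e0; exists 1 => // y _ _; rewrite subrr nm0. Qed.

Lemma ccontS a b a' b' f : a' <= a -> b <= b' -> ccont a' b' f -> ccont a b f.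
Proof.
move=> aa bb cf x /andP[ax xb] e e0.
have [|d d0 dP] := cf x _ e e0; first by rewrite (le_trans aa ax) (le_trans xb bb).
by exists d => // y /andP[ay yb]; apply: dP; rewrite (le_trans aa ay) (le_trans yb bb).
Qed.

Lemma eq_ccont a b f g : (forall x, a <= x <= b -> f x = g x) -> ccont a b f -> ccont a b g.
Proof.
move=> fg cf x xab e e0; have [d d0 dP] := cf x xab e e0; exists d => // y yab yd.
by rewrite -!fg//; exact: dP.
Qed.

Lemma ccontD a b f g : ccont a b f -> ccont a b g -> ccont a b (fun x => f x + g x).
Proof.
move=> cf cg x xab e e0; have e2 : 0 < e / 2 by rewrite divr_gt0.
have [d1 d10 h1] := cf x xab _ e2; have [d2 d20 h2] := cg x xab _ e2.
exists (Num.min d1 d2) => [|y yab]; first by rewrite lt_min d10.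
rewrite lt_min => /andP[/(h1 _ yab) k1 /(h2 _ yab) k2].
rewrite opprD addrACA (le_lt_trans (nmD _ _))//; lra.
Qed.

Lemma ccontM a b f g : ccont a b f -> ccont a b g -> ccont a b (fun x => f x * g x).
Proof.
move=> cf cg x xab e e0.
pose K := nm (f x : C) + nm (g x : C) + 1.
have K0 : 0 < K by rewrite ltr_wpDl// addr_ge0// nm_ge0.
(* The bound 1 makes the product of the two errors at most [e'], so the total error is at most
   [e' * K], and the factor 2 leaves it strictly below [e]. *)
pose e' := Num.min 1 (e / (2 * K)).
have e'0 : 0 < e' by rewrite lt_min ltr01 divr_gt0// mulr_gt0.
have [d1 d10 h1] := cf x xab _ e'0; have [d2 d20 h2] := cg x xab _ e'0.
exists (Num.min d1 d2) => [|y yab]; first by rewrite lt_min d10.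
rewrite lt_min => /andP[/(h1 _ yab) k1 /(h2 _ yab) k2].
rewrite (_ : f y * g y - f x * g x =
  (f y - f x) * (g y - g x) + (f y - f x) * g x + f x * (g y - g x)); last by ring.
apply: (@le_lt_trans _ _ (e' * K)).
  rewrite (_ : e' * K = e' * 1 + e' * nm (g x : C) + nm (f x : C) * e'); last first.
    by rewrite /K; ring.
  have e1 : e' <= 1 by rewrite ge_min lexx.
  apply: (le_trans (nmD _ _)); apply: lerD; last first.
    by rewrite nmM ler_wpM2l ?nm_ge0// ltW.
  apply: (le_trans (nmD _ _)); apply: lerD; rewrite nmM; last first.
    by rewrite ler_wpM2r ?nm_ge0// ltW.
  by apply: ler_pM; rewrite ?nm_ge0// ltW//; exact: lt_le_trans e1.
rewrite -ltr_pdivlMr//; apply: (@le_lt_trans _ _ (e / (2 * K))).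
  by rewrite /e' ge_min lexx orbT.
rewrite invfM mulrA ltr_pM2r ?invr_gt0//; lra.
Qed.

Lemma ccontZ a b c g : ccont a b g -> ccont a b (fun x => c * g x).
Proof. by move=> cg; apply: ccontM => //; exact: ccont_cst. Qed.

Lemma ccontN a b g : ccont a b g -> ccont a b (fun x => - g x).
Proof.
move=> cg; apply: (@eq_ccont _ _ (fun x => -1 * g x)); last exact: ccontZ.
by move=> x _; rewrite mulN1r.
Qed.

Lemma ccontB a b f g : ccont a b f -> ccont a b g -> ccont a b (fun x => f x - g x).
Proof. by move=> cf cg; apply: ccontD => //; exact: ccontN. Qed.

Lemma ccont_sum (I : Type) (s : seq I) a b (f : I -> R -> C) :
  (forall i, ccont a b (f i)) -> ccont a b (fun x => \sum_(i <- s) f i x).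
Proof.
move=> cf; elim: s => [|i s ih].
  by apply: (@eq_ccont _ _ (fun=> 0)); [move=> x _; rewrite big_nil|exact: ccont_cst].
apply: (@eq_ccont _ _ (fun x => f i x + \sum_(i <- s) f i x)).
  by move=> x _; rewrite big_cons.
exact: ccontD.
Qed.

Definition cint a b g : C := mkc (rint a b (cre \o g)) (rint a b (cim \o g)).

Lemma eq_cint a b f g : (forall x, a <= x <= b -> f x = g x) -> cint a b f = cint a b g.
Proof. by move=> fg; congr mkc; apply: eq_rint => x xab /=; rewrite fg. Qed.

Lemma cintD a b f g : ccont a b f -> ccont a b g ->
  cint a b (fun x => f x + g x) = cint a b f + cint a b g.
Proof.
move=> cf cg; apply: cplxP; rewrite ?creD ?cimD /cint ?cre_mk ?cim_mk -rintD;
  try exact: ccont_re; try exact: ccont_im.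
- by apply: eq_rint => x _ /=; rewrite creD.
- by apply: eq_rint => x _ /=; rewrite cimD.
Qed.

Lemma rcontZ a b r (f : R -> R) : rcont a b f -> rcont a b (fun x => r * f x).
Proof.
move=> cf x xab e e0; have r0 : 0 < `|r| + 1 by rewrite ltr_wpDl.
have [d d0 h] := cf x xab (e / (`|r| + 1)) (divr_gt0 e0 r0).
exists d => // y yab /(h _ yab) k; rewrite -mulrBr normrM.
apply: (@le_lt_trans _ _ ((`|r| + 1) * `|f y - f x|)).
  by rewrite ler_wpM2r// lerDl.
by rewrite mulrC -ltr_pdivlMr.
Qed.

Lemma cintZ a b c g : ccont a b g -> cint a b (fun x => c * g x) = c * cint a b g.
Proof.
move=> cg; have cr := ccont_re cg; have ci := ccont_im cg.
apply: cplxP; rewrite ?creM ?cimM /cint ?cre_mk ?cim_mk.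
- rewrite -mulNr -!rintZ// -rintD; try exact: rcontZ.
  by apply: eq_rint => x _ /=; rewrite creM mulNr.
- rewrite -!rintZ// -rintD; try exact: rcontZ.
  by apply: eq_rint => x _ /=; rewrite cimM.
Qed.

Lemma cintN a b g : ccont a b g -> cint a b (fun x => - g x) = - cint a b g.
Proof.
by move=> cg; rewrite -mulN1r -cintZ//; apply: eq_cint => x _; rewrite mulN1r.
Qed.

Lemma cintB a b f g : ccont a b f -> ccont a b g ->
  cint a b (fun x => f x - g x) = cint a b f - cint a b g.
Proof. by move=> cf cg; rewrite cintD ?cintN//; exact: ccontN. Qed.

Lemma cint_cst a b c : a <= b -> cint a b (fun=> c) = cofr (b - a) * c.
Proof.
move=> ab; apply: cplxP; rewrite ?creM ?cimM /cint ?cre_mk ?cim_mk rint_cst//=.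
  by rewrite /cre /cim /= mul0r subr0 mulrC.
by rewrite /cre /cim /= mul0r addr0 mulrC.
Qed.

Lemma cint_sum (I : Type) (s : seq I) a b (f : I -> R -> C) : a <= b ->
  (forall i, ccont a b (f i)) ->
  cint a b (fun x => \sum_(i <- s) f i x) = \sum_(i <- s) cint a b (f i).
Proof.
move=> ab cf; elim: s => [|i s ih].
  rewrite big_nil -[RHS](mulr0 (cofr (b - a))) -cint_cst//.
  by apply: eq_cint => x _; rewrite big_nil.
rewrite big_cons -ih -cintD//; last exact: ccont_sum.
by apply: eq_cint => x _; rewrite big_cons.
Qed.

Lemma cint_split a m b f : a <= m -> m <= b -> ccont a b f ->
  cint a b f = cint a m f + cint m b f.
Proof.
move=> am mb cf; apply: cplxP; rewrite ?creD ?cimD /cint ?cre_mk ?cim_mk.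
  by apply: rint_split => //; exact: ccont_re.
by apply: rint_split => //; exact: ccont_im.
Qed.

Lemma rint_norm_le a b (f : R -> R) M : a <= b -> rcont a b f -> (forall x, a <= x <= b -> `|f x| <= M) ->
  `|rint a b f| <= M * (b - a).
Proof.
move=> ab cf fM; rewrite ler_norml -mulNr -!rint_cst//.
by apply/andP; split; apply: rint_le => //; try exact: rcont_cst;
  move=> x /fM; rewrite ler_norml => /andP[].
Qed.

(** The factor 2 comes from bounding the real and imaginary parts separately; it reappears in all
    later constants. *)
Lemma nm_cint a b g M : a <= b -> ccont a b g ->
  (forall x, a <= x <= b -> nm (g x : C) <= M) -> nm (cint a b g : C) <= 2 * (b - a) * M.
Proof.
move=> ab cg gM; apply: (le_trans (nm_cre_cim _)).
rewrite -mulrA mulr_natl mulr2n [_ * M]mulrC; apply: lerD; rewrite /cint ?cre_mk ?cim_mk.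
  apply: rint_norm_le => //; first exact: ccont_re.
  by move=> x /gM h; apply: le_trans h; exact: cre_le.
apply: rint_norm_le => //; first exact: ccont_im.
by move=> x /gM h; apply: le_trans h; exact: cim_le.
Qed.

Definition cder a b (F f : R -> C) := forall x, a <= x <= b -> forall e, 0 < e ->
  exists2 d, 0 < d & forall y, a <= y <= b -> `|y - x| < d ->
    nm (F y - F x - cofr (y - x) * f x : C) <= e * `|y - x|.

Lemma cre_cofrM r z : cre (cofr r * z) = r * cre z.
Proof. by rewrite creM /cre /cim /= mul0r subr0. Qed.
Lemma cim_cofrM r z : cim (cofr r * z) = r * cim z.
Proof. by rewrite cimM /cre /cim /= mul0r addr0. Qed.

Lemma cint_FTC a b F f : a <= b -> ccont a b f -> cder a b F f ->
  cint a b f = F b - F a.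
Proof.
move=> ab cf dF; apply: cplxP; rewrite ?creB ?cimB /cint ?cre_mk ?cim_mk.
  rewrite (@rint_FTC _ _ _ (cre \o F))//; first exact: ccont_re.
  move=> x xab e e0; have [d d0 dP] := dF x xab e e0; exists d => // y yab yd.
  by have := dP y yab yd; apply: le_trans; rewrite /= -cre_cofrM -!creB cre_le.
rewrite (@rint_FTC _ _ _ (cim \o F))//; first exact: ccont_im.
move=> x xab e e0; have [d d0 dP] := dF x xab e e0; exists d => // y yab yd.
by have := dP y yab yd; apply: le_trans; rewrite /= -cim_cofrM -!cimB cim_le.
Qed.

Lemma cder_cont a b F f : cder a b F f -> ccont a b F.
Proof.
move=> dF x xab e e0; have [d d0 dP] := dF x xab 1 ltr01.
pose K := nm (f x : C) + 1; have K0 : 0 < K by rewrite ltr_wpDl// nm_ge0.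
exists (Num.min d (e / K)); first by rewrite lt_min d0 divr_gt0.
move=> y yab; rewrite lt_min => /andP[yd ye].
have := dP y yab yd; rewrite mul1r => h.
rewrite -(subrK (cofr (y - x) * f x) (F y - F x)) (le_lt_trans (nmD _ _))//.
rewrite (@le_lt_trans _ _ (`|y - x| * K))//; last by rewrite -ltr_pdivlMr.
by rewrite nmM nm_cofr /K mulrDr mulr1 addrC lerD2l.
Qed.
End ComplexIntegral.

(** * Goursat's theorem *)

Section Goursat.
Variable R : realType.
Local Notation C := (Cplx R).
Local Notation ci := ('i%C : C).
Implicit Types (a b c d x y e : R) (f g : C -> C) (z w : C).

Definition cd f z k := forall e, 0 < e -> exists2 r : R, 0 < r &
  forall w, nm (w - z : C) < r -> nm (f w - f z - k * (w - z) : C) <= e * nm (w - z : C).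

Lemma cd_cont f z k : cd f z k -> forall e, 0 < e -> exists2 r : R, 0 < r &
  forall w, nm (w - z : C) < r -> nm (f w - f z : C) < e.
Proof.
move=> dF e e0; have [r r0 rP] := dF 1 ltr01.
pose K := nm (k : C) + 1; have K0 : 0 < K by rewrite ltr_wpDl// nm_ge0.
exists (Num.min r (e / K)); first by rewrite lt_min r0 divr_gt0.
move=> w; rewrite lt_min => /andP[wr we].
have := rP w wr; rewrite mul1r => h.
rewrite -(subrK (k * (w - z)) (f w - f z)) (le_lt_trans (nmD _ _))//.
rewrite (@le_lt_trans _ _ (nm (w - z : C) * K))//; last by rewrite -ltr_pdivlMr.
by rewrite [nm (k * _)]nmM /K [leRHS]mulrDr mulr1 addrC [nm k * _]mulrC lerD2l.
Qed.

Lemma mkcE x y : mkc x y = cofr x + ci * cofr y :> C.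
Proof.
by apply: cplxP; rewrite ?creD ?cimD ?creM ?cimM /cre /cim /=; ring.
Qed.

Lemma cplxE z : z = mkc (cre z) (cim z). Proof. exact: cplxP. Qed.

Lemma cofrB x y : cofr (x - y) = cofr x - cofr y :> C.
Proof. by apply: cplxP; rewrite ?creB ?cimB /cre /cim //= subrr. Qed.

Lemma mkc_subl x x' y : mkc x' y - mkc x y = cofr (x' - x) :> C.
Proof. by rewrite !mkcE cofrB; ring. Qed.

Lemma mkc_subr x y y' : mkc x y' - mkc x y = ci * cofr (y' - y) :> C.
Proof. by rewrite !mkcE cofrB; ring. Qed.

Lemma nm_mkc_subl x x' y : nm (mkc x' y - mkc x y : C) = `|x' - x|.
Proof. by rewrite mkc_subl nm_cofr. Qed.

Lemma nm_mkc_subr x y y' : nm (mkc x y' - mkc x y : C) = `|y' - y|.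
Proof. by rewrite mkc_subr nmM nm_i mul1r nm_cofr. Qed.

Definition hcont f a b y := ccont a b (fun x => f (mkc x y)).
Definition vcont f c d x := ccont c d (fun y => f (mkc x y)).
(** Continuity is asked on the boundary alone, since the integrands may be singular inside. *)
Definition edges f a b c d := [/\ hcont f a b c, hcont f a b d, vcont f c d b & vcont f c d a].

(** Counterclockwise contour integral: bottom minus top, plus [i] times right minus left, as
    [dz = i dy] on vertical edges. *)
Definition rectint f a b c d : C :=
  cint a b (fun x => f (mkc x c)) - cint a b (fun x => f (mkc x d))
  + ci * (cint c d (fun y => f (mkc b y)) - cint c d (fun y => f (mkc a y))).

Lemma cd_hcont f a b y : (forall x, a <= x <= b -> exists k, cd f (mkc x y) k) -> hcont f a b y.
Proof.
move=> h x xab e e0; have [k /cd_cont/(_ e e0)[r r0 rP]] := h x xab.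
by exists r => // x' _ x'r; apply: rP; rewrite nm_mkc_subl.
Qed.

Lemma cd_vcont f c d x : (forall y, c <= y <= d -> exists k, cd f (mkc x y) k) -> vcont f c d x.
Proof.
move=> h y yab e e0; have [k /cd_cont/(_ e e0)[r r0 rP]] := h y yab.
by exists r => // x' _ x'r; apply: rP; rewrite nm_mkc_subr.
Qed.

Lemma rectintD f g a b c d : edges f a b c d -> edges g a b c d ->
  rectint (fun w => f w + g w) a b c d = rectint f a b c d + rectint g a b c d.
Proof.
by move=> [f1 f2 f3 f4] [g1 g2 g3 g4]; rewrite /rectint !cintD//; ring.
Qed.

Lemma rectintZ f k a b c d : edges f a b c d ->
  rectint (fun w => k * f w) a b c d = k * rectint f a b c d.
Proof.
by move=> [f1 f2 f3 f4]; rewrite /rectint !cintZ//; ring.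
Qed.

Lemma edgesD f g a b c d : edges f a b c d -> edges g a b c d ->
  edges (fun w => f w + g w) a b c d.
Proof. by move=> [f1 f2 f3 f4] [g1 g2 g3 g4]; split; apply: ccontD. Qed.

Lemma edgesM f g a b c d : edges f a b c d -> edges g a b c d ->
  edges (fun w => f w * g w) a b c d.
Proof. by move=> [f1 f2 f3 f4] [g1 g2 g3 g4]; split; apply: ccontM. Qed.

Lemma edges_cst k a b c d : edges (fun=> k) a b c d.
Proof. by split; apply: ccont_cst. Qed.

Lemma edgesZ f k a b c d : edges f a b c d -> edges (fun w => k * f w) a b c d.
Proof. by move=> h; apply: edgesM => //; exact: edges_cst. Qed.

Lemma eq_rectint f g a b c d : a <= b -> c <= d ->
  (forall x y, a <= x <= b -> c <= y <= d -> [|| x == a, x == b, y == c | y == d] ->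
    f (mkc x y) = g (mkc x y)) ->
  rectint f a b c d = rectint g a b c d.
Proof.
move=> ab cd' fg; have aa : a <= a <= b by rewrite lexx.
have bb : a <= b <= b by rewrite lexx ab.
have cc : c <= c <= d by rewrite lexx.
have dd : c <= d <= d by rewrite lexx cd'.
congr (_ - _ + _ * (_ - _)); apply: eq_cint => t tt; rewrite fg// ?eqxx ?orbT//.
Qed.

Lemma rectint_le f a b c d M : a <= b -> c <= d -> edges f a b c d ->
  (forall x y, a <= x <= b -> c <= y <= d -> [|| x == a, x == b, y == c | y == d] ->
    nm (f (mkc x y) : C) <= M) ->
  nm (rectint f a b c d : C) <= 4 * ((b - a) + (d - c)) * M.
Proof.
move=> ab cd' [f1 f2 f3 f4] fM; have aa : a <= a <= b by rewrite lexx.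
have bb : a <= b <= b by rewrite lexx ab.
have cc : c <= c <= d by rewrite lexx.
have dd : c <= d <= d by rewrite lexx cd'.
apply: (le_trans (nmD _ _)); rewrite nmM nm_i mul1r.
have h1 : nm (cint a b (fun x => f (mkc x c)) : C) <= 2 * (b - a) * M.
  by apply: nm_cint => // x xab; apply: fM; rewrite ?eqxx ?orbT.
have h2 : nm (cint a b (fun x => f (mkc x d)) : C) <= 2 * (b - a) * M.
  by apply: nm_cint => // x xab; apply: fM; rewrite ?eqxx ?orbT.
have h3 : nm (cint c d (fun x => f (mkc b x)) : C) <= 2 * (d - c) * M.
  by apply: nm_cint => // x xab; apply: fM; rewrite ?eqxx ?orbT.
have h4 : nm (cint c d (fun x => f (mkc a x)) : C) <= 2 * (d - c) * M.
  by apply: nm_cint => // x xab; apply: fM; rewrite ?eqxx ?orbT.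
have k1 := nmB (cint a b (fun x => f (mkc x c))) (cint a b (fun x => f (mkc x d))).
have k2 := nmB (cint c d (fun x => f (mkc b x))) (cint c d (fun x => f (mkc a x))).
lra.
Qed.

Lemma rectint_splitx f a m b c d : a <= m -> m <= b ->
  hcont f a b c -> hcont f a b d ->
  rectint f a b c d = rectint f a m c d + rectint f m b c d.
Proof.
move=> am mb h1 h2; rewrite /rectint.
by rewrite (cint_split am mb h1) (cint_split am mb h2); ring.
Qed.

Lemma rectint_splity f a b c m d : c <= m -> m <= d ->
  vcont f c d a -> vcont f c d b ->
  rectint f a b c d = rectint f a b c m + rectint f a b m d.
Proof.
move=> cm md h1 h2; rewrite /rectint.
by rewrite (cint_split cm md h1) (cint_split cm md h2); ring.
Qed.

(** An affine function has the quadratic primitive [P], and the values of [P] at the four corners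
    cancel. *)
Lemma rectint_affine k l z0 a b c d : a <= b -> c <= d ->
  rectint (fun w => k + l * (w - z0)) a b c d = 0.
Proof.
move=> ab cd'; pose f w : C := k + l * (w - z0).
pose P w : C := k * w + l * (w - z0) ^+ 2 / 2.
have dP z : cd P z (f z).
  move=> e e0; pose K := nm (l / 2 : C) + 1.
  have K0 : 0 < K by rewrite ltr_wpDl// nm_ge0.
  exists (e / K) => [|w wr]; first by rewrite divr_gt0.
  rewrite (_ : P w - P z - f z * (w - z) = l / 2 * (w - z) * (w - z)); last first.
    by rewrite /P /f; field.
  rewrite 2!nmM ler_wpM2r ?nm_ge0//.
  apply: (@le_trans _ _ (K * nm (w - z : C))); first by rewrite ler_wpM2r ?nm_ge0// lerDl.
  by rewrite mulrC -ler_pdivlMr// ltW.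
have df z : exists k, cd f z k.
  exists l => e e0; exists 1 => // w _.
  by rewrite (_ : f w - f z - l * (w - z) = 0) ?nm0 ?mulr_ge0 ?nm_ge0 ?ltW// /f; ring.
have H y : cint a b (fun x => f (mkc x y)) = P (mkc b y) - P (mkc a y).
  apply: (@cint_FTC _ _ _ (fun x => P (mkc x y))) => //; first exact: cd_hcont.
  move=> x _ e e0; have [r r0 rP] := dP (mkc x y) e e0; exists r => // x' _ x'r.
  by have := rP (mkc x' y); rewrite nm_mkc_subl mkc_subl mulrC; exact.
have V x : ci * cint c d (fun y => f (mkc x y)) = P (mkc x d) - P (mkc x c).
  rewrite -cintZ; last exact: cd_vcont.
  apply: (@cint_FTC _ _ _ (fun y => P (mkc x y))) => //.
    by apply: ccontZ; exact: cd_vcont.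
  move=> y _ e e0; have [r r0 rP] := dP (mkc x y) e e0; exists r => // y' _ y'r.
  have := rP (mkc x y'); rewrite nm_mkc_subr mkc_subr => /(_ y'r); apply: le_trans.
  by rewrite (_ : cofr (y' - y) * _ = f (mkc x y) * (ci * cofr (y' - y))) //; ring.
rewrite -/f /rectint !H mulrBr !V; ring.
Qed.

Lemma pow2_small (K r : R) : 0 <= K -> 0 < r -> exists n : nat, K / 2 ^+ n < r.
Proof.
move=> K0 r0; exists (Num.bound (K / r)).
rewrite ltr_pdivrMr ?exprn_gt0// -ltr_pdivrMl// mulrC.
apply: (lt_trans (archi_boundP _)); first by rewrite divr_ge0// ltW.
by rewrite -natrX ltr_nat ltn_expl.
Qed.

Lemma nested_point (u v : nat -> R) : (forall n, u n <= u n.+1) -> (forall n, v n.+1 <= v n) ->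
  (forall n, u n <= v n) -> exists x, forall n, u n <= x <= v n.
Proof.
move=> uS vS uv.
have um : {homo u : m n / (m <= n)%N >-> m <= n} by apply: homo_leq => //; exact: le_trans.
have vm : {homo v : m n / (m <= n)%N >-> n <= m}.
  by apply: homo_leq => // x y z /[swap]; exact: le_trans.
have uvm m n : u m <= v n.
  apply: (le_trans (um _ _ (leq_maxl m n))); apply: (le_trans (uv _)).
  exact: vm (leq_maxr m n).
exists (sup (range u)) => n; apply/andP; split.
  apply: ub_le_sup; last by exists n.
  by exists (v 0%N) => _ [m _ <-].
by apply: ge_sup; [exists (u 0%N), 0%N|move=> _ [m _ <-]].
Qed.

(** Bisection: some quarter always carries at least a quarter of the integral. At the common point
    of the nested rectangles the affine part of [f] integrates to zero, and the rest is small
    compared with the squared size [4 ^- n]. *)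
Lemma goursat f a b c d : a <= b -> c <= d ->
  (forall x y, a <= x <= b -> c <= y <= d -> exists k, cd f (mkc x y) k) ->
  rectint f a b c d = 0.
Proof.
move=> ab cd' df; apply: contrapT => /eqP nz.
have eta0 : 0 < nm (rectint f a b c d : C) by rewrite nm_gt0.
set eta := nm _ in eta0.
pose good (r : R * R * R * R) := let: (a', b', c', d') := r in
  [/\ a <= a', a' <= b', b' <= b & [/\ c <= c', c' <= d' & d' <= d]].
pose P (r : R * R * R * R) := let: (a', b', c', d') := r in nm (rectint f a' b' c' d' : C).
pose quarter (r s : R * R * R * R) := let: (a', b', c', d') := r in
  let: (a1, b1, c1, d1) := s in
  [/\ [/\ a' <= a1, b1 <= b', c' <= c1 & d1 <= d'],
   b1 - a1 = (b' - a') / 2, d1 - c1 = (d' - c') / 2 & P r <= 4 * P s].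
(* The guard [good r] stays under the existential so that [choice] yields a total map, which can be
   iterated. *)
have step r : exists s, good r -> good s /\ quarter r s.
  case: r => [[[a' b'] c'] d'].
  have [[aa ab' bb [cc cd1 dd]]|ng] := pselect (good (a', b', c', d')); last by exists (a', b', c', d').
  pose m := (a' + b') / 2; pose n := (c' + d') / 2.
  have am : a' <= m by rewrite /m; lra.
  have mb : m <= b' by rewrite /m; lra.
  have cn : c' <= n by rewrite /n; lra.
  have nd : n <= d' by rewrite /n; lra.
  have ex : m - a' = (b' - a') / 2 by rewrite /m; lra.
  have ex' : b' - m = (b' - a') / 2 by rewrite /m; lra.
  have ey : n - c' = (d' - c') / 2 by rewrite /n; lra.
  have ey' : d' - n = (d' - c') / 2 by rewrite /n; lra.
  have key a1 b1 c1 d1 : a' <= a1 -> a1 <= b1 -> b1 <= b' -> b1 - a1 = (b' - a') / 2 ->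
      c' <= c1 -> c1 <= d1 -> d1 <= d' -> d1 - c1 = (d' - c') / 2 ->
      P (a', b', c', d') <= 4 * P (a1, b1, c1, d1) ->
      exists s, good (a', b', c', d') -> good s /\ quarter (a', b', c', d') s.
    move=> h1 h2 h3 h4 k1 k2 k3 k4 h; exists (a1, b1, c1, d1) => _.
    split; last by split=> //; split.
    split; [exact: le_trans h1|done|exact: le_trans bb|].
    split; [exact: le_trans k1|done|exact: le_trans dd].
  have hc y : c <= y <= d -> hcont f a' b' y.
    by move=> yy; apply: cd_hcont => x /andP[? ?]; apply: df => //; lra.
  have vc x : a <= x <= b -> vcont f c' d' x.
    by move=> xx; apply: cd_vcont => y /andP[? ?]; apply: df => //; lra.
  have E : rectint f a' b' c' d' = (rectint f a' m c' n + rectint f a' m n d')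
       + (rectint f m b' c' n + rectint f m b' n d').
    have c'I : c <= c' <= d by lra.
    have d'I : c <= d' <= d by lra.
    rewrite (rectint_splitx am mb (hc c' c'I) (hc d' d'I)).
    by rewrite !(rectint_splity cn nd)//; apply: vc; lra.
  have tr : P (a', b', c', d') <= (P (a', m, c', n) + P (a', m, n, d'))
       + (P (m, b', c', n) + P (m, b', n, d')).
    by rewrite /P E; apply: (le_trans (nmD _ _)); apply: lerD; exact: nmD.
  have [h1|h1] := leP (P (a', b', c', d')) (4 * P (a', m, c', n)).
    exact: key h1.
  have [h2|h2] := leP (P (a', b', c', d')) (4 * P (a', m, n, d')).
    exact: key h2.
  have [h3|h3] := leP (P (a', b', c', d')) (4 * P (m, b', c', n)).
    exact: key h3.
  apply: (key m b' n d') => //; move: tr h1 h2 h3.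
  set p0 := P _; set p1 := P _; set p2 := P _; set p3 := P _; set p4 := P _.
  by move: p0 p1 p2 p3 p4 => p0 p1 p2 p3 p4; clear; lra.
have [s sP] := choice step.
pose r n := iter n s (a, b, c, d).
have gr n : good (r n).
  elim: n => [|n ih]; first by split => //; split.
  by have [] := sP _ ih.
have qr n : quarter (r n) (r n.+1) by have [] := sP _ (gr n).
pose u n := (r n).1.1.1; pose v n := (r n).1.1.2; pose p n := (r n).1.2; pose q n := (r n).2.
have rE n : r n = (u n, v n, p n, q n) by rewrite /u /v /p /q; case: (r n) => [[[]]].
have size n : [/\ v n - u n = (b - a) / 2 ^+ n, q n - p n = (d - c) / 2 ^+ n &
    eta <= 4 ^+ n * P (r n)].
  elim: n => [|n [ih1 ih2 ih3]]; first by rewrite !expr0 !divr1 mul1r.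
  have := qr n; rewrite !rE => -[_ -> ->]; rewrite -!rE => h.
  rewrite ih1 ih2 !exprSr !invfM !mulrA; split=> //.
  by apply: (le_trans ih3); rewrite -mulrA ler_wpM2l// exprn_ge0.
have [x0 x0P] : exists x0, forall n, u n <= x0 <= v n.
  apply: nested_point => n; [have := qr n|have := qr n|have := gr n]; rewrite !rE.
  - by move=> [[]].
  - by move=> [[]].
  - by move=> [].
have [y0 y0P] : exists x0, forall n, p n <= x0 <= q n.
  apply: nested_point => n; [have := qr n|have := qr n|have := gr n]; rewrite !rE.
  - by move=> [[]].
  - by move=> [[]].
  - by move=> [_ _ _ []].
have [k dk] : exists k, cd f (mkc x0 y0) k.
  by apply: df; [exact: (x0P 0%N)|exact: (y0P 0%N)].
pose L := (b - a) + (d - c).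
have L0 : 0 <= L by rewrite /L; lra.
(* On the rectangle of stage [n] the bound is [4 * (L / 2 ^+ n) * (e * (L / 2 ^+ n))]; times
   [4 ^+ n] this is [e * (4 * L * L)], which has to be less than [eta]. *)
pose e := eta / (4 * L * L + 1) / 2.
have LL : 0 <= 4 * L * L by rewrite !mulr_ge0.
have e0 : 0 < e by rewrite !divr_gt0// ltr_wpDl.
have [rr r0 rP] := dk e e0.
have [n nP] := pow2_small L0 r0.
have [s1 s2 s3] := size n.
have /andP[x01 x02] := x0P n; have /andP[y01 y02] := y0P n.
pose g w := f w - (f (mkc x0 y0) + k * (w - mkc x0 y0)).
have := gr n; rewrite rE => -[g1 g2 g3 [g4 g5 g6]].
have ef : edges f (u n) (v n) (p n) (q n).
  split; [apply: cd_hcont|apply: cd_hcont|apply: cd_vcont|apply: cd_vcont] => t /andP[? ?];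
    apply: df; lra.
have eaff : edges (fun w => f (mkc x0 y0) + k * (w - mkc x0 y0)) (u n) (v n) (p n) (q n).
  have da z : exists l, cd (fun w => f (mkc x0 y0) + k * (w - mkc x0 y0)) z l.
    exists k => e' e'0; exists 1 => // w _.
    rewrite (_ : _ - _ - _ = 0) ?nm0 ?mulr_ge0 ?nm_ge0 ?ltW//; ring.
  by split; [apply: cd_hcont|apply: cd_hcont|apply: cd_vcont|apply: cd_vcont] => t _.
have eg : edges g (u n) (v n) (p n) (q n).
  have := edgesD ef (edgesZ (-1) eaff).
  by congr edges; apply/funext => w; rewrite /g mulN1r.
have Pg : P (r n) = nm (rectint g (u n) (v n) (p n) (q n) : C).
  rewrite rE /P; congr (nm (_ : C)).
  have fg : f = (fun w => g w + (f (mkc x0 y0) + k * (w - mkc x0 y0))).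
    by apply/funext => w; rewrite /g subrK.
  rewrite [in LHS]fg rectintD// rectint_affine//; exact: addr0.
have dist x y : u n <= x <= v n -> p n <= y <= q n ->
    nm (mkc x y - mkc x0 y0 : C) <= L / 2 ^+ n.
  move=> /andP[? ?] /andP[? ?].
  rewrite (_ : _ - _ = (mkc x y - mkc x0 y) + (mkc x0 y - mkc x0 y0)); last by ring.
  apply: (le_trans (nmD _ _)); rewrite nm_mkc_subl nm_mkc_subr /L mulrDl -s1 -s2.
  by apply: lerD; rewrite ler_norml; lra.
have bd : nm (rectint g (u n) (v n) (p n) (q n) : C)
     <= 4 * ((v n - u n) + (q n - p n)) * (e * (L / 2 ^+ n)).
  apply: rectint_le => // x y xx yy _; rewrite /g opprD addrA.
  have dd := dist x y xx yy.
  apply: (le_trans (rP _ (le_lt_trans dd nP))).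
  by rewrite ler_wpM2l// ltW.
have : eta <= 4 ^+ n * (4 * ((v n - u n) + (q n - p n)) * (e * (L / 2 ^+ n))).
  by apply: (le_trans s3); rewrite Pg ler_wpM2l// exprn_ge0.
rewrite s1 s2 -mulrDl -/L.
have p2 : 2 ^+ n != 0 :> R by rewrite expf_neq0.
have -> : 4 ^+ n = 2 ^+ n * 2 ^+ n :> R by rewrite -exprMn; congr (_ ^+ _); ring.
have -> : 2 ^+ n * 2 ^+ n * (4 * (L / 2 ^+ n) * (e * (L / 2 ^+ n))) = e * (4 * L * L).
  by field.
rewrite leNgt => /negP; apply.
have K0 : 0 < 4 * L * L + 1 by rewrite ltr_wpDl.
rewrite /e; apply: (@lt_trans _ _ (eta / (4 * L * L + 1) / 2 * (4 * L * L + 1))).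
  by rewrite ltr_pM2l ?ltrDl.
rewrite mulrAC divfK ?gt_eqF//; lra.
Qed.
End Goursat.

(** * Second order Taylor estimate in one variable *)

Section Taylor.
Variable R : realType.
Local Notation C := (Cplx R).
Local Notation ci := ('i%C : C).
Implicit Types (a b c d x y e : R) (f g : C -> C) (z w h : C).

Lemma diff_cd f z : differentiable f z -> cd f z ('d f z 1).
Proof.
move=> /diff_locally /eqaddoP /nm_littleoP h e /h[d d0 dP]; exists d => // w wd.
have E : 'd f z (w - z) = 'd f z 1 * (w - z).
  have -> : w - z = (w - z) *: (1 : C^o) by rewrite [RHS]mulr1.
  by rewrite linearZ /= [X in _ = _ * X]mulr1 mulrC.
by have := dP (w - z) wd; rewrite /= !fctE /= subrK opprD addrA E.
Qed.

Definition reg f a b c d x0 y0 := forall x y, a <= x <= b -> c <= y <= d ->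
  (x != x0) || (y != y0) -> exists k, cd f (mkc x y) k.

(* The singularity is weaker than a simple pole, so the integral over small
   squares around it tends to zero. *)
Definition weak_sing f z0 := forall e, 0 < e -> exists2 r : R, 0 < r &
  forall w, 0 < nm (w - z0 : C) < r -> nm (f w : C) * nm (w - z0 : C) <= e.

Lemma goursat_sing f a b c d x0 y0 : a < x0 < b -> c < y0 < d ->
  reg f a b c d x0 y0 -> weak_sing f (mkc x0 y0) -> rectint f a b c d = 0.
Proof.
move=> /andP[ax xb] /andP[cy yd] df sf; apply: nm_eq0; apply/eqP.
rewrite eq_le nm_ge0 andbT; apply/ler_addgt0Pr => e e0; rewrite add0r.
(* [rectint_le] on a square of half-side [t] with bound [e / 16 / t] gives
   [4 * (2 t + 2 t) * (e / 16 / t) = e]. *)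
have e16 : 0 < e / 16 by rewrite divr_gt0.
have [r r0 rP] := sf _ e16.
(* Half-side of the small square. Its boundary points are within [2 t < r] of the singular point,
   hence in the range of [rP]. *)
pose t := Num.min (r / 3) (Num.min (Num.min (x0 - a) (b - x0)) (Num.min (y0 - c) (d - y0))).
have t0 : 0 < t by rewrite !lt_min !subr_gt0 ax xb cy yd divr_gt0.
have [tr [t1 t2] [t3 t4]] : [/\ t <= r / 3, (t <= x0 - a /\ t <= b - x0) & (t <= y0 - c /\ t <= d - y0)].
  by rewrite /t !ge_min !lexx ?orbT.
clearbody t.
have hc y : c <= y <= d -> y != y0 -> hcont f a b y.
  by move=> yy yn; apply: cd_hcont => x xx; apply: df => //; rewrite yn orbT.
have vc x : a <= x <= b -> x != x0 -> vcont f c d x.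
  by move=> yy yn; apply: cd_vcont => y xx; apply: df => //; rewrite yn.
have neq (u v : R) : u < v -> u != v /\ v != u.
  by move=> uv; rewrite lt_eqF// gt_eqF.
have cn : c != y0 by have [] := neq _ _ cy.
have dn : d != y0 by have [_] := neq _ _ yd.
have gr a1 b1 c1 d1 : a <= a1 -> a1 <= b1 -> b1 <= b -> c <= c1 -> c1 <= d1 -> d1 <= d ->
    (forall x y, a1 <= x <= b1 -> c1 <= y <= d1 -> (x != x0) || (y != y0)) ->
    rectint f a1 b1 c1 d1 = 0.
  move=> h1 h2 h3 h4 h5 h6 hn; apply: goursat => // x y xx yy; apply: df; [lra|lra|].
  exact: hn.
pose x1 := x0 - t; pose x2 := x0 + t; pose y1 := y0 - t; pose y2 := y0 + t.
have ax1 : a <= x1 by rewrite /x1; lra.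
have x12 : x1 <= x2 by rewrite /x1 /x2; lra.
have x2b : x2 <= b by rewrite /x2; lra.
have cy1 : c <= y1 by rewrite /y1; lra.
have y12 : y1 <= y2 by rewrite /y1 /y2; lra.
have y2d : y2 <= d by rewrite /y2; lra.
have x1x0 : x1 < x0 by rewrite /x1; lra.
have x2x0 : x0 < x2 by rewrite /x2; lra.
have y1y0 : y1 < y0 by rewrite /y1; lra.
have y2y0 : y0 < y2 by rewrite /y2; lra.
have ->: rectint f a b c d = rectint f x1 x2 y1 y2.
  have hcc : hcont f a b c by apply: hc => //; lra.
  have hcd : hcont f a b d by apply: hc => //; lra.
  have x1b : x1 <= b by exact: le_trans x2b.
  have y1d : y1 <= d by exact: le_trans y2d.
  have hS u : hcont f a b u -> hcont f x1 b u by exact: ccontS.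
  have v1 : vcont f c d x1 by apply: vc; [lra|by have [] := neq _ _ x1x0].
  have v2 : vcont f c d x2 by apply: vc; [lra|by have [_] := neq _ _ x2x0].
  have vS x : vcont f c d x -> vcont f y1 d x by exact: ccontS.
  rewrite (rectint_splitx ax1 x1b hcc hcd).
  rewrite (rectint_splitx x12 x2b (hS _ hcc) (hS _ hcd)).
  rewrite (rectint_splity cy1 y1d v1 v2).
  rewrite (rectint_splity y12 y2d (vS _ v1) (vS _ v2)).
  have -> : rectint f a x1 c d = 0.
    apply: gr => //; [lra|move=> x y /andP[_ xx] _].
    by have [-> _] := neq _ _ (le_lt_trans xx x1x0).
  have -> : rectint f x2 b c d = 0.
    apply: gr => //; [lra|lra|move=> x y /andP[xx _] _].
    by have [_ ->] := neq _ _ (lt_le_trans x2x0 xx).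
  have -> : rectint f x1 x2 c y1 = 0.
    apply: gr => // x y _ /andP[_ xx].
    by have [-> _] := neq _ _ (le_lt_trans xx y1y0); rewrite orbT.
  have -> : rectint f x1 x2 y2 d = 0.
    apply: gr => //; [lra|move=> x y _ /andP[xx _]].
    by have [_ ->] := neq _ _ (lt_le_trans y2y0 xx); rewrite orbT.
  by rewrite !add0r !addr0.
have bdn x y : [|| x == x1, x == x2, y == y1 | y == y2] -> t <= `|x - x0| \/ t <= `|y - y0|.
  by case/or4P => /eqP ->; [left|left|right|right]; rewrite /x1 /x2 /y1 /y2 ler_normr; lra.
have bd : nm (rectint f x1 x2 y1 y2 : C) <= 4 * ((x2 - x1) + (y2 - y1)) * (e / 16 / t).
  apply: rectint_le => //.
    split; [apply: cd_hcont|apply: cd_hcont|apply: cd_vcont|apply: cd_vcont] => s ss; (apply: df; [lra|lra|]).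
    - by have [-> _] := neq _ _ y1y0; rewrite orbT.
    - by have [_ ->] := neq _ _ y2y0; rewrite orbT.
    - by have [_ ->] := neq _ _ x2x0.
    - by have [-> _] := neq _ _ x1x0.
  move=> x y xx yy bxy.
  have wE : mkc x y - mkc x0 y0 = mkc (x - x0) (y - y0) :> C by [].
  have tw : t <= nm (mkc x y - mkc x0 y0 : C).
    rewrite wE; case: (bdn _ _ bxy) => h; apply: (le_trans h).
      exact: (cre_le (mkc (x - x0) (y - y0))).
    exact: (cim_le (mkc (x - x0) (y - y0))).
  have wr : nm (mkc x y - mkc x0 y0 : C) < r.
    rewrite wE; apply: (le_lt_trans (nm_cre_cim _)); rewrite cre_mk cim_mk.
    have : `|x - x0| <= t by rewrite ler_norml; move: xx; rewrite /x1 /x2; lra.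
    have : `|y - y0| <= t by rewrite ler_norml; move: yy; rewrite /y1 /y2; lra.
    lra.
  rewrite ler_pdivlMr//; apply: (@le_trans _ _ (nm (f (mkc x y)) * nm (mkc x y - mkc x0 y0))).
    by rewrite ler_wpM2l ?nm_ge0.
  by apply: rP; rewrite wr (lt_le_trans t0 tw).
apply: (le_trans bd); rewrite /x1 /x2 /y1 /y2.
rewrite (_ : 4 * _ * _ = e) //; field; exact: lt0r_neq0.
Qed.

(** A vertical or horizontal line strictly between the two points cuts the rectangle into two pieces
    with one singular point each. *)
Lemma goursat_sing2 f a b c d x1 y1 x2 y2 :
  a < x1 < b -> c < y1 < d -> a < x2 < b -> c < y2 < d -> (x1 != x2) || (y1 != y2) ->
  (forall x y, a <= x <= b -> c <= y <= d -> (x != x1) || (y != y1) ->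
     (x != x2) || (y != y2) -> exists k, cd f (mkc x y) k) ->
  weak_sing f (mkc x1 y1) -> weak_sing f (mkc x2 y2) -> rectint f a b c d = 0.
Proof.
have splx u1 v1 u2 v2 : a < u1 < b -> c < v1 < d -> a < u2 < b -> c < v2 < d -> u1 < u2 ->
    (forall x y, a <= x <= b -> c <= y <= d -> (x != u1) || (y != v1) ->
     (x != u2) || (y != v2) -> exists k, cd f (mkc x y) k) ->
    weak_sing f (mkc u1 v1) -> weak_sing f (mkc u2 v2) -> rectint f a b c d = 0.
  move=> h1 h2 h3 h4 uu df s1 s2.
  pose m := (u1 + u2) / 2.
  have [m1 m2] : u1 < m /\ m < u2 by rewrite /m; lra.
  clearbody m.
  have am : a <= m by lra. have mb : m <= b by lra.
  rewrite (rectint_splitx am mb); first last.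
  - by apply: cd_hcont => x xx; apply: df => //; [lra|rewrite orbC; apply/orP; left|rewrite orbC; apply/orP; left]; lra.
  - by apply: cd_hcont => x xx; apply: df => //; [lra|rewrite orbC; apply/orP; left|rewrite orbC; apply/orP; left]; lra.
  rewrite (@goursat_sing f a m c d u1 v1)// ?add0r; last 2 first.
  - lra.
  - move=> x y xx yy n; apply: df => //; [lra|apply/orP; left; lra].
  rewrite (@goursat_sing f m b c d u2 v2)//; first by lra.
  move=> x y xx yy n; apply: df => //; [lra|apply/orP; left; lra].
have sply u1 v1 u2 v2 : a < u1 < b -> c < v1 < d -> a < u2 < b -> c < v2 < d -> v1 < v2 ->
    (forall x y, a <= x <= b -> c <= y <= d -> (x != u1) || (y != v1) ->
     (x != u2) || (y != v2) -> exists k, cd f (mkc x y) k) ->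
    weak_sing f (mkc u1 v1) -> weak_sing f (mkc u2 v2) -> rectint f a b c d = 0.
  move=> h1 h2 h3 h4 uu df s1 s2.
  pose m := (v1 + v2) / 2.
  have [m1 m2] : v1 < m /\ m < v2 by rewrite /m; lra.
  clearbody m.
  have am : c <= m by lra. have mb : m <= d by lra.
  rewrite (rectint_splity am mb); first last.
  - by apply: cd_vcont => x xx; apply: df => //; [lra|apply/orP; left|apply/orP; left]; lra.
  - by apply: cd_vcont => x xx; apply: df => //; [lra|apply/orP; left|apply/orP; left]; lra.
  rewrite (@goursat_sing f a b c m u1 v1)// ?add0r; last 2 first.
  - lra.
  - move=> x y xx yy n; apply: df => //; [lra|apply/orP; right; lra].
  rewrite (@goursat_sing f a b m d u2 v2)//; first by lra.
  move=> x y xx yy n; apply: df => //; [lra|apply/orP; right; lra].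
move=> h1 h2 h3 h4 n df s1 s2.
have df' x y : a <= x <= b -> c <= y <= d -> (x != x2) || (y != y2) ->
     (x != x1) || (y != y1) -> exists k, cd f (mkc x y) k by move=> *; exact: df.
case/orP: n => /lt_total /orP[n|n].
- exact: (splx x1 y1 x2 y2).
- exact: (splx x2 y2 x1 y1).
- exact: (sply x1 y1 x2 y2).
- exact: (sply x2 y2 x1 y1).
Qed.

Local Notation SQ f := (rectint f (-3) 3 (-3) 3).

Lemma rint_ge a b (f : R -> R) m : a <= b -> rcont a b f -> (forall x, a <= x <= b -> m <= f x) ->
  m * (b - a) <= rint a b f.
Proof. by move=> ab cf h; rewrite -rint_cst//; apply: rint_le => //; exact: rcont_cst. Qed.

Lemma rint_lecst a b (f : R -> R) m : a <= b -> rcont a b f -> (forall x, a <= x <= b -> f x <= m) ->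
  rint a b f <= m * (b - a).
Proof. by move=> ab cf h; rewrite -rint_cst//; apply: rint_le => //; exact: rcont_cst. Qed.

Lemma diff_sub_id (h w : C) : differentiable (fun w : C => w - h : C) w.
Proof. by apply: differentiableB => //; exact: differentiable_cst. Qed.

Lemma diff_inv_sub (h w : C) : w != h -> differentiable (fun w : C => (w - h)^-1 : C) w.
Proof.
move=> wh; apply: (@differentiableV _ _ (fun w : C => w - h : C)).
  exact: diff_sub_id.
by rewrite subr_eq0.
Qed.

Lemma bdry_neq h x y : nm (h : C) <= 1 -> [|| x == -3, x == 3, y == -3 | y == 3] -> mkc x y != h.
Proof.
move=> h1 bxy; apply: contraTneq h1 => <-; rewrite -ltNge.
case/or4P: bxy => /eqP ->.
- by apply: lt_le_trans (cre_le _); rewrite cre_mk normrN ger0_norm//; lra.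
- by apply: lt_le_trans (cre_le _); rewrite cre_mk ger0_norm//; lra.
- by apply: lt_le_trans (cim_le _); rewrite cim_mk normrN ger0_norm//; lra.
- by apply: lt_le_trans (cim_le _); rewrite cim_mk ger0_norm//; lra.
Qed.

Lemma edges_sq f : (forall x y, -3 <= x <= 3 -> -3 <= y <= 3 ->
   [|| x == -3, x == 3, y == -3 | y == 3] -> differentiable f (mkc x y)) -> edges f (-3) 3 (-3) 3.
Proof.
move=> df; have i33 : -3 <= 3 :> R by apply: (@le_trans _ _ 0); rewrite ?oppr_le0 ler0n.
have I1 : (-3 <= -3 :> R) && (-3 <= 3 :> R) by rewrite lexx i33.
have I2 : (-3 <= 3 :> R) && (3 <= 3 :> R) by rewrite lexx i33.
split; [apply: cd_hcont|apply: cd_hcont|apply: cd_vcont|apply: cd_vcont] => s ss;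
  (eexists; apply: diff_cd; apply: df => //; rewrite eqxx ?orbT//).
Qed.

(** The integral has imaginary part [2 pi], but a lower bound suffices to divide by it. On each edge
    the relevant component has constant sign and size at least [1 / 16], because
    [u / (u ^+ 2 + v ^+ 2) >= 1 / 16] for [2 <= u <= 4] and [-4 <= v <= 4]; four edges of length 6
    give [24 / 16]. *)
Lemma winding_ge h : nm (h : C) <= 1 -> 1 <= nm (SQ (fun w => (w - h)^-1) : C).
Proof.
move=> h1; have [c1 c2 c3 c4] : edges (fun w => (w - h)^-1) (-3) 3 (-3) 3.
  by apply: edges_sq => x y _ _ bxy; apply: diff_inv_sub; exact: bdry_neq.
have := le_trans (cre_le _) h1; have := le_trans (cim_le _) h1.
case: h h1 c1 c2 c3 c4 => p q h1 c1 c2 c3 c4; rewrite cre_mk cim_mk !ler_norml => q1 p1.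
apply: le_trans (cim_le _); apply: le_trans (ler_norm _).
have cimci z : cim (ci * z) = cre z by rewrite cimM /cre /cim /=; ring.
rewrite /rectint cimD cimB cimci creB /cint !cim_mk !cre_mk.
have inv x y : (mkc x y - mkc p q)^-1 =
    mkc ((x - p) / ((x - p) ^+ 2 + (y - q) ^+ 2)) (- ((y - q) / ((x - p) ^+ 2 + (y - q) ^+ 2))) :> C.
  by [].
have bnd (u v : R) : 2 <= u -> u <= 4 -> -4 <= v -> v <= 4 -> 1 / 16 <= u / (u ^+ 2 + v ^+ 2).
  move=> u2 u4 v4 v4'; have s0 : 0 < u ^+ 2 + v ^+ 2.
    have u0 : 0 < u by lra.
    by have := sqr_ge0 v; have := exprn_gt0 2 u0; lra.
  rewrite ler_pdivlMr// !expr2.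
  have k1 : 0 <= u * (4 - u) by rewrite mulr_ge0; lra.
  have k2 : 0 <= (4 - v) * (4 + v) by rewrite mulr_ge0; lra.
  lra.
have i33 : -3 <= 3 :> R by apply: (@le_trans _ _ 0); rewrite ?oppr_le0 ler0n.
have b1 := @rint_ge _ _ _ (1 / 16) i33 (ccont_im c1).
have b2 := @rint_lecst _ _ _ (- (1 / 16)) i33 (ccont_im c2).
have b3 := @rint_ge _ _ _ (1 / 16) i33 (ccont_re c3).
have b4 := @rint_lecst _ _ _ (- (1 / 16)) i33 (ccont_re c4).
apply: (@le_trans _ _ ((1 / 16 * (3 - -3) - - (1 / 16) * (3 - -3))
   + (1 / 16 * (3 - -3) - - (1 / 16) * (3 - -3)))); first lra.
apply: lerD; apply: lerB.
- apply: b1 => x xx.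
  rewrite [leRHS](_ : _ = - ((-3 - q) / ((x - p) ^+ 2 + (-3 - q) ^+ 2)))//.
  by rewrite -mulNr -[(-3 - q) ^+ 2]sqrrN opprB [X in _ <= _ / X]addrC; apply: bnd; lra.
- apply: b2 => x xx.
  rewrite [leLHS](_ : _ = - ((3 - q) / ((x - p) ^+ 2 + (3 - q) ^+ 2)))//.
  by rewrite lerN2 [X in _ <= _ / X]addrC; apply: bnd; lra.
- apply: b3 => x xx.
  rewrite [leRHS](_ : _ = ((3 - p) / ((3 - p) ^+ 2 + (x - q) ^+ 2)))//.
  by apply: bnd; lra.
- apply: b4 => x xx.
  rewrite [leLHS](_ : _ = ((-3 - p) / ((-3 - p) ^+ 2 + (x - q) ^+ 2)))//.
  by rewrite lerNr -mulNr -[(-3 - p) ^+ 2]sqrrN opprB; apply: bnd; lra.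
Qed.
End Taylor.

(** * Cauchy bound and Taylor remainder on the disc of radius 7 *)

Section Taylor2.
Variable R : realType.
Local Notation C := (Cplx R).
Local Notation ci := ('i%C : C).
Implicit Types (a b c d x y e : R) (f g : C -> C) (z w h : C).
Local Notation SQ f := (rectint f (-3) 3 (-3) 3).

Lemma bdry_nm x y : [|| x == -3, x == 3, y == -3 | y == 3] -> 3 <= nm (mkc x y : C).
Proof.
case/or4P => /eqP ->.
- by apply: le_trans (cre_le _); rewrite cre_mk normrN ger0_norm.
- by apply: le_trans (cre_le _); rewrite cre_mk ger0_norm.
- by apply: le_trans (cim_le _); rewrite cim_mk normrN ger0_norm.
- by apply: le_trans (cim_le _); rewrite cim_mk ger0_norm.
Qed.

Lemma sq_nm x y : -3 <= x <= 3 -> -3 <= y <= 3 -> nm (mkc x y : C) <= 6.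
Proof.
move=> xx yy; apply: (le_trans (nm_cre_cim _)); rewrite cre_mk cim_mk.
have : `|x| <= 3 by rewrite ler_norml.
have : `|y| <= 3 by rewrite ler_norml.
lra.
Qed.

Lemma mkc_neq x y h : (x != cre h) || (y != cim h) -> mkc x y != h.
Proof. by apply: contraTneq => <-; rewrite cre_mk cim_mk !eqxx. Qed.

Section F.
Variables (f : C -> C) (M : R).
Hypothesis df : forall w, nm (w : C) < 7 -> differentiable f w.
Hypothesis fM : forall w, nm (w : C) < 7 -> nm (f w : C) <= M.

Let f1 := 'd f 0 1 : C.

(** The reason for the radius 7: the square of half-side 3, which surrounds the unit disc at
    distance at least 2, has points of modulus at most 6. *)
Let sq_lt7 x y : -3 <= x <= 3 -> -3 <= y <= 3 -> nm (mkc x y : C) < 7.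
Proof. by move=> xx yy; apply: le_lt_trans (sq_nm xx yy) _; lra. Qed.

Let zero7 : nm (0 : C) < 7. Proof. by rewrite nm0. Qed.

Let cd0 : cd f 0 f1. Proof. by apply: diff_cd; exact: df. Qed.

Let M0 : 0 <= M. Proof. exact: le_trans (nm_ge0 _) (fM zero7). Qed.

Let mkc00 : mkc 0 0 = 0 :> C. Proof. exact: cplxP. Qed.

(** Removing the first order part leaves [g], less singular at 0 than a simple pole, so its integral
    vanishes. Hence [f1] times the integral of [1 / w] equals the integral of [(f w - f 0) / w^2],
    which is bounded on the square. *)
Lemma cauchy_d1 : nm (f1 : C) <= 11 * M.
Proof.
pose g w : C := (f w - f 0 - f1 * w) / (w * w).
have gd w : nm (w : C) < 7 -> w != 0 -> differentiable g w.
  move=> w7 w0; apply: differentiableM.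
    apply: differentiableB.
      by apply: differentiableB; [exact: df|exact: differentiable_cst].
    by apply: differentiableM => //; exact: differentiable_cst.
  by apply: (@differentiableV _ _ (fun w : C => w * w : C)); rewrite ?mulf_neq0//;
    apply: differentiableM.
have g0 : SQ g = 0.
  have i03 : (-3 < 0 :> R) && (0 < 3 :> R) by rewrite oppr_lt0 ltr0n.
  apply: (goursat_sing (x0 := 0) (y0 := 0)) => //.
    move=> x y xx yy n; eexists; apply: diff_cd; apply: gd; first exact: sq_lt7.
    by apply: mkc_neq.
  rewrite mkc00 => e e0; have [r r0 rP] := cd0 e0; exists r => // w; rewrite !subr0 => /andP[w0 wr].
  have := rP w; rewrite subr0 => /(_ wr) h.
  have wn : nm (w : C) != 0 by rewrite gt_eqF.
  rewrite /g nmM nmV nmM invfM mulrA -mulrA mulVf// mulr1 ler_pdivrMr//.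
have i33 : -3 <= 3 :> R by apply: (@le_trans _ _ 0); rewrite ?oppr_le0 ler0n.
have E : SQ (fun w => (f w - f 0) / (w * w)) = f1 * SQ (fun w => (w - 0)^-1).
  rewrite -rectintZ; last first.
    apply: edges_sq => x y _ _ bxy; apply: diff_inv_sub; apply: bdry_neq => //.
    by rewrite nm0.
  rewrite -[RHS]add0r -[X in _ = X + _]g0 -rectintD.
  - apply: eq_rectint => // x y _ _ bxy.
    have n0 : mkc x y != 0 by apply: bdry_neq => //; rewrite nm0.
    by rewrite /g subr0; field.
  - apply: edges_sq => x y xx yy bxy; apply: gd; first exact: sq_lt7.
    by apply: bdry_neq => //; rewrite nm0.
  - apply: edgesZ; apply: edges_sq => x y _ _ bxy; apply: diff_inv_sub; apply: bdry_neq => //.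
    by rewrite nm0.
(* Boundary points have modulus at least 3, whence the 9; then [4 * 12 * 2 / 9 < 11]. *)
have B : nm (SQ (fun w => (f w - f 0) / (w * w)) : C) <= 4 * ((3 - -3) + (3 - -3)) * (2 * M / 9).
  apply: rectint_le => //.
    apply: edges_sq => x y xx yy bxy.
    have n0 : mkc x y != 0 by apply: bdry_neq => //; rewrite nm0.
    apply: differentiableM.
      by apply: differentiableB; [apply: df; exact: sq_lt7|exact: differentiable_cst].
    by apply: (@differentiableV _ _ (fun w : C => w * w : C)); rewrite ?mulf_neq0//;
      apply: differentiableM.
  move=> x y xx yy bxy; have b3 := bdry_nm bxy.
  have p9 : 9 <= nm (mkc x y : C) * nm (mkc x y : C).
    by rewrite (_ : 9 = 3 * 3 :> R); [apply: ler_pM|ring].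
  rewrite nmM nmV nmM; apply: ler_pM; rewrite ?nm_ge0// ?invr_ge0 ?mulr_ge0 ?nm_ge0//.
    apply: (le_trans (nmB _ _)).
    by have := fM (sq_lt7 xx yy); have := fM zero7; lra.
  by rewrite lef_pV2 ?posrE// (lt_le_trans _ p9).
have W := @winding_ge R 0; rewrite nm0 ler01 in W; have {}W := W isT.
rewrite E nmM in B.
apply: (@le_trans _ _ (nm (f1 : C) * nm (SQ (fun w => (w - 0)^-1) : C))).
  by rewrite ler_peMr// nm_ge0.
apply: (le_trans B); move: M0; lra.
Qed.

(* With [c] chosen so that [f w - f 0 - f1 w - c w^2] vanishes at [w = h], its
   quotient by [w^2 (w - h)] has integral 0 around the square by Goursat, and
   [winding_ge] bounds the contribution of [c] from below. *)
Lemma taylor2 h : nm (h : C) <= 1 -> nm (f h - f 0 - f1 * h : C) <= 182 * M * nm (h : C) ^+ 2.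
Proof.
move=> h1; have [->|hn0] := eqVneq h 0.
  by rewrite mulr0 subr0 subrr nm0 expr0n mulr0.
have f1M := cauchy_d1.
have h0 : 0 < nm (h : C) by rewrite nm_gt0.
have h7 : nm (h : C) < 7 by apply: le_lt_trans h1 _; lra.
pose c : C := (f h - f 0 - f1 * h) / (h * h).
pose N w : C := f w - f 0 - f1 * w - c * (w * w).
pose g w : C := N w / (w * w * (w - h)).
have dlin w : differentiable (fun w : C => f1 * w : C) w.
  by apply: differentiableM => //; exact: differentiable_cst.
have dsq w : differentiable (fun w : C => w * w : C) w by apply: differentiableM.
have dN0 w : nm (w : C) < 7 -> differentiable (fun w => f w - f 0 - f1 * w : C) w.
  move=> w7; apply: differentiableB; last exact: dlin.
  by apply: differentiableB; [exact: df|exact: differentiable_cst].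
have dN w : nm (w : C) < 7 -> differentiable N w.
  move=> w7; apply: differentiableB; first exact: dN0.
  by apply: differentiableM => //; exact: differentiable_cst.
have dden w : w != 0 -> w != h -> differentiable (fun w : C => (w * w * (w - h))^-1 : C) w.
  move=> w0 wh; apply: (@differentiableV _ _ (fun w : C => w * w * (w - h) : C)).
    by apply: differentiableM => //; exact: diff_sub_id.
  by rewrite !mulf_neq0// subr_eq0.
have gd w : nm (w : C) < 7 -> w != 0 -> w != h -> differentiable g w.
  by move=> w7 w0 wh; apply: differentiableM; [exact: dN|exact: dden].
have Nh : N h = 0 by rewrite /N /c; field.
have i33 : -3 <= 3 :> R by apply: (@le_trans _ _ 0); rewrite ?oppr_le0 ler0n.
have i03 : (-3 < 0 :> R) && (0 < 3 :> R) by rewrite oppr_lt0 ltr0n.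
have g0 : SQ g = 0.
  have rh : -3 < cre h < 3.
    by have := le_trans (cre_le h) h1; rewrite ler_norml; lra.
  have ih : -3 < cim h < 3.
    by have := le_trans (cim_le h) h1; rewrite ler_norml; lra.
  apply: (@goursat_sing2 R g _ _ _ _ 0 0 (cre h) (cim h)) => //.
  - apply: contraNT hn0; rewrite negb_or !negbK => /andP[/eqP e1 /eqP e2].
    by apply/eqP; apply: cplxP; rewrite -?e1 -?e2.
  - move=> x y xx yy n1 n2; eexists; apply: diff_cd; apply: gd; first exact: sq_lt7.
      exact: mkc_neq.
    exact: mkc_neq.
  - rewrite mkc00 => e e0.
    pose K := nm (c : C) + 1; have K0 : 0 < K by rewrite ltr_wpDl// nm_ge0.
    have e20 : 0 < e * nm (h : C) / 4 by rewrite divr_gt0// mulr_gt0.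
    have [r r0 rP] := cd0 e20.
    (* [nm h / 2] keeps [w] away from the other singular point; the third radius controls the term
       [c * w^2]. *)
    exists (Num.min r (Num.min (nm (h : C) / 2) (e * nm (h : C) / 4 / K))).
      by rewrite !lt_min r0 !divr_gt0// mulr_gt0.
    move=> w; rewrite !subr0 !lt_min => /and4P[w0 wr wh wk].
    have := rP w; rewrite subr0 => /(_ wr) hh.
    have wn : nm (w : C) != 0 by rewrite gt_eqF.
    have whn : nm (h : C) / 2 <= nm (w - h : C).
      by have := nmB w (w - h); rewrite opprB addrC subrK; lra.
    have wh0 : 0 < nm (w - h : C) by apply: lt_le_trans whn; rewrite divr_gt0.
    rewrite (_ : nm (g w) * nm w = nm (N w) / nm w / nm (w - h)); last first.
      by rewrite /g nmM nmV !nmM; field; rewrite wn gt_eqF.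
    rewrite 2?ler_pdivrMr//.
    apply: (@le_trans _ _ (e * (nm (h : C) / 2) * nm w)); last first.
      by rewrite ler_wpM2r ?nm_ge0// ler_wpM2l// ltW.
    rewrite /N; apply: (le_trans (nmB _ _)); rewrite [nm (c * _)]nmM [nm (w * w)]nmM.
    have k1 : nm (c : C) * (nm w * nm w) <= e * nm (h : C) / 4 * nm w.
      rewrite mulrA ler_wpM2r ?nm_ge0//.
      apply: (@le_trans _ _ (K * nm w)); first by rewrite ler_wpM2r ?nm_ge0// lerDl.
      by rewrite mulrC -ler_pdivlMr// ltW.
    have -> : e * (nm h / 2) * nm w = e * nm h / 4 * nm w + e * nm h / 4 * nm w by field.
    by apply: lerD; [apply: (le_trans hh)|exact: k1].
  - rewrite [X in weak_sing _ X](_ : _ = h); last exact/esym/cplxE.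
    move=> e e0.
    have e20 : 0 < e * (nm (h : C) / 2 * (nm (h : C) / 2)) by rewrite !mulr_gt0// divr_gt0.
    have [r r0 rP] := cd_cont (diff_cd (dN _ h7)) e20.
    exists (Num.min r (nm (h : C) / 2)); first by rewrite lt_min r0 divr_gt0.
    move=> w; rewrite lt_min => /and3P[wh0 wr wh].
    have := rP w wr; rewrite Nh subr0 => hh.
    have whn : nm (h : C) / 2 <= nm (w : C).
      by have := nmB w (w - h); rewrite opprB addrC subrK; lra.
    have w0 : 0 < nm (w : C) by apply: lt_le_trans whn; rewrite divr_gt0.
    rewrite /g nmM nmV !nmM invfM mulrA divfK ?gt_eqF// ler_pdivrMr ?mulr_gt0//.
    apply: (le_trans (ltW hh)); apply: ler_wpM2l; first exact: ltW.
    by apply: ler_pM => //; rewrite ltW// divr_gt0.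
have bn0 x y : [|| x == -3, x == 3, y == -3 | y == 3] -> mkc x y != 0 :> C.
  by move=> bxy; apply: bdry_neq => //; rewrite nm0.
have E : SQ (fun w => (f w - f 0 - f1 * w) / (w * w * (w - h))) = c * SQ (fun w => (w - h)^-1).
  have ei : edges (fun w => (w - h)^-1) (-3) 3 (-3) 3.
    by apply: edges_sq => x y _ _ bxy; apply: diff_inv_sub; exact: bdry_neq.
  rewrite -rectintZ// -[RHS]add0r -[X in _ = X + _]g0 -rectintD//.
  - apply: eq_rectint => // x y _ _ bxy; have n0 := bn0 _ _ bxy.
    have nh := bdry_neq h1 bxy; rewrite /g /N; field.
    by rewrite n0 subr_eq0 nh.
  - apply: edges_sq => x y xx yy bxy; apply: gd; [exact: sq_lt7|exact: bn0|exact: bdry_neq].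
  - exact: edgesZ.
(* The numerator is at most [2 * M + 11 * M * 6], the denominator at least [3 * 3 * 2]; then
   [48 * 68 / 18 < 182]. *)
have B : nm (SQ (fun w => (f w - f 0 - f1 * w) / (w * w * (w - h))) : C)
    <= 4 * ((3 - -3) + (3 - -3)) * (68 * M * (18^-1)).
  apply: rectint_le => //.
    apply: edges_sq => x y xx yy bxy; apply: differentiableM.
      by apply: dN0; exact: sq_lt7.
    by apply: dden; [exact: bn0|exact: bdry_neq].
  move=> x y xx yy bxy; have b3 := bdry_nm bxy.
  have p9 : 9 <= nm (mkc x y : C) * nm (mkc x y : C).
    by rewrite (_ : 9 = 3 * 3 :> R); [apply: ler_pM|ring].
  have wh : 2 <= nm (mkc x y - h : C).
    by have := nmD (mkc x y - h) h; rewrite subrK; lra.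
  have p18 : 18 <= nm (mkc x y : C) * nm (mkc x y : C) * nm (mkc x y - h : C).
    by rewrite (_ : 18 = 9 * 2 :> R); [apply: ler_pM|ring].
  rewrite nmM nmV !nmM; apply: ler_pM; rewrite ?nm_ge0// ?invr_ge0 ?mulr_ge0 ?nm_ge0//.
    apply: (le_trans (nmB _ _)); rewrite nmM.
    have k1 : nm (f1 : C) * nm (mkc x y : C) <= 11 * M * 6.
      by apply: ler_pM; rewrite ?nm_ge0// sq_nm.
    have k2 := nmB (f (mkc x y)) (f 0).
    have := fM (sq_lt7 xx yy); have := fM zero7; lra.
  by rewrite lef_pV2 ?posrE// (lt_le_trans _ p18).
have W := winding_ge h1.
rewrite E nmM in B.
have cB : nm (c : C) <= 182 * M.
  apply: (@le_trans _ _ (nm (c : C) * nm (SQ (fun w => (w - h)^-1) : C))).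
    by rewrite ler_peMr// nm_ge0.
  apply: (le_trans B); move: M0; lra.
have -> : f h - f 0 - f1 * h = c * (h * h) by rewrite /c divfK// mulf_neq0.
by rewrite 2!nmM expr2 ler_wpM2r// mulr_ge0 ?nm_ge0.
Qed.
End F.
End Taylor2.

(** * Holomorphic functions of several variables *)

Section Several.
Variables (R : realType).
Local Notation C := (Cplx R).

Definition cvgs (u : nat -> C) (l : C) := forall e : R, 0 < e ->
  exists N, forall k, (N <= k)%N -> nm (u k - l : C) <= e.

Lemma cvgs_unique u l l' : cvgs u l -> cvgs u l' -> l = l'.
Proof.
move=> h h'; apply/eqP; rewrite -subr_eq0; apply/eqP/nm_eq0/eqP.
rewrite eq_le nm_ge0 andbT; apply/ler_addgt0Pr => e e0; rewrite add0r.
have e2 : 0 < e / 2 by rewrite divr_gt0.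
have [N P] := h _ e2; have [N' P'] := h' _ e2.
have := P _ (leq_maxl N N'); have := P' _ (leq_maxr N N'); set k := maxn _ _ => k1 k2.
have -> : l - l' = (u k - l') - (u k - l) by ring.
by apply: (le_trans (nmB _ _)); lra.
Qed.

Lemma cauchy_cvgs (u : nat -> C) :
  (forall e : R, 0 < e -> exists N, forall k l, (N <= k)%N -> (N <= l)%N -> nm (u k - u l : C) <= e) ->
  exists l, cvgs u l.
Proof.
move=> h.
have rc (v : nat -> R) : (forall k l, `|v k - v l| <= nm (u k - u l : C)) ->
    exists l, forall e : R, 0 < e -> exists N, forall k, (N <= k)%N -> `|v k - l| <= e.
  move=> vu.
  have : cvg (v k @[k --> \oo]).
    apply/cauchy_cvgP/cauchy_exP => e e0.
    have [N NP] := h (e / 2) (divr_gt0 e0 (ltr0n _ 2)).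
    exists (v N); exists N => // k /= Nk.
    rewrite /ball /=; apply: (le_lt_trans (vu _ _)).
    by apply: (le_lt_trans (NP _ _ (leqnn _) Nk)); lra.
  move=> /cvg_ex[l vl]; exists l => e e0.
  move: vl => /cvgrPdist_le /(_ e e0) [N _ NP]; exists N => k Nk.
  by rewrite distrC; exact: NP.
have [x xP] := rc (fun k => cre (u k)) (fun k l => ltac:(rewrite /= -creB; exact: cre_le)).
have [y yP] := rc (fun k => cim (u k)) (fun k l => ltac:(rewrite /= -cimB; exact: cim_le)).
exists (mkc x y) => e e0; have e2 : 0 < e / 2 by rewrite divr_gt0.
have [N NP] := xP _ e2; have [N' NP'] := yP _ e2.
exists (maxn N N') => k; rewrite geq_max => /andP[/NP k1 /NP' k2].
apply: (le_trans (nm_cre_cim _)); rewrite creB cimB cre_mk cim_mk.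
by move: k1 k2 => /=; lra.
Qed.

Variable n : nat.
Local Notation vec := 'rV[C]_n.
Implicit Types (f : vec -> C) (p q h : vec) (rho M e : R).

(** Radius and bound are recorded because every Cauchy or Taylor constant below is expressed through
    them. *)
Definition bhol f p rho M := forall q, nm (q - p) < rho ->
  differentiable f q /\ nm (f q : C) <= M.

Lemma bhol_sub f p rho M q r : bhol f p rho M -> nm (q - p) + r <= rho -> bhol f q r M.
Proof.
move=> b h q' q'r; apply: b; apply: lt_le_trans h.
rewrite (_ : q' - p = (q' - q) + (q - p)); last by rewrite addrA subrK.
by apply: (le_lt_trans (nmD _ _)); rewrite addrC ltrD2l.
Qed.

Lemma holo_bhol (D : set vec) f p : open D -> holomorphic_on D f -> D p ->
  exists rho, exists M, [/\ 0 < rho, bhol f p rho M & forall q, nm (q - p) < rho -> D q].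
Proof.
move=> oD fD Dp; have [r r0 rP] := (nm_openP D).1 oD p Dp.
have [d d0 dP] := fd_cont (diff_fd (fD _ Dp)) (ltr01 : 0 < 1 :> R).
exists (Num.min r d), (nm (f p : C) + 1); split; first by rewrite lt_min r0.
  move=> q; rewrite lt_min => /andP[qr qd]; split; first exact/fD/rP.
  have := nmD (f q - f p) (f p); rewrite subrK => h; apply: (le_trans h).
  by rewrite addrC lerD2l ltW// dP.
by move=> q; rewrite lt_min => /andP[qr _]; exact: rP.
Qed.

Lemma bhol_M0 f p rho M : 0 < rho -> bhol f p rho M -> 0 <= M.
Proof.
move=> r0 b.
have [_] : differentiable f p /\ nm (f p : C) <= M by apply: b; rewrite subrr nm0.
by apply: le_trans; exact: nm_ge0.
Qed.

(** Restriction to the complex line through [p] along [h]. The direction [v] is [h] scaled to norm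
    [rho / 8], so that the disc of radius 7 of the one variable estimates stays in the ball. *)
Lemma slice f p rho M h : 0 < rho -> bhol f p rho M -> h != 0 ->
  exists v : vec, exists w : C, [/\ h = w *: v, nm (w : C) = nm h * 8 / rho &
   nm (dotc (grad f p) v : C) <= 11 * M /\
   (nm h <= rho / 8 -> nm (f (p + h) - f p - dotc (grad f p) h : C) <= 182 * M * nm (w : C) ^+ 2)].
Proof.
move=> r0 b h0; have nh0 : 0 < nm h by rewrite nm_gt0.
pose t : R := nm h * 8 / rho; have t0 : 0 < t by rewrite divr_gt0// mulr_gt0.
have ct : cofr t != 0 :> C by rewrite -nm_gt0 nm_cofr gtr0_norm.
pose v := (cofr t)^-1 *: h; exists v, (cofr t).
have vE : nm v = rho / 8.
  rewrite /v nmZ nmV nm_cofr gtr0_norm// /t; field.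
  by rewrite gt_eqF//= gt_eqF.
have hE : h = cofr t *: v by rewrite /v scalerA divff// scale1r.
pose g (w : C) : C := f (p + w *: v).
have inb w : nm (w : C) < 7 -> nm (p + w *: v - p) < rho.
  rewrite addrC addKr nmZ vE => w7.
  apply: (@le_lt_trans _ _ (7 * (rho / 8))); last by lra.
  by rewrite ler_wpM2r ?ltW// divr_gt0.
have dl w : differentiable (fun w : C => p + w *: v : vec) w.
  apply: differentiableD; first exact: differentiable_cst.
  by apply: differentiableZl.
have dg w : nm (w : C) < 7 -> differentiable g w.
  move=> w7; apply: (@differentiable_comp _ _ _ _ (fun w : C => p + w *: v : vec) f) => //.
  by have [] := b _ (inb _ w7).
have gM w : nm (w : C) < 7 -> nm (g w : C) <= M by move=> w7; have [] := b _ (inb _ w7).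
have z7 : nm (0 : C) < 7 by rewrite nm0.
have [fp _] : differentiable f p /\ nm (f p : C) <= M by apply: b; rewrite subrr nm0.
have dE : 'd g 0 1 = dotc (grad f p) v.
  have E1 : 'D_v f p = dotc (grad f p) v by rewrite deriveE// gradE.
  have E2 : 'D_(1 : C) g 0 = 'd g 0 1 by apply: deriveE; exact: dg.
  rewrite -E1 -E2.
  have E3 : (fun k : C => k^-1 *: (g (k *: 1 + 0) - g 0)) = (fun k : C => k^-1 *: (f (k *: v + p) - f p)).
    apply/funext => k.
    by rewrite /g scale0r addr0 addr0 [k *: 1]mulr1 [p + _]addrC.
  by rewrite /derive E3.
have th := taylor2 dg gM; have c1 := cauchy_d1 dg gM.
rewrite dE in th c1.
split => //; first by rewrite nm_cofr gtr0_norm.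
split=> // h8; have := th (cofr t); rewrite nm_cofr gtr0_norm// => H.
have t1 : t <= 1 by rewrite /t ler_pdivrMr// mul1r; lra.
have := H t1; rewrite /g scale0r addr0 -hE => {}H.
rewrite (_ : dotc (grad f p) h = dotc (grad f p) v * cofr t)//.
by clear -hE; clearbody t v; rewrite hE linearZ /= mulrC.
Qed.
End Several.

(** * Estimates in several variables and holomorphy of partial derivatives *)

Section Several2.
Variables (R : realType) (n : nat).
Local Notation C := (Cplx R).
Local Notation vec := 'rV[C]_n.
Implicit Types (f : vec -> C) (p q h : vec) (rho M e : R).

Lemma taylor_vec f p rho M h : 0 < rho -> bhol f p rho M -> nm h <= rho / 8 ->
  nm (f (p + h) - f p - dotc (grad f p) h : C) <= 182 * M * (8 / rho) ^+ 2 * nm h ^+ 2.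
Proof.
move=> r0 b h8; have [->|h0] := eqVneq h 0.
  by rewrite addr0 subrr linear0 subr0 !nm0 expr0n mulr0.
have [v [w [_ wE [_ /(_ h8)]]]] := slice r0 b h0; rewrite wE => /le_trans; apply.
by rewrite le_eqVlt; apply/orP; left; apply/eqP; rewrite !expr2; ring.
Qed.

(** [88 = 11 * 8]: the constant of [cauchy_d1] times the rescaling of [slice]. *)
Lemma cauchy_vec f p rho M h : 0 < rho -> bhol f p rho M ->
  nm (dotc (grad f p) h : C) <= 88 * M / rho * nm h.
Proof.
move=> r0 b; have [->|h0] := eqVneq h 0; first by rewrite linear0 !nm0 mulr0.
have [v [w [hE wE [c _]]]] := slice r0 b h0.
rewrite hE linearZ /= nmM -hE wE.
rewrite (_ : 88 * M / rho * nm h = nm h * 8 / rho * (11 * M)).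
  by rewrite ler_wpM2l// !mulr_ge0 ?nm_ge0 ?invr_ge0// ltW.
by field; rewrite gt_eqF.
Qed.

Lemma nm_delta i : nm (delta_mx 0 i : vec) <= 1.
Proof.
by apply: nm_row_le => // j; rewrite mxE eqxx /=; case: eqP; rewrite /= ?nm1 ?nm0.
Qed.

Lemma cauchy_grad f p rho M i : 0 < rho -> bhol f p rho M ->
  nm (grad f p i : C) <= 88 * M / rho.
Proof.
move=> r0 b; rewrite -dotc_delta; apply: (le_trans (cauchy_vec _ r0 b)).
apply: ler_piMr; last exact: nm_delta.
by apply: divr_ge0; [apply: mulr_ge0 => //; exact: (bhol_M0 r0 b)|exact: ltW].
Qed.

Lemma gradB f g p : differentiable f p -> differentiable g p ->
  grad (fun q => f q - g q) p = (fun i => grad f p i - grad g p i).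
Proof.
move=> df dg; apply/funext => i; rewrite /grad /pd /=.
by rewrite (@deriveB _ _ _ f g)//; apply: diff_derivable.
Qed.

Lemma bholB f g p rho M : bhol f p rho M -> bhol g p rho M -> bhol (fun q => f q - g q) p rho (2 * M).
Proof.
move=> bf bg q qr; have [df fM] := bf q qr; have [dg gM] := bg q qr.
split; first exact: differentiableB.
by apply: (le_trans (nmB _ _)); lra.
Qed.

Lemma eq_bholM f p rho M M' : (forall q, nm (q - p) < rho -> nm (f q : C) <= M') -> bhol f p rho M -> bhol f p rho M'.
Proof. by move=> h b q qr; have [] := b q qr; split=> //; exact: h. Qed.

(** Cauchy's estimate applied to [u k - u l] makes the gradients converge; the Taylor remainder is
    quadratic with a constant independent of [k], so it survives in the limit. *)
Lemma unif_limit (u : nat -> vec -> C) f p rho M : 0 < rho ->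
  (forall k, bhol (u k) p rho M) ->
  (forall e, 0 < e -> exists N, forall k, (N <= k)%N -> forall q, nm (q - p) < rho ->
     nm (u k q - f q : C) <= e) ->
  exists2 c, fd f p c & forall i, cvgs (fun k => grad (u k) p i) (c i).
Proof.
move=> r0 b uf.
have pp : nm (p - p) < rho by rewrite subrr nm0.
have ch i : exists l, cvgs (fun k => grad (u k) p i) l.
  apply: cauchy_cvgs => e e0.
  (* The difference of two terms is at most [2 * t], and [88 * (2 * t) / rho = e]. *)
  pose t := e * rho / 176; have t0 : 0 < t by rewrite !divr_gt0// mulr_gt0.
  have [N NP] := uf _ t0; exists N => k l Nk Nl.
  have [dk _] := b k _ pp; have [dl _] := b l _ pp.
  have := @cauchy_grad (fun q => u k q - u l q) p rho (2 * t) i r0.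
  rewrite gradB// => H; apply: (le_trans (H _)).
    apply: (@eq_bholM _ _ _ (2 * M)); last exact: bholB.
    move=> q qr; rewrite (_ : u k q - u l q = (u k q - f q) - (u l q - f q)); last by ring.
    apply: (le_trans (nmB _ _)).
    by have := NP k Nk q qr; have := NP l Nl q qr; lra.
  by rewrite /t le_eqVlt; apply/orP; left; apply/eqP; field; rewrite gt_eqF.
have [c cP] := choice ch; exists c => //.
have M0 := bhol_M0 r0 (b 0%N).
move=> e e0; pose K := 182 * M * (8 / rho) ^+ 2.
have K0 : 0 <= K by apply: mulr_ge0 (sqr_ge0 _); exact: mulr_ge0 (ler0n _ 182) M0.
exists (Num.min (rho / 8) (e / (K + 1))).
  by rewrite lt_min !divr_gt0// ltr_wpDl.
move=> h; rewrite lt_min => /andP[h8 he].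
have K1 : 0 < K + 1 by rewrite ltr_wpDl.
apply: (@le_trans _ _ (K * nm h ^+ 2)); last first.
  rewrite expr2 mulrA ler_wpM2r ?nm_ge0//.
  apply: (@le_trans _ _ ((K + 1) * nm h)); first by rewrite ler_wpM2r ?nm_ge0// lerDl.
  by rewrite mulrC -ler_pdivlMr// ltW.
apply/ler_addgt0Pr => d d0.
(* The four-term splitting below costs [s + s + n%:R * (nm h * s)], which is exactly [d]. *)
pose s := d / (2 + n%:R * nm h).
have den0 : 0 < 2 + n%:R * nm h by rewrite ltr_wpDr// mulr_ge0 ?nm_ge0.
have s0 : 0 < s by rewrite divr_gt0.
have [N NP] := uf _ s0.
have [L LP] : exists L, forall k, (L <= k)%N -> forall i, nm (grad (u k) p i - c i : C) <= s.
  have [L LP] := choice (fun i => cP i s s0).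
  exists (\max_i L i) => k Lk i; apply: LP; apply: leq_trans Lk.
  exact: leq_bigmax.
pose k := maxn N L.
have hr : nm (p + h - p) < rho.
  by rewrite addrC addKr; apply: lt_le_trans h8 _; rewrite ler_pdivrMr//; lra.
have k1 := NP k (leq_maxl _ _) _ hr; have k2 := NP k (leq_maxl _ _) _ pp.
have k3 := taylor_vec r0 (b k) (ltW h8).
rewrite (_ : f (p + h) - f p - dotc c h = (u k (p + h) - u k p - dotc (grad (u k) p) h)
   - (u k (p + h) - f (p + h)) + (u k p - f p) + (dotc (grad (u k) p) h - dotc c h)); last by ring.
have k4 : nm (dotc (grad (u k) p) h - dotc c h : C) <= n%:R * (nm h * s).
  rewrite (_ : _ - _ = dotc (fun i => grad (u k) p i - c i) h); last first.
    by rewrite /dotc -sumrB; apply: eq_bigr => i _; rewrite mulrBr.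
  by apply: nm_dotc => i; apply: LP; exact: leq_maxr.
apply: (@le_trans _ _ (K * nm h ^+ 2 + s + s + n%:R * (nm h * s))).
  apply: (le_trans (nmD _ _)); apply: lerD => //.
  apply: (le_trans (nmD _ _)); apply: lerD => //.
  by apply: (le_trans (nmB _ _)); apply: lerD.
rewrite -!addrA lerD2l /s le_eqVlt; apply/orP; left; apply/eqP.
by field; rewrite gt_eqF.
Qed.

Lemma fd_dir f p c h : fd f p c -> forall t : nat -> C, (forall k, t k != 0) -> cvgs t 0 ->
  cvgs (fun k => (f (p + t k *: h) - f p) / t k) (dotc c h).
Proof.
move=> fc t tn t0 e e0.
pose K := nm h + 1; have K0 : 0 < K by rewrite ltr_wpDl// nm_ge0.
have [d d0 dP] := fc (e / K) (divr_gt0 e0 K0).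
have [N NP] := t0 (d / 2 / K) (divr_gt0 (divr_gt0 d0 (ltr0n _ 2)) K0).
exists N => k /NP; rewrite subr0 => tk.
have tp : 0 < nm (t k : C) by rewrite nm_gt0.
have td : nm (t k *: h) < d.
  rewrite nmZ; apply: (@le_lt_trans _ _ (nm (t k) * K)).
    by rewrite ler_wpM2l ?nm_ge0// lerDl.
  rewrite -ltr_pdivlMr//; apply: (le_lt_trans tk).
  by rewrite ltr_pM2r ?invr_gt0//; lra.
have := dP _ td; rewrite linearZ /= => H.
rewrite (_ : _ - _ = (f (p + t k *: h) - f p - t k * dotc c h) / t k); last by field.
rewrite nmM nmV ler_pdivrMr//; apply: (le_trans H); rewrite nmZ.
rewrite (_ : e / K * (nm (t k) * nm h) = e * nm (t k) * (nm h / K)); last by field; rewrite gt_eqF.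
rewrite ler_piMr ?mulr_ge0 ?nm_ge0 ?ltW// ltr_pdivrMr// mul1r ltrDl//.
Qed.

Lemma small_seq r : 0 < r -> exists2 t : nat -> C, (forall k, t k != 0 /\ nm (t k : C) <= r) & cvgs t 0.
Proof.
move=> r0; exists (fun k => cofr (r / 2 ^+ k)) => [k|e e0].
  have p0 : 0 < r / 2 ^+ k by rewrite divr_gt0// exprn_gt0.
  rewrite -nm_gt0 nm_cofr gtr0_norm//; split=> //.
  rewrite ler_pdivrMr ?exprn_gt0//; apply: ler_peMr; first exact: ltW.
  by apply: exprn_ege1; rewrite ler1n.
have [N NP] := pow2_small (ltW r0) e0; exists N => k Nk.
have p0 : 0 < r / 2 ^+ k by rewrite divr_gt0// exprn_gt0.
rewrite subr0 nm_cofr gtr0_norm//; apply: le_trans (ltW NP).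
by rewrite ler_pM2l// lef_pV2 ?posrE ?exprn_gt0// ler_weXn2l// ler1n.
Qed.

Lemma gradS f p (v : vec) : differentiable f (p + v) ->
  differentiable (fun q => f (q + v)) p /\ grad (fun q => f (q + v)) p = grad f (p + v).
Proof.
move=> df; apply: fd_diff => e /(diff_fd df)[d d0 dP]; exists d => // h hd.
by rewrite [p + h + v]addrAC; exact: dP.
Qed.

Lemma gradZ f p (a : C) : differentiable f p ->
  differentiable (fun q => a * f q) p /\ grad (fun q => a * f q) p = (fun i => a * grad f p i).
Proof.
move=> df; split; first exact: (@differentiableZ _ _ _ f a).
by apply/funext => i; rewrite /grad /pd /= (@deriveZ _ _ _ f)//; exact: diff_derivable.
Qed.

(** The difference quotients in direction [i] converge to the partial derivative uniformly, at rate
    [K * nm (t k)], so [unif_limit] applies. It also gives the second derivatives as limits of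
    difference quotients of the gradient, from which [pd_comm] follows. *)
Lemma pd_fd f p rho M i : 0 < rho -> bhol f p rho M ->
  differentiable (pd [:: i] f) p /\
  exists2 t : nat -> C, (forall k, t k != 0) /\ cvgs t 0 &
    forall j, cvgs (fun k => (pd [:: j] f (p + t k *: delta_mx 0 i) - pd [:: j] f p) / t k)
      (pd [:: i; j] f p).
Proof.
move=> r0 b; have M0 := bhol_M0 r0 b.
pose r := rho / 2; have rr0 : 0 < r by rewrite divr_gt0.
have r8 : 0 < r / 8 by rewrite divr_gt0.
have [t tP t0] := small_seq r8.
have bq q : nm (q - p) < r -> bhol f q r M.
  by move=> qr; apply: (bhol_sub b); rewrite /r in qr *; lra.
pose v k : vec := t k *: delta_mx 0 i.
have nv k : nm (v k) <= nm (t k : C).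
  by rewrite nmZ ler_piMr ?nm_ge0// nm_delta.
have nv8 k : nm (v k) <= r / 8 by apply: (le_trans (nv k)); case: (tP k).
pose u k q := (t k)^-1 * (f (q + v k) - f q).
have vr k : nm (v k) < r by apply: (le_lt_trans (nv8 k)); lra.
have dfv k q : nm (q - p) < r -> differentiable f (q + v k).
  move=> qr; have [] // : differentiable f (q + v k) /\ nm (f (q + v k) : C) <= M.
  by apply: (bq q qr); rewrite addrC addKr.
have df q : nm (q - p) < r -> differentiable f q.
  by move=> qr; have [] // := b q; apply: lt_trans qr _; rewrite /r; lra.
have dfq k q : nm (q - p) < r -> differentiable (fun q => f (q + v k) - f q) q.
  move=> qr; apply: (@differentiableB _ _ _ (fun q => f (q + v k)) f); last exact: df.
  by have [] := gradS (dfv k q qr).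
have du k q : nm (q - p) < r -> differentiable (u k) q /\
    grad (u k) q = (fun j => (t k)^-1 * (grad f (q + v k) j - grad f q j)).
  move=> qr; have [d g] := gradZ (t k)^-1 (dfq k q qr); split=> //.
  have [dS gS] := gradS (dfv k q qr).
  by rewrite [LHS]g (gradB dS (df _ qr)) gS.
pose K := 182 * M * (8 / r) ^+ 2.
have K0 : 0 <= K by apply: mulr_ge0 (sqr_ge0 _); exact: mulr_ge0 (ler0n _ 182) M0.
have est k q : nm (q - p) < r -> nm (u k q - pd [:: i] f q : C) <= K * nm (t k : C).
  move=> qr; have [tn tr] := tP k.
  have := taylor_vec rr0 (bq q qr) (nv8 k).
  rewrite -/K /v linearZ /= dotc_delta -/(v k) => H.
  have tp : 0 < nm (t k : C) by rewrite nm_gt0.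
  have E0 : u k q - grad f q i = (f (q + v k) - f q - t k * grad f q i) / t k.
    by rewrite /u; field.
  rewrite [X in nm X](E0 : u k q - pd [:: i] f q = _).
  rewrite nmM nmV ler_pdivrMr//; apply: (le_trans H).
  by rewrite -[K * _ * _]mulrA ler_wpM2l// expr2; apply: ler_pM; rewrite ?nm_ge0.
pose M' := 88 * M / r + K * (r / 8).
have bu k : bhol (u k) p r M'.
  move=> q qr; have [d _] := du k q qr; split=> //.
  have := nmD (u k q - pd [:: i] f q) (pd [:: i] f q); rewrite subrK => h.
  apply: (le_trans h); rewrite /M' addrC; apply: lerD; first exact: (cauchy_grad i rr0 (bq q qr)).
  apply: (le_trans (est k q qr)); rewrite ler_wpM2l//.
  by case: (tP k).
have [c fc cc] : exists2 c, fd (pd [:: i] f) p c & forall j, cvgs (fun k => grad (u k) p j) (c j).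
  apply: (@unif_limit u _ _ r M') => // e e0.
  have K1 : 0 < K + 1 by rewrite ltr_wpDl.
  have [N NP] := t0 (e / (K + 1)) (divr_gt0 e0 K1); exists N => k Nk q qr.
  apply: (le_trans (est k q qr)); have := NP k Nk; rewrite subr0 ler_pdivlMr// => H.
  by apply: le_trans H; rewrite mulrC ler_wpM2l ?nm_ge0// lerDl.
have [dd gg] := fd_diff fc; split=> //.
exists t => [|j]; first by split=> // k; case: (tP k).
have -> : pd [:: i; j] f p = c j by rewrite -gg.
have pp : nm (p - p) < r by rewrite subrr nm0.
move=> e /(cc j)[N NP]; exists N => k /NP.
by have [_ ->] := du k p pp; rewrite mulrC.
Qed.

Lemma holo_pd (D : set vec) f i : open D -> holomorphic_on D f -> holomorphic_on D (pd [:: i] f).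
Proof.
move=> oD fD p Dp; have [rho [M [r0 b _]]] := holo_bhol oD fD Dp.
by have [] := pd_fd i r0 b.
Qed.

Lemma holo_pds (D : set vec) f s : open D -> holomorphic_on D f -> holomorphic_on D (pd s f).
Proof.
move=> oD; elim: s f => [//|i s ih] f fD.
by rewrite (_ : pd _ f = pd s (pd [:: i] f))//; apply: ih; exact: holo_pd.
Qed.

(** Both sides are limits of the same difference quotients of [pd [:: j] f] in direction [i]: one by
    [pd_fd], the other by differentiability of [pd [:: j] f]. *)
Lemma pd_comm (D : set vec) f i j p : open D -> holomorphic_on D f -> D p ->
  pd [:: i; j] f p = pd [:: j; i] f p.
Proof.
move=> oD fD Dp; have [rho [M [r0 b _]]] := holo_bhol oD fD Dp.
have [_ [t [tn t0] /(_ j) h]] := pd_fd i r0 b.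
have dj := @holo_pd D f j oD fD p Dp.
have := fd_dir (delta_mx 0 i) (diff_fd dj) tn t0; rewrite dotc_delta => h'.
exact: cvgs_unique h h'.
Qed.
End Several2.

(** * Calculus of partial derivatives *)

Section Calculus.
Variables (R : realType) (n : nat).
Local Notation C := (Cplx R).
Local Notation vec := 'rV[C]_n.
Implicit Types (f g : vec -> C) (p q h x : vec) (rho M e : R) (a b : 'I_n).

Lemma pdD a f g x : differentiable f x -> differentiable g x ->
  pd [:: a] (fun x => f x + g x) x = pd [:: a] f x + pd [:: a] g x.
Proof. by move=> df dg; rewrite /pd /= (@deriveD _ _ _ f g)//; exact: diff_derivable. Qed.

Lemma pdB a f g x : differentiable f x -> differentiable g x ->
  pd [:: a] (fun x => f x - g x) x = pd [:: a] f x - pd [:: a] g x.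
Proof. by move=> df dg; rewrite /pd /= (@deriveB _ _ _ f g)//; exact: diff_derivable. Qed.

Lemma pdM a f g x : differentiable f x -> differentiable g x ->
  pd [:: a] (fun x => f x * g x) x = f x * pd [:: a] g x + g x * pd [:: a] f x.
Proof. by move=> df dg; rewrite /pd /= (@deriveM _ _ f g)//; exact: diff_derivable. Qed.

Lemma pdZ a (c : C) f x : differentiable f x ->
  pd [:: a] (fun x => c * f x) x = c * pd [:: a] f x.
Proof. by move=> df; rewrite /pd /= (@deriveZ _ _ _ f)//; exact: diff_derivable. Qed.

Lemma pd_cst a (c : C) x : pd [:: a] (fun=> c) x = 0.
Proof. by rewrite /pd /= derive_cst. Qed.

Lemma pdV a f x : f x != 0 -> differentiable f x ->
  pd [:: a] (fun x => (f x)^-1) x = - (f x)^-1 ^+ 2 * pd [:: a] f x.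
Proof.
move=> f0 df; rewrite /pd /= deriveV//; last exact: diff_derivable.
by rewrite /GRing.scale /= exprVn.
Qed.

Lemma diff_sum (I : Type) (s : seq I) (u : I -> vec -> C) x :
  (forall i, differentiable (u i) x) -> differentiable (fun x => \sum_(i <- s) u i x) x.
Proof.
move=> du; elim: s => [|i s ih].
  rewrite (_ : (fun _ => _) = fun=> 0); first exact: differentiable_cst.
  by apply/funext => y; rewrite big_nil.
rewrite (_ : (fun _ => _) = fun x => u i x + \sum_(i <- s) u i x); first exact: differentiableD.
by apply/funext => y; rewrite big_cons.
Qed.

Lemma pd_sum a (I : Type) (s : seq I) (u : I -> vec -> C) x :
  (forall i, differentiable (u i) x) ->
  pd [:: a] (fun x => \sum_(i <- s) u i x) x = \sum_(i <- s) pd [:: a] (u i) x.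
Proof.
move=> du; elim: s => [|i s ih].
  rewrite (_ : (fun _ => _) = fun=> 0) ?pd_cst ?big_nil//.
  by apply/funext => y; rewrite big_nil.
rewrite (_ : (fun _ => _) = fun x => u i x + \sum_(i <- s) u i x) ?big_cons.
  by rewrite pdD ?ih//; exact: diff_sum.
by apply/funext => y; rewrite big_cons.
Qed.

Lemma coord_fd b p : fd (fun x : vec => x 0 b : C) p (fun a => (a == b)%:R).
Proof.
move=> e e0; exists 1 => // h _; rewrite mxE [p 0 b + _]addrC addrK /dotc (bigD1 b)//= eqxx mulr1.
rewrite big1 ?addr0 ?subrr ?nm0 ?mulr_ge0 ?nm_ge0 ?ltW// => i /negPf ->.
by rewrite mulr0.
Qed.

Lemma diff_coordB b p x : differentiable (fun x : vec => (x - p) 0 b : C) x.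
Proof.
have [d _] := fd_diff (coord_fd b (x - p)).
by have [] := gradS d.
Qed.

Lemma pd_coordB a b p x : pd [:: a] (fun x : vec => (x - p) 0 b : C) x = (a == b)%:R.
Proof.
have [d g] := fd_diff (coord_fd b (x - p)); have [_ gs] := gradS d.
by rewrite -[LHS]/(grad (fun x : vec => (x - p) 0 b : C) x a) gs g.
Qed.

Lemma eq_pd (D : set vec) s f g x : open D -> D x -> (forall y, D y -> f y = g y) ->
  pd s f x = pd s g x.
Proof.
move=> oD; elim: s f g x => [|a s ih] f g x Dx fg; first exact: fg.
rewrite -[LHS]/(pd s (pd [:: a] f) x) -[RHS]/(pd s (pd [:: a] g) x).
apply: (ih (pd [:: a] f) (pd [:: a] g) x Dx) => y Dy; rewrite /pd /=.
apply: (@near_eq_derive C vec C f g y (delta_mx 0 a)); apply/nm_nbhsP.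
have [r r0 rP] := (nm_openP D).1 oD y Dy; exists r => // z zr.
exact/fg/rP.
Qed.

Definition bl p rho : set vec := [set q | nm (q - p) < rho].

Lemma bl_open p rho : open (bl p rho).
Proof.
apply/nm_openP => x xr; exists (rho - nm (x - p)); first by rewrite subr_gt0.
move=> y yx; rewrite /bl /= (_ : y - p = (y - x) + (x - p)); last by rewrite addrA subrK.
by apply: (le_lt_trans (nmD _ _)); rewrite -ltrBrDr.
Qed.

Lemma bl_center p rho : 0 < rho -> bl p rho p.
Proof. by move=> r0; rewrite /bl /= subrr nm0. Qed.

Definition seg p x (s : R) : vec := p + cofr s *: (x - p).

Lemma seg0 p x : seg p x 0 = p.
Proof. by rewrite /seg (_ : cofr 0 = 0) ?scale0r ?addr0. Qed.

Lemma seg1 p x : seg p x 1 = x.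
Proof. by rewrite /seg (_ : cofr 1 = 1) ?scale1r ?subrKC. Qed.

Lemma seg_bl p x s : 0 <= s <= 1 -> nm (seg p x s - p) <= nm (x - p).
Proof.
move=> /andP[s0 s1]; rewrite /seg addrC addKr nmZ nm_cofr ger0_norm//.
by rewrite ler_piMl ?nm_ge0.
Qed.

Lemma segB p x s t : seg p x t - seg p x s = cofr (t - s) *: (x - p).
Proof. by rewrite /seg opprD addrACA subrr add0r -scalerBl cofrB. Qed.

Lemma seg_cder f p x : (forall s, 0 <= s <= 1 -> differentiable f (seg p x s)) ->
  cder 0 1 (fun s => f (seg p x s)) (fun s => dotc (grad f (seg p x s)) (x - p)).
Proof.
move=> df s ss e e0.
pose K := nm (x - p) + 1; have K0 : 0 < K by rewrite ltr_wpDl// nm_ge0.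
have [d d0 dP] := diff_fd (df s ss) (divr_gt0 e0 K0).
exists (d / K); first by rewrite divr_gt0.
move=> t _ ts; pose h := cofr (t - s) *: (x - p).
have hK : nm h <= `|t - s| * K by rewrite /h nmZ nm_cofr ler_wpM2l// lerDl.
have hd : nm h < d by apply: (le_lt_trans hK); rewrite -ltr_pdivlMr.
have := dP h hd; rewrite {1}/h -segB subrKC /h linearZ /= => H.
apply: (le_trans H); rewrite mulrAC ler_pdivrMr// -mulrA ler_wpM2l ?(ltW e0)//.
Qed.

Lemma seg_ccont f p x : (forall s, 0 <= s <= 1 -> differentiable f (seg p x s)) ->
  ccont 0 1 (fun s => f (seg p x s)).
Proof. by move=> df; apply: cder_cont (seg_cder df). Qed.

Lemma seg_ccont_dotc f p x (v : vec) : (forall a s, 0 <= s <= 1 -> differentiable (pd [:: a] f) (seg p x s)) ->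
  ccont 0 1 (fun s => dotc (grad f (seg p x s)) v).
Proof.
move=> df; apply: ccont_sum => i; apply: ccontM; first exact: ccont_cst.
by apply: seg_ccont => s; exact: df.
Qed.

Lemma seg_FTC f p x : (forall s, 0 <= s <= 1 -> differentiable f (seg p x s)) ->
  (forall a s, 0 <= s <= 1 -> differentiable (pd [:: a] f) (seg p x s)) ->
  f x - f p = cint 0 1 (fun s => dotc (grad f (seg p x s)) (x - p)).
Proof.
move=> df ddf; rewrite (cint_FTC ler01 _ (seg_cder df)) ?seg0 ?seg1//.
exact: seg_ccont_dotc.
Qed.

Lemma nm_cint01 (g : R -> C) M : ccont 0 1 g -> (forall s, 0 <= s <= 1 -> nm (g s : C) <= M) ->
  nm (cint 0 1 g : C) <= 2 * M.
Proof. by move=> cg gM; have := nm_cint ler01 cg gM; rewrite subr0 mulr1. Qed.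

Lemma lipschitz_seg f p x L : (forall s, 0 <= s <= 1 -> differentiable f (seg p x s)) ->
  (forall a s, 0 <= s <= 1 -> differentiable (pd [:: a] f) (seg p x s)) ->
  (forall a s, 0 <= s <= 1 -> nm (pd [:: a] f (seg p x s) : C) <= L) ->
  nm (f x - f p : C) <= 2 * (n%:R * (nm (x - p) * L)).
Proof.
move=> df ddf fL; rewrite seg_FTC//.
apply: nm_cint01; first exact: seg_ccont_dotc.
by move=> s ss; apply: nm_dotc => i; exact: fL.
Qed.

(* The operators [J k f] are the building blocks of the homotopy formula for
   the Poincare lemma centred at [p]. *)
Definition J (p : vec) k f x : C := cint 0 1 (fun s => cofr s ^+ k * f (seg p x s)).

Lemma cofr_ccont : ccont 0 1 (fun s => cofr s : C).
Proof. by move=> x _ e e0; exists e => // y _ yx; rewrite -cofrB nm_cofr. Qed.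

Lemma cofrX_ccont k : ccont 0 1 (fun s => cofr s ^+ k : C).
Proof.
elim: k => [|k ih].
  by apply: (@eq_ccont _ _ _ (fun=> 1)); [move=> x _; rewrite expr0|exact: ccont_cst].
apply: (@eq_ccont _ _ _ (fun s => cofr s * cofr s ^+ k)); first by move=> x _; rewrite exprS.
by apply: ccontM => //; exact: cofr_ccont.
Qed.

Lemma nm_cofrX s k : 0 <= s <= 1 -> nm (cofr s ^+ k : C) <= 1.
Proof. by move=> /andP[s0 s1]; rewrite nmX nm_cofr ger0_norm// exprn_ile1. Qed.

Section InBall.
Variables (p : vec) (rho : R).

Lemma bl_seg x s : bl p rho x -> 0 <= s <= 1 -> bl p rho (seg p x s).
Proof. by move=> px ss; apply: le_lt_trans px; exact: seg_bl. Qed.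

Lemma J_ccont k f x : holomorphic_on (bl p rho) f -> bl p rho x ->
  ccont 0 1 (fun s => cofr s ^+ k * f (seg p x s)).
Proof.
move=> hf px; apply: ccontM; first exact: cofrX_ccont.
by apply: seg_ccont => s ss; apply: hf; exact: bl_seg.
Qed.

Lemma nm_J k f x M : holomorphic_on (bl p rho) f -> bl p rho x ->
  (forall y, bl p rho y -> nm (f y : C) <= M) -> nm (J p k f x : C) <= 2 * M.
Proof.
move=> hf px fM; apply: nm_cint01; first exact: J_ccont.
move=> s ss; rewrite nmM -[leRHS]mul1r; apply: ler_pM; rewrite ?nm_ge0 ?nm_cofrX//.
by apply: fM; exact: bl_seg.
Qed.

(** The Taylor remainder is quadratic in [h] uniformly along the segment, so differentiation passes
    under the integral; the chain rule supplies the factor [s] that raises [k] by one. *)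
Lemma J_fd k f x M : bhol f p rho M -> bl p rho x ->
  fd (J p k f) x (fun a => J p k.+1 (pd [:: a] f) x).
Proof.
move=> b px; have hf : holomorphic_on (bl p rho) f by move=> y /b[].
have hdf a : holomorphic_on (bl p rho) (pd [:: a] f) by apply: holo_pd => //; exact: bl_open.
pose r := rho - nm (x - p); have r0 : 0 < r by rewrite subr_gt0.
have bs s : 0 <= s <= 1 -> bhol f (seg p x s) r M.
  by move=> ss; apply: (bhol_sub b); rewrite /r addrC; have := seg_bl p x ss; lra.
have M0 : 0 <= M by apply: (@bhol_M0 _ _ f (seg p x 0) r) => //; apply: bs; rewrite lexx ler01.
move=> e e0; pose K := 2 * (182 * M * (8 / r) ^+ 2).
have K0 : 0 <= K.
  apply: mulr_ge0 (ler0n _ 2) _; apply: mulr_ge0 (sqr_ge0 _); exact: mulr_ge0 (ler0n _ 182) M0.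
have K1 : 0 < K + 1 by rewrite ltr_wpDl.
exists (Num.min (r / 8) (e / (K + 1))).
  by rewrite lt_min; apply/andP; split; apply: divr_gt0.
move=> h; rewrite lt_min => /andP[h8 he].
have pxh : bl p rho (x + h).
  rewrite /bl /= addrAC; apply: (le_lt_trans (nmD _ _)).
  by move: h8; rewrite /r; move: (nm_ge0 (x - p)) px; rewrite /bl /=; lra.
have -> : J p k f (x + h) - J p k f x - dotc (fun a => J p k.+1 (pd [:: a] f) x) h =
   cint 0 1 (fun s => cofr s ^+ k * (f (seg p (x + h) s) - f (seg p x s)
      - dotc (grad f (seg p x s)) (cofr s *: h))).
  have c1 := J_ccont k hf pxh; have c2 := J_ccont k hf px.
  have c3 a : ccont 0 1 (fun s => h 0 a * (cofr s ^+ k.+1 * pd [:: a] f (seg p x s))).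
    by apply: ccontZ; exact: J_ccont.
  rewrite /J -cintB// /dotc.
  have -> : \sum_i h 0 i * cint 0 1 (fun s => cofr s ^+ k.+1 * pd [:: i] f (seg p x s))
     = cint 0 1 (fun s => \sum_i h 0 i * (cofr s ^+ k.+1 * pd [:: i] f (seg p x s))).
    rewrite cint_sum//; apply: eq_bigr => i _; rewrite cintZ//; exact: J_ccont.
  rewrite -cintB; [|exact: ccontB|exact: ccont_sum].
  apply: eq_cint => s _; rewrite !mulrBr mulr_sumr; congr (_ - _).
  by apply: eq_bigr => i _; rewrite mxE /grad exprSr; ring.
apply: (@le_trans _ _ (K * nm h ^+ 2)); last first.
  rewrite expr2 mulrA ler_wpM2r ?nm_ge0//.
  apply: (@le_trans _ _ ((K + 1) * nm h)); first by rewrite ler_wpM2r ?nm_ge0// lerDl.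
  by rewrite mulrC -ler_pdivlMr// ltW.
rewrite /K -mulrA; apply: nm_cint01.
  apply: ccontM; first exact: cofrX_ccont.
  apply: ccontB.
    apply: ccontB; apply: seg_ccont => s ss; apply: hf; exact: bl_seg.
  apply: ccont_sum => i; apply: ccontM.
    apply: (@eq_ccont _ _ _ (fun s => cofr s * h 0 i)); first by move=> s _; rewrite mxE.
    by apply: ccontM; [exact: cofr_ccont|exact: ccont_cst].
  by apply: seg_ccont => s ss; apply: hdf; exact: bl_seg.
move=> s ss; rewrite nmM -[leRHS]mul1r; apply: ler_pM; rewrite ?nm_ge0 ?nm_cofrX//.
have sh : nm (cofr s *: h) <= nm h.
  by case/andP: ss => s0 s1; rewrite nmZ nm_cofr ger0_norm// ler_piMl ?nm_ge0.
have -> : seg p (x + h) s = seg p x s + cofr s *: h.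
  by rewrite /seg [x + h - p]addrAC scalerDr addrA.
apply: (le_trans (taylor_vec r0 (bs s ss) (le_trans sh (ltW h8)))).
apply: ler_wpM2l; first by apply: mulr_ge0 (sqr_ge0 _); exact: mulr_ge0 (ler0n _ 182) M0.
by rewrite !expr2; apply: ler_pM; rewrite ?nm_ge0.
Qed.

Lemma J_diff k f x M : bhol f p rho M -> bl p rho x -> differentiable (J p k f) x.
Proof. by move=> b px; have [] := fd_diff (J_fd k b px). Qed.

Lemma pd_J k f x M a : bhol f p rho M -> bl p rho x ->
  pd [:: a] (J p k f) x = J p k.+1 (pd [:: a] f) x.
Proof.
move=> b px; have [_ g] := fd_diff (J_fd k b px).
by rewrite -[LHS]/(grad (J p k f) x a) g.
Qed.

Lemma J_sub k f g x : holomorphic_on (bl p rho) f -> holomorphic_on (bl p rho) g -> bl p rho x ->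
  J p k (fun y => f y - g y) x = J p k f x - J p k g x.
Proof.
move=> hf hg px; rewrite /J -cintB; try exact: J_ccont.
by apply: eq_cint => s _; rewrite mulrBr.
Qed.

Lemma eq_J k f g x : (forall y, bl p rho y -> f y = g y) -> bl p rho x -> J p k f x = J p k g x.
Proof. by move=> fg px; apply: eq_cint => s ss; rewrite fg//; exact: bl_seg. Qed.

Lemma J_sum k (I : Type) (r : seq I) (f : I -> vec -> C) x :
  (forall i, holomorphic_on (bl p rho) (f i)) -> bl p rho x ->
  J p k (fun y => \sum_(i <- r) f i y) x = \sum_(i <- r) J p k (f i) x.
Proof.
move=> hf px; rewrite /J -cint_sum//; last by move=> i; exact: J_ccont.
by apply: eq_cint => s _; rewrite mulr_sumr.
Qed.

(* Integrating the derivative of [s * f (p + s (x - p))]. *)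
Lemma J_homotopy f x : holomorphic_on (bl p rho) f -> bl p rho x ->
  f x = J p 0 f x + \sum_a (x - p) 0 a * J p 1 (pd [:: a] f) x.
Proof.
move=> hf px.
have hdf a : holomorphic_on (bl p rho) (pd [:: a] f) by apply: holo_pd => //; exact: bl_open.
have cf : ccont 0 1 (fun s => f (seg p x s)).
  by apply: seg_ccont => s ss; apply: hf; exact: bl_seg.
have cd0 : ccont 0 1 (fun s => dotc (grad f (seg p x s)) (x - p)).
  by apply: seg_ccont_dotc => a s ss; apply: hdf; exact: bl_seg.
have cd1 : ccont 0 1 (fun s => cofr s * dotc (grad f (seg p x s)) (x - p)).
  by apply: ccontM => //; exact: cofr_ccont.
have -> : \sum_a (x - p) 0 a * J p 1 (pd [:: a] f) x =
    cint 0 1 (fun s => cofr s * dotc (grad f (seg p x s)) (x - p)).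
  rewrite /J; transitivity (\sum_a cint 0 1 (fun s => (x - p) 0 a * (cofr s ^+ 1 * pd [:: a] f (seg p x s)))).
    by apply: eq_bigr => a _; rewrite cintZ//; exact: J_ccont.
  rewrite -cint_sum//; last by move=> a; apply: ccontZ; exact: J_ccont.
  apply: eq_cint => s _; rewrite /dotc mulr_sumr; apply: eq_bigr => a _.
  by rewrite /grad expr1; ring.
rewrite /J (_ : cint 0 1 _ = cint 0 1 (fun s => f (seg p x s))); last first.
  by apply: eq_cint => s _; rewrite expr0 mul1r.
rewrite -cintD// (@cint_FTC _ _ _ (fun s => cofr s * f (seg p x s)))//.
- by rewrite seg0 seg1 /= (_ : cofr 1 = 1)// (_ : cofr 0 = 0)// mul1r mul0r subr0.
- exact: ccontD.
move=> s ss e e0.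
have df t : 0 <= t <= 1 -> differentiable f (seg p x t) by move=> tt; apply: hf; exact: bl_seg.
have e2 : 0 < e / 2 by rewrite divr_gt0.
have [d d0 dP] := seg_cder df ss e2.
have [d' d'0 dP'] := seg_ccont df ss e2.
exists (Num.min d d') => [|t tt]; first by rewrite lt_min d0.
rewrite lt_min => /andP[td td']; have h1 := dP t tt td; have h2 := dP' t tt td'.
set G := dotc _ _ in h1 *.
have al (a b c y z : C) : y * a - z * b - (y - z) * (b + z * c) = z * (a - b - (y - z) * c) + (y - z) * (a - b).
  by ring.
rewrite cofrB al -cofrB.
apply: (le_trans (nmD _ _)); rewrite !nmM !nm_cofr.
have s1 : `|s| <= 1 by case/andP: ss => s0 s1; rewrite ger0_norm.
have k1 : `|s| * nm (f (seg p x t) - f (seg p x s) - cofr (t - s) * G) <= 1 * (e / 2 * `|t - s|).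
  by apply: ler_pM; rewrite ?nm_ge0.
have k2 : `|t - s| * nm (f (seg p x t) - f (seg p x s)) <= `|t - s| * (e / 2).
  by rewrite ler_wpM2l// ltW.
lra.
Qed.
End InBall.
End Calculus.

(** * Flat linear systems *)

(** Induction step for tails of geometric series: when the steps halve, a tail is at most twice its
    first term. *)
Lemma geom_tele (K : realFieldType) (x y z : K) : x * y + (z - 2 * x * y) <= z - 2 * x * (y / 2).
Proof. lra. Qed.

Section Frobenius.
Variables (R : realType) (n N : nat).
Local Notation C := (Cplx R).
Local Notation vec := 'rV[C]_n.
Implicit Types (p q h x : vec) (rho M e : R) (a b : 'I_n) (i j : 'I_N).

Lemma nm_sum_le m (u : 'I_m -> C) M : (forall t, nm (u t : C) <= M) ->
  nm (\sum_t u t : C) <= m%:R * M.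
Proof.
move=> uM; apply: (le_trans (nm_sum _ _ _)).
apply: (@le_trans _ _ (\sum_(t < m) M)); first exact: ler_sum.
by rewrite sumr_const card_ord mulr_natl.
Qed.

Lemma half_pow_eq0 (z : C) M : 0 <= M -> (forall m : nat, nm (z : C) <= M / 2 ^+ m) -> z = 0.
Proof.
move=> M0 h; apply: nm_eq0; apply/eqP; rewrite eq_le nm_ge0 andbT.
apply/ler_addgt0Pr => e e0; rewrite add0r.
by have [m mP] := pow2_small M0 e0; apply: (le_trans (h m)); exact: ltW.
Qed.

Section Picard.
Variables (A : 'I_n -> 'I_N -> 'I_N -> vec -> C) (p : vec) (rho B : R) (c : 'I_N -> C).
Hypothesis Ab : forall a i j, bhol (A a i j) p rho B.
Hypothesis small : n%:R * (N%:R * (rho * (2 * B))) <= 1 / 2.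

(** The integral operator of the system. The hypothesis [small] makes it halve sup norms: [n * N]
    terms, each with [rho] from [x - p], [B] from the coefficient and 2 from the integral. *)
Definition linop (k : nat) (X : 'I_n -> 'I_N -> vec -> C) i x : C :=
  \sum_a \sum_j (x - p) 0 a * J p k (fun y => A a i j y * X a j y) x.

Lemma linop_le k X i x M : 0 <= M -> (forall a j, holomorphic_on (bl p rho) (X a j)) ->
  (forall a j y, bl p rho y -> nm (X a j y : C) <= M) -> bl p rho x ->
  nm (linop k X i x : C) <= M / 2.
Proof.
move=> M0 hX XM px.
apply: (@le_trans _ _ (n%:R * (N%:R * (rho * (2 * (B * M)))))); last first.
  rewrite (_ : n%:R * (N%:R * (rho * (2 * (B * M)))) = n%:R * (N%:R * (rho * (2 * B))) * M); last by ring.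
  by apply: (le_trans (ler_wpM2r M0 small)); rewrite mulrC; lra.
have hA a i' j : holomorphic_on (bl p rho) (A a i' j) by move=> y py; have [] := Ab a i' j py.
apply: nm_sum_le => a; apply: nm_sum_le => j.
rewrite nmM; apply: ler_pM; rewrite ?nm_ge0//.
  by apply: (le_trans (nm_coord _ _)); exact: ltW.
apply: (@nm_J _ _ _ rho) => //.
  by move=> y py; apply: differentiableM; [exact: hA|exact: hX].
move=> y py; rewrite nmM; apply: ler_pM; rewrite ?nm_ge0//.
  by have [] := Ab a i j py.
exact: XM.
Qed.

Lemma linop_bhol k X i M M' : (forall a j, bhol (X a j) p rho M) ->
  (forall x, bl p rho x -> nm (linop k X i x : C) <= M') -> bhol (linop k X i) p rho M'.
Proof.
move=> hX le x px; split; last exact: le.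
apply: diff_sum => a; apply: diff_sum => j; apply: differentiableM.
  exact: diff_coordB.
apply: (@J_diff _ _ _ rho _ _ _ (B * M)) => // y py.
have [d1 b1] := Ab a i j py; have [d2 b2] := hX a j y py; split.
  exact: differentiableM.
by rewrite nmM; apply: ler_pM; rewrite ?nm_ge0.
Qed.

Lemma linopB k X Y i x : (forall a j, holomorphic_on (bl p rho) (X a j)) ->
  (forall a j, holomorphic_on (bl p rho) (Y a j)) -> bl p rho x ->
  linop k (fun a j y => X a j y - Y a j y) i x = linop k X i x - linop k Y i x.
Proof.
move=> hX hY px; rewrite /linop -sumrB; apply: eq_bigr => a _.
rewrite -sumrB; apply: eq_bigr => j _; rewrite -mulrBr; congr (_ * _).
have hA i' : holomorphic_on (bl p rho) (A a i' j) by move=> y py; have [] := Ab a i' j py.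
rewrite -(@J_sub _ _ _ rho _ _ _ _ _ _ px).
- by apply: eq_cint => s _; rewrite mulrBr.
- by move=> y py; apply: differentiableM; [exact: hA|exact: hX].
- by move=> y py; apply: differentiableM; [exact: hA|exact: hY].
Qed.

(** An invariant bound: [nm (c i) <= M / 2], and [linop] contributes another [M / 2]. *)
Let M := 2 * \sum_i nm (c i : C).

Let M0 : 0 <= M.
Proof. by rewrite mulr_ge0// sumr_ge0// => i _; exact: nm_ge0. Qed.

Let cM i : nm (c i : C) <= M / 2.
Proof.
rewrite /M mulrAC divff// mul1r (bigD1 i)//= lerDl sumr_ge0// => j _.
exact: nm_ge0.
Qed.

Fixpoint pic (m : nat) : 'I_N -> vec -> C :=
  if m is m'.+1 then fun i x => c i + linop 0 (fun _ => pic m') i x else fun i _ => c i.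

Lemma pic_bhol m i : bhol (pic m i) p rho M.
Proof.
elim: m i => [|m ih] i x px.
  split; first exact: differentiable_cst.
  by apply: (le_trans (cM i)); move: M0; lra.
have hX (a : 'I_n) j : holomorphic_on (bl p rho) (pic m j) by move=> y py; have [] := ih j y py.
have le y : bl p rho y -> nm (linop 0 (fun _ => pic m) i y : C) <= M / 2.
  move=> py; apply: (@linop_le 0 (fun _ => pic m) i y M M0 hX _ py).
  by move=> a j z pz; have [] := ih j z pz.
have [d b] := linop_bhol (fun a j => ih j) le px; split.
  by apply: differentiableD => //; exact: differentiable_cst.
apply: (le_trans (nmD _ _)); have := cM i; move: b; lra.
Qed.

Lemma pic_hol m i : holomorphic_on (bl p rho) (pic m i).
Proof. by move=> x px; have [] := pic_bhol m i px. Qed.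

Lemma pic_step m i x : bl p rho x -> nm (pic m.+1 i x - pic m i x : C) <= M / 2 ^+ m.
Proof.
elim: m i x => [|m ih] i x px.
  rewrite /= addrC addKr expr0 divr1.
  apply: (@le_trans _ _ (M / 2)); last by move: M0; lra.
  apply: linop_le => //; first by move=> a j y _; exact: differentiable_cst.
  by move=> a j y _; apply: (le_trans (cM j)); move: M0; lra.
rewrite -[pic m.+2 i x]/(c i + linop 0 (fun _ => pic m.+1) i x).
rewrite -[pic m.+1 i x]/(c i + linop 0 (fun _ => pic m) i x).
rewrite opprD addrACA subrr add0r.
rewrite -(@linopB 0 (fun _ => pic m.+1) (fun _ => pic m) i x (fun _ => pic_hol m.+1) (fun _ => pic_hol m) px).
rewrite exprSr invfM mulrA; apply: linop_le px.
- by rewrite divr_ge0// exprn_ge0.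
- by move=> a j y py; apply: differentiableB; exact: pic_hol.
- by move=> a j y py; exact: ih.
Qed.

Lemma pic_cauchy m l i x : bl p rho x -> nm (pic (m + l) i x - pic m i x : C) <= 2 * M / 2 ^+ m.
Proof.
move=> px; apply: (@le_trans _ _ (2 * M / 2 ^+ m - 2 * M / 2 ^+ (m + l))); last first.
  by rewrite gerBl divr_ge0 ?exprn_ge0// mulr_ge0.
elim: l => [|l ih]; first by rewrite addn0 !subrr nm0.
rewrite addnS -(subrK (pic (m + l) i x) (pic (m + l).+1 i x)) -addrA.
apply: (le_trans (nmD _ _)).
apply: (le_trans (lerD (pic_step (m + l) i px) ih)).
rewrite exprSr invfM; exact: geom_tele.
Qed.

Lemma pic_limit : exists Psi : 'I_N -> vec -> C, forall m i x, bl p rho x ->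
  nm (pic m i x - Psi i x : C) <= 2 * M / 2 ^+ m.
Proof.
have h (ix : 'I_N * vec) : exists l, bl p rho ix.2 -> cvgs (fun m => pic m ix.1 ix.2) l.
  have [px|] := pselect (bl p rho ix.2); last by exists 0.
  have [l lP] : exists l, cvgs (fun m => pic m ix.1 ix.2) l; last by exists l.
  apply: cauchy_cvgs => e e0.
  have [m mP] := pow2_small (mulr_ge0 (ler0n _ 2) (mulr_ge0 (ler0n _ 2) M0)) e0.
  exists m => k l mk ml.
  have := pic_cauchy m (k - m) ix.1 px; have := pic_cauchy m (l - m) ix.1 px.
  rewrite !subnKC// => h1 h2.
  rewrite (_ : _ - _ = (pic k ix.1 ix.2 - pic m ix.1 ix.2) - (pic l ix.1 ix.2 - pic m ix.1 ix.2)); last by ring.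
  by apply: (le_trans (nmB _ _)); apply: le_trans (ltW mP); lra.
have [P PP] := choice h; exists (fun i x => P (i, x)) => m i x px.
apply/ler_addgt0Pr => e e0; have [k kP] := PP (i, x) px e e0.
have := kP (m + k)%N (leq_addl _ _) => /= h1; have h2 := pic_cauchy m k i px.
rewrite (_ : _ - _ = (pic (m + k) i x - P (i, x)) - (pic (m + k) i x - pic m i x)); last by ring.
by apply: (le_trans (nmB _ _)); rewrite addrC; apply: lerD.
Qed.

(** The iterates converge geometrically and uniformly on the ball, so the limit is holomorphic by
    [unif_limit]. For arbitrary coefficients this solves only the radial part of the system. *)
Lemma picard : exists2 Psi : 'I_N -> vec -> C, (forall i, bhol (Psi i) p rho M) &
  forall i x, bl p rho x -> Psi i x = c i + linop 0 (fun _ => Psi) i x.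
Proof.
have [Psi PP] := pic_limit.
have hb i : bhol (Psi i) p rho M.
  move=> x px.
  pose r := rho - nm (x - p); have r0 : 0 < r by rewrite subr_gt0.
  have sub y : nm (y - x) < r -> bl p rho y.
    move=> yx; rewrite /bl /= (_ : y - p = (y - x) + (x - p)); last by rewrite addrA subrK.
    by apply: (le_lt_trans (nmD _ _)); rewrite -ltrBrDr.
  split.
    have [c' fc _] : exists2 c', fd (Psi i) x c' & forall a, cvgs (fun m => grad (pic m i) x a) (c' a).
      apply: (@unif_limit _ _ (fun m => pic m i) (Psi i) x r M) => //.
        by move=> m; apply: (bhol_sub (pic_bhol m i)); rewrite /r addrC subrK.
      move=> e e0; have [m mP] := pow2_small (mulr_ge0 (ler0n _ 2) M0) e0.
      exists m => k mk y yx; apply: (le_trans (PP k i y (sub y yx))).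
      apply: le_trans (ltW mP); apply: ler_wpM2l; first by rewrite mulr_ge0.
      by rewrite lef_pV2 ?posrE ?exprn_gt0// ler_weXn2l// ler1n.
    by have [] := fd_diff fc.
  apply/ler_addgt0Pr => e e0.
  have [m mP] := pow2_small (mulr_ge0 (ler0n _ 2) M0) e0.
  have h1 := PP m i x px; have [_ h2] := pic_bhol m i px.
  rewrite (_ : Psi i x = pic m i x - (pic m i x - Psi i x)); last by ring.
  by apply: (le_trans (nmB _ _)); apply: lerD => //; apply: (le_trans h1); exact: ltW.
exists Psi => // i x px; apply/eqP; rewrite -subr_eq0; apply/eqP.
have hP (a : 'I_n) j : holomorphic_on (bl p rho) (Psi j) by move=> y py; have [] := hb j y py.
(* The error of [linop] at stage [m] and that of the iterate [m.+1] are both [2 * M / 2 ^+ m.+1],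
   with sum [2 * M / 2 ^+ m]. *)
apply: (@half_pow_eq0 _ (2 * M)) => [|m]; first by rewrite mulr_ge0.
have h1 := PP m.+1 i x px.
have h2 : nm (linop 0 (fun _ => pic m) i x - linop 0 (fun _ => Psi) i x : C) <= 2 * M / 2 ^+ m / 2.
  rewrite -linopB//; last by move=> a j; exact: pic_hol.
  apply: linop_le px.
  - by rewrite divr_ge0 ?exprn_ge0// mulr_ge0.
  - by move=> a j y py; apply: differentiableB; [exact: pic_hol|exact: hP].
  - by move=> a j y py; exact: PP.
rewrite -[pic m.+1 i x]/(c i + linop 0 (fun _ => pic m) i x) in h1.
set u := linop _ _ _ _ in h1 h2; set w := linop _ _ _ _ in h2 *.
rewrite (_ : _ - _ = (u - w) - (c i + u - Psi i x)); last by ring.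
apply: (le_trans (nmB _ _)); apply: (le_trans (lerD h2 h1)).
rewrite exprSr invfM; lra.
Qed.
End Picard.
End Frobenius.

(** * From the integral equation to the differential system *)

Section FlatSystem.
Variables (R : realType) (n N : nat).
Local Notation C := (Cplx R).
Local Notation vec := 'rV[C]_n.
Implicit Types (p q h x : vec) (rho M e : R) (a b : 'I_n) (i j : 'I_N).

Lemma common_bhol (T : finType) (D : set vec) (u : T -> vec -> C) p :
  open D -> D p -> (forall t, holomorphic_on D (u t)) ->
  exists rho, exists M, [/\ 0 < rho, 0 <= M, forall t, bhol (u t) p rho M & bl p rho `<=` D].
Proof.
move=> oD Dp hu.
have [r [M rM]] : exists (r M : T -> R), forall t, [/\ 0 < r t, bhol (u t) p (r t) (M t) &
    forall q, nm (q - p) < r t -> D q].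
  have [r rP] := choice (fun t => holo_bhol oD (hu t) Dp).
  by have [M MP] := choice rP; exists r, M.
have [d d0 dD] := (nm_openP D).1 oD p Dp.
(* [S^-1] is below [d] and all [r t] at once; the term [d^-1] keeps [S] positive for empty [T]. *)
pose S := d^-1 + \sum_t (r t)^-1.
have sum0 : 0 <= \sum_t (r t)^-1.
  by apply: sumr_ge0 => t _; rewrite invr_ge0 ltW//; case: (rM t).
have S0 : 0 < S by rewrite ltr_wpDr// invr_gt0.
have St t : S^-1 <= r t.
  have [rt0 _ _] := rM t.
  rewrite -[leRHS]invrK lef_pV2 ?posrE ?invr_gt0// /S (bigD1 t)//= addrCA lerDl.
  rewrite addr_ge0 ?invr_ge0 ?(ltW d0)//; apply: sumr_ge0 => s _.
  by rewrite invr_ge0 ltW//; case: (rM s).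
have Sd : S^-1 <= d.
  by rewrite -[leRHS]invrK lef_pV2 ?posrE ?invr_gt0// lerDl.
exists S^-1, (\sum_t `|M t|); split.
- by rewrite invr_gt0.
- by apply: sumr_ge0.
- move=> t q qS; have [_ /(_ q (lt_le_trans qS (St t)))[df fM] _] := rM t.
  split=> //; apply: (le_trans fM); apply: (le_trans (ler_norm _)).
  by rewrite (bigD1 t)//= lerDl sumr_ge0.
- by move=> q qS; apply: dD; exact: lt_le_trans Sd.
Qed.

(** The regrouping behind [GE]: with the derivative of [Psi] written as [E + w], the curl of [w]
    splits into a part linear in [E], a quadratic part in [A], and the curl of [A]. *)
Lemma curl_alg (A B Eb Ea wb wa P pb pa : C) :
  (A * (Eb + wb) + P * pb) - (B * (Ea + wa) + P * pa) =
  (A * Eb - B * Ea) + (A * wb - B * wa) + P * (pb - pa).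
Proof. by ring. Qed.

(** The defect [E = d Psi - A Psi] of Picard's solution satisfies a linear integral equation without
    inhomogeneous term, because flatness makes the curl of [A Psi] linear in [E]. Its operator is a
    contraction, so [E] vanishes. *)
Theorem flat_system (D : set vec) (A : 'I_n -> 'I_N -> 'I_N -> vec -> C) p (c : 'I_N -> C) :
  open D -> D p -> (forall a i j, holomorphic_on D (A a i j)) ->
  (forall x a b i j, D x -> pd [:: b] (A a i j) x - pd [:: a] (A b i j) x
     + \sum_k (A a i k x * A b k j x - A b i k x * A a k j x) = 0) ->
  exists rho, exists Psi : 'I_N -> vec -> C, [/\ 0 < rho, bl p rho `<=` D,
    forall i, holomorphic_on (bl p rho) (Psi i), forall i, Psi i p = c i &
    forall x a i, bl p rho x -> pd [:: a] (Psi i) x = \sum_j A a i j x * Psi j x].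
Proof.
move=> oD Dp hA flat.
have [rho1 [B [rho10 B0 Ab1 sub1]]] := @common_bhol _ D
  (fun t : 'I_n * 'I_N * 'I_N => A t.1.1 t.1.2 t.2) p oD Dp (fun t => hA _ _ _).
pose L := n%:R * (N%:R * (2 * B)); have L0 : 0 <= L by rewrite !mulr_ge0.
(* Makes [rho * L <= 1 / 2], the contraction factor of both the Picard iteration and the estimate of
   the defect. *)
pose rho := Num.min rho1 (1 / (2 * L + 1)).
have L1 : 0 < 2 * L + 1 by rewrite ltr_wpDl// mulr_ge0.
have rho0 : 0 < rho by rewrite lt_min rho10 divr_gt0.
have rr1 : rho <= rho1 by rewrite ge_min lexx.
have rL : rho * L <= 1 / 2.
  have h : rho <= 1 / (2 * L + 1) by rewrite ge_min lexx orbT.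
  rewrite ler_pdivlMr// in h; move: rho0; nra.
have Ab a i j : bhol (A a i j) p rho B.
  by move=> q qr; exact: (Ab1 (a, i, j) q (lt_le_trans qr rr1)).
have sub x : bl p rho x -> D x by move=> px; apply: sub1; exact: lt_le_trans rr1.
have small : n%:R * (N%:R * (rho * (2 * B))) <= 1 / 2.
  by rewrite (_ : _ * _ = rho * L)// /L; ring.
have [Psi hPsi ePsi] := picard c Ab small.
set M := 2 * _ in hPsi.
have M0 : 0 <= M by rewrite /M mulr_ge0// sumr_ge0// => i _; exact: nm_ge0.
clearbody M.
have dA a i j : holomorphic_on (bl p rho) (A a i j) by move=> x px; have [] := Ab a i j x px.
have dP i : holomorphic_on (bl p rho) (Psi i) by move=> x px; have [] := hPsi i x px.
have ob : open (bl p rho) by exact: bl_open.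
pose w a i y : C := \sum_j A a i j y * Psi j y.
have hAP a i j : bhol (fun y => A a i j y * Psi j y) p rho (B * M).
  move=> y py; have [d1 b1] := Ab a i j y py; have [d2 b2] := hPsi j y py; split.
    exact: differentiableM.
  by rewrite nmM; apply: ler_pM; rewrite ?nm_ge0.
have dAP a i j : holomorphic_on (bl p rho) (fun y => A a i j y * Psi j y).
  by move=> y py; have [] := hAP a i j y py.
have hw a i : bhol (w a i) p rho (N%:R * (B * M)).
  move=> y py; split; last by apply: nm_sum_le => j; have [] := hAP a i j y py.
  by apply: diff_sum => j; have [] := hAP a i j y py.
have dw a i : holomorphic_on (bl p rho) (w a i) by move=> y py; have [] := hw a i y py.
have dpw a b i : holomorphic_on (bl p rho) (pd [:: b] (w a i)) by exact: holo_pd.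
have PsiE i x : bl p rho x -> Psi i x = c i + \sum_a (x - p) 0 a * J p 0 (w a i) x.
  move=> px; rewrite [LHS]ePsi//; congr (_ + _); apply: eq_bigr => a _.
  by rewrite -mulr_sumr; congr (_ * _); rewrite -(@J_sum _ _ _ rho).
(* The radius is halved because [E] contains derivatives of [Psi], which Cauchy's estimate bounds
   uniformly only away from the boundary. *)
exists (rho / 2), Psi.
have r2 : rho / 2 <= rho by rewrite ler_pdivrMr// ler_peMr ?(ltW rho0)// ler1n.
have r20 : 0 < rho / 2 by rewrite divr_gt0.
have sub2 x : bl p (rho / 2) x -> bl p rho x by move=> px; exact: lt_le_trans r2.
split => //.
- by move=> x px; exact/sub/sub2.
- by move=> i x /sub2 px; exact: dP.
- move=> i; rewrite PsiE; last exact: bl_center.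
  by rewrite big1 ?addr0// => a _; rewrite subrr mxE mul0r.
pose E b i y := pd [:: b] (Psi i) y - w b i y.
have dE b i : holomorphic_on (bl p rho) (E b i).
  move=> y py; apply: differentiableB; last exact: dw.
  by have := holo_pd b ob (dP i) py.
pose G a b i y := \sum_j (A a i j y * E b j y - A b i j y * E a j y).
have dG a b i : holomorphic_on (bl p rho) (G a b i).
  move=> y py; apply: diff_sum => j; apply: differentiableB;
    by apply: differentiableM; [exact: dA|exact: dE].
(* The only use of flatness: it cancels every term of the curl of [w] that is free of [E]. *)
have GE a b i y : bl p rho y -> pd [:: b] (w a i) y - pd [:: a] (w b i) y = G a b i y.
  move=> py.
  have pw a' b' : pd [:: b'] (w a' i) y =
      \sum_j (A a' i j y * (E b' j y + w b' j y) + Psi j y * pd [:: b'] (A a' i j) y).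
    rewrite pd_sum; last by move=> j; exact: dAP.
    apply: eq_bigr => j _; rewrite pdM; [|exact: dA|exact: dP].
    by rewrite /E subrK.
  rewrite !pw -sumrB.
  have fl j := flat y a b i j (sub _ py).
  have Z : \sum_j Psi j y * (pd [:: b] (A a i j) y - pd [:: a] (A b i j) y
     + \sum_k (A a i k y * A b k j y - A b i k y * A a k j y)) = 0.
    by apply: big1 => j _; rewrite fl mulr0.
  have Z2 : \sum_j (A a i j y * w b j y - A b i j y * w a j y) =
      \sum_j Psi j y * \sum_k (A a i k y * A b k j y - A b i k y * A a k j y).
    transitivity (\sum_j \sum_k (A a i j y * A b j k y - A b i j y * A a j k y) * Psi k y).
      apply: eq_bigr => j _; rewrite /w !mulr_sumr -sumrB; apply: eq_bigr => k _; ring.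
    rewrite exchange_big /=; apply: eq_bigr => j _; rewrite mulr_sumr.
    by apply: eq_bigr => k _; ring.
  transitivity (G a b i y + \sum_j (A a i j y * w b j y - A b i j y * w a j y)
      + \sum_j Psi j y * (pd [:: b] (A a i j) y - pd [:: a] (A b i j) y)).
    rewrite /G -big_split -big_split /=; apply: eq_bigr => j _.
    exact: curl_alg.
  rewrite Z2 -addrA -big_split /= -[RHS]addr0 -[X in _ = _ + X]Z; congr (_ + _).
  by apply: eq_bigr => j _; rewrite [RHS]mulrDr [RHS]addrC.
(* Differentiate the integral equation for [Psi] and subtract the homotopy formula [J_homotopy] for
   [w b i]: the curl of [w] remains under [J p 1]. *)
have EE b i x : bl p rho x -> E b i x = \sum_a (x - p) 0 a * J p 1 (G a b i) x.
  move=> px; rewrite /E.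
  have -> : pd [:: b] (Psi i) x = pd [:: b] (fun x => c i + \sum_a (x - p) 0 a * J p 0 (w a i) x) x.
    by apply: (eq_pd (D := bl p rho)) => //; exact: PsiE.
  have dJ a : differentiable (J p 0 (w a i)) x by exact: J_diff (hw a i) px.
  have dxJ a : differentiable (fun x => (x - p) 0 a * J p 0 (w a i) x) x.
    by apply: differentiableM => //; exact: diff_coordB.
  rewrite pdD; [|exact: differentiable_cst|exact: diff_sum].
  rewrite pd_cst add0r pd_sum//.
  have -> : \sum_a pd [:: b] (fun x => (x - p) 0 a * J p 0 (w a i) x) x =
      J p 0 (w b i) x + \sum_a (x - p) 0 a * J p 1 (pd [:: b] (w a i)) x.
    transitivity (\sum_a ((x - p) 0 a * J p 1 (pd [:: b] (w a i)) x + J p 0 (w a i) x * (b == a)%:R)).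
      apply: eq_bigr => a _; rewrite pdM//; last exact: diff_coordB.
      by rewrite pd_coordB (pd_J 0 b (hw a i) px).
    rewrite big_split /= addrC; congr (_ + _).
    rewrite (bigD1 b)//= eqxx mulr1 big1 ?addr0// => a ab.
    by rewrite eq_sym (negPf ab) mulr0.
  rewrite [w b i x](@J_homotopy _ _ p rho)// opprD addrACA subrr add0r -sumrB.
  apply: eq_bigr => a _; rewrite -mulrBr -(@J_sub _ _ _ rho)//.
  by congr (_ * _); apply: (@eq_J _ _ p rho) => // y py; exact: GE.
pose K := 88 * M / (rho / 2) + N%:R * (B * M).
have K0 : 0 <= K.
  have h1 : 0 <= N%:R * (B * M) by rewrite !mulr_ge0.
  have h2 : 0 <= 88 * M / (rho / 2) by apply: divr_ge0; [exact: mulr_ge0|exact: ltW].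
  by rewrite /K addr_ge0.
have EK b i y : bl p (rho / 2) y -> nm (E b i y : C) <= K.
  move=> py; apply: (le_trans (nmB _ _)); apply: lerD; last first.
    by have [] := hw b i y (sub2 _ py).
  apply: (@cauchy_grad _ _ (Psi i) y (rho / 2) M b) => //.
  by apply: (bhol_sub (hPsi i)); move: py; rewrite /bl /=; lra.
(* Each use of [EE] multiplies the bound by [rho * L <= 1 / 2]. *)
have Em m : forall b i y, bl p (rho / 2) y -> nm (E b i y : C) <= K / 2 ^+ m.
  elim: m => [|m ih] b i y py; first by rewrite expr0 divr1 EK.
  rewrite EE; last exact: sub2.
  pose T := K / 2 ^+ m; have T0 : 0 <= T by rewrite divr_ge0// exprn_ge0.
  apply: (@le_trans _ _ (n%:R * (rho / 2 * (2 * (N%:R * (2 * (B * T))))))); last first.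
    rewrite (_ : n%:R * _ = rho * L * T); last by rewrite /L; field.
    apply: (le_trans (ler_wpM2r T0 rL)); rewrite /T exprSr invfM; lra.
  apply: nm_sum_le => a; rewrite nmM; apply: ler_pM; rewrite ?nm_ge0//.
    by apply: (le_trans (nm_coord _ _)); exact: ltW.
  apply: (@nm_J _ _ _ (rho / 2)) => //.
    by move=> z pz; apply: dG; exact: sub2.
  move=> z pz; apply: nm_sum_le => j; apply: (le_trans (nmB _ _)).
  rewrite !nmM mulr_natl mulr2n; have sz := sub2 _ pz.
  apply: lerD; apply: ler_pM; rewrite ?nm_ge0 ?ih//.
    by have [] := Ab a i j z sz.
  by have [] := Ab b i j z sz.
move=> x a i px; apply/eqP; rewrite -subr_eq0; apply/eqP.
by apply: (half_pow_eq0 K0) => m; exact: Em.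
Qed.
End FlatSystem.

(** * Inverse function theorem *)

Section InverseFunction.
Variables (R : realType) (n : nat).
Local Notation C := (Cplx R).
Local Notation vec := 'rV[C]_n.
Implicit Types (p q h x y z : vec) (r e : R) (a b k : 'I_n).

Lemma ex_choice (X Y : Type) (P : X -> Y -> Prop) :
  (forall t, exists s, P t s) -> exists f, forall t, P t (f t).
Proof. by move=> /choice[f fP]; exists f. Qed.

Lemma diff_coord m (phi : vec -> 'rV[C]_m) x (k : 'I_m) : differentiable phi x ->
  differentiable (fun x => phi x 0 k : C) x.
Proof.
move=> d; apply: (@differentiable_comp _ _ _ _ phi (fun y : 'rV[C]_m => y 0 k : C)) => //.
exact: differentiable_coord.
Qed.

Lemma diff_rowP m (phi : vec -> 'rV[C]_m) x :
  (forall k : 'I_m, differentiable (fun x => phi x 0 k : C) x) -> differentiable phi x.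
Proof.
move=> d.
have -> : phi = \sum_(k < m) (fun x => phi x 0 k *: delta_mx 0 k : 'rV[C]_m).
  by apply/funext => y; rewrite fct_sumE [LHS]row_sum_delta.
by apply: differentiable_sum => k; apply: (@differentiableZl _ _ _ (fun x => phi x 0 k : C)).
Qed.

Lemma diff_row_coord m (phi : vec -> 'rV[C]_m) x v (k : 'I_m) : differentiable phi x ->
  ('d phi x v) 0 k = dotc (grad (fun x => phi x 0 k : C) x) v.
Proof.
move=> d; have dk := diff_coord k d.
rewrite -(gradE dk) -!deriveE//.
have L : (fun t : C => t^-1 *: (phi (t *: v + x) - phi x)) @ 0^' --> 'D_v phi x.
  exact: diff_derivable.
apply/esym/cvg_lim => //.
have := cvg_comp _ _ L (@coord_continuous C 1 m 0 k _).
by apply: cvg_trans; apply: near_eq_cvg; near=> t; rewrite /= !mxE.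
Unshelve. all: by end_near. Qed.

Lemma seg_convex p r x y s : bl p r x -> bl p r y -> 0 <= s <= 1 -> bl p r (seg x y s).
Proof.
move=> px py /andP[s0 s1]; rewrite /bl /= /seg.
have -> : x + cofr s *: (y - x) - p = cofr (1 - s) *: (x - p) + cofr s *: (y - p).
  by rewrite cofrB scalerBl (_ : cofr 1 = 1)// scale1r !scalerBr; apply/rowP => i; rewrite !mxE; ring.
apply: (le_lt_trans (nmD _ _)); rewrite !nmZ !nm_cofr !ger0_norm ?subr_ge0//.
move: px py; rewrite /bl /=; set u := nm _; set w := nm _ => ux wy.
have [->|s1'] := eqVneq s 1; first by rewrite subrr mul0r mul1r add0r.
have h : (1 - s) * u < (1 - s) * r by rewrite ltr_pM2l// subr_gt0 lt_neqAle s1' s1.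
have h' : s * w <= s * r by rewrite ler_wpM2l// ltW.
lra.
Qed.

(** With identity Jacobian at [p], [phi - id] has Lipschitz constant [1 / 2] near [p]: a fixed point
    iteration gives surjectivity onto a ball, and [lower] gives injectivity and a Lipschitz
    inverse. *)
Theorem inverse_function (D : set vec) (phi : vec -> vec) p :
  open D -> D p -> (forall k, holomorphic_on D (fun x => phi x 0 k : C)) ->
  (forall a k, pd [:: a] (fun x => phi x 0 k : C) p = (a == k)%:R) ->
  exists V : set vec, [/\ open V, V p, V `<=` D, open (phi @` V) &
    exists2 psi, holomorphic_on (phi @` V) psi & forall q, V q -> psi (phi q) = q].
Proof.
move=> oD Dp hphi gphi.
pose g k x : C := phi x 0 k - x 0 k.
have dcoord k x : differentiable (fun x : vec => x 0 k : C) x by exact: differentiable_coord.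
have hg k : holomorphic_on D (g k).
  by move=> x Dx; apply: differentiableB => //; exact: hphi.
have pdx a k x : pd [:: a] (fun x : vec => x 0 k : C) x = (a == k)%:R.
  have [_ gg] := fd_diff (coord_fd k x).
  by rewrite -[LHS]/(grad (fun x : vec => x 0 k : C) x a) gg.
have pdg a k x : D x -> pd [:: a] (g k) x = pd [:: a] (fun x => phi x 0 k : C) x - (a == k)%:R.
  by move=> Dx; rewrite pdB ?pdx//; exact: hphi.
have hpg a k : holomorphic_on D (pd [:: a] (g k)) by exact: holo_pd.
(* Makes the constant [2 * (n%:R * L)] of [lipschitz_seg] at most [1 / 2]; the [+ 1] keeps [L]
   positive for [n = 0]. *)
pose L : R := (4 * n%:R + 1)^-1; have L0 : 0 < L by rewrite invr_gt0 ltr_wpDl// mulr_ge0.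
have nL : 2 * (n%:R * L) <= 1 / 2.
  have h : 0 < 4 * n%:R + 1 :> R by rewrite ltr_wpDl// mulr_ge0.
  by rewrite /L mulrA ler_pdivrMr//; lra.
have [r [r0 subD gL]] : exists r, [/\ 0 < r, bl p r `<=` D &
    forall a k x, bl p r x -> nm (pd [:: a] (g k) x : C) <= L].
  have [d d0 dD] := (nm_openP D).1 oD p Dp.
  have [t tP] : exists t : 'I_n * 'I_n -> R, forall ak, 0 < t ak /\
      forall x, nm (x - p) < t ak -> nm (pd [:: ak.1] (g ak.2) x : C) <= L.
    apply: (@ex_choice _ _ (fun ak (s : R) => 0 < s /\ forall x, nm (x - p) < s ->
        nm (pd [:: ak.1] (g ak.2) x : C) <= L)) => -[a k] /=.
    have [s s0 sP] := fd_cont (diff_fd (hpg a k p Dp)) L0; exists s; split=> // x xs.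
    have := sP x xs; rewrite [pd _ _ p]pdg// gphi subrr subr0; exact: ltW.
  exists (\big[Num.min/d]_ak t ak); split.
  - by apply/bigmin_gtP; split=> // ak _; case: (tP ak).
  - move=> x px; apply: dD; apply: lt_le_trans px _; exact: bigmin_le_id.
  - move=> a k x px; apply: (tP (a, k)).2; apply: lt_le_trans px _.
    exact: bigmin_le_cond.
have gLip x y : bl p r x -> bl p r y -> nm ((phi x - x) - (phi y - y)) <= 1 / 2 * nm (x - y).
  move=> px py; apply: nm_row_le; first by rewrite mulr_ge0 ?nm_ge0.
  move=> k; rewrite (_ : _ 0 k = g k x - g k y); last by rewrite !mxE.
  apply: (@le_trans _ _ (2 * (n%:R * (nm (x - y) * L)))); last first.
    rewrite (_ : 2 * _ = 2 * (n%:R * L) * nm (x - y)); last by ring.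
    by rewrite ler_wpM2r ?nm_ge0.
  apply: lipschitz_seg => [s ss|a s ss|a s ss].
  - by apply: hg; apply: subD; exact: seg_convex.
  - by apply: hpg; apply: subD; exact: seg_convex.
  - by apply: gL; exact: seg_convex.
have lower x y : bl p r x -> bl p r y -> nm (x - y) <= 2 * nm (phi x - phi y).
  move=> px py; have h := gLip x y px py.
  have := nmB (phi x - phi y) ((phi x - x) - (phi y - y)).
  rewrite (_ : _ - _ - _ = x - y); first by move: h; clear; lra.
  by apply/rowP => i; rewrite !mxE; ring.
have upper x y : bl p r x -> bl p r y -> nm (phi x - phi y) <= 2 * nm (x - y).
  move=> px py; have h := gLip x y px py; have n0 := nm_ge0 (x - y).
  have := nmD ((phi x - x) - (phi y - y)) (x - y).
  rewrite (_ : _ - _ + _ = phi x - phi y); first by move: h n0; clear; lra.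
  by apply/rowP => i; rewrite !mxE; ring.
have pp : bl p r p by rewrite /bl /= subrr nm0.
have surj z : nm (z - phi p) < r / 2 -> exists2 x, bl p r x & phi x = z.
  move=> zr; pose t := nm (z - phi p); have t0 : 0 <= t by exact: nm_ge0.
  (* Fixed points of this map solve [phi x = z]. The iterates stay within [2 * t < r] of [p], hence
     in the ball where [gLip] holds. *)
  pose u m := iter m (fun x => z - (phi x - x)) p.
  have uS m : u m.+1 = z - (phi (u m) - u m) by [].
  have tr : 2 * t < r by rewrite /t; lra.
  have inb m : nm (u m - p) <= 2 * t * (1 - (2 ^+ m)^-1) -> bl p r (u m).
    move=> h; apply: le_lt_trans tr; apply: (le_trans h).
    by rewrite ler_piMr ?mulr_ge0// gerBl invr_ge0 exprn_ge0.
  have key m : nm (u m - p) <= 2 * t * (1 - (2 ^+ m)^-1) /\ nm (u m.+1 - u m) <= t / 2 ^+ m.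
    elim: m => [|m [ih1 ih2]].
      rewrite uS /= subrr nm0 expr0 invr1 subrr mulr0; split=> //.
      by rewrite mulr1 (_ : _ - _ - _ = z - phi p)//; apply/rowP => i; rewrite !mxE; ring.
    have h1 : nm (u m.+1 - p) <= 2 * t * (1 - (2 ^+ m.+1)^-1).
      have := nmD (u m.+1 - u m) (u m - p); rewrite addrA subrK => h.
      apply: (le_trans h); rewrite exprSr invfM; move: ih1 ih2; clear; lra.
    split=> //.
    have := gLip _ _ (inb _ ih1) (inb _ h1).
    rewrite (_ : _ - _ = u m.+2 - u m.+1); last first.
      by rewrite !uS; apply/rowP => i; rewrite !mxE; ring.
    by rewrite nmBC => h; apply: (le_trans h); rewrite exprSr invfM nmBC; move: ih2; clear; lra.
  have um m : bl p r (u m) by apply: inb; case: (key m).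
  have cau m l : nm (u (m + l)%N - u m) <= 2 * t / 2 ^+ m.
    apply: (@le_trans _ _ (2 * t / 2 ^+ m - 2 * t / 2 ^+ (m + l))); last first.
      by rewrite gerBl divr_ge0 ?exprn_ge0// mulr_ge0.
    elim: l => [|l ih]; first by rewrite addn0 !subrr nm0.
    rewrite addnS -(subrK (u (m + l)%N) (u (m + l).+1)) -addrA.
    apply: (le_trans (nmD _ _)).
    have [_ k2] := key (m + l)%N.
    apply: (le_trans (lerD k2 ih)).
    rewrite exprSr invfM; exact: geom_tele.
  have [x xP] : exists x : vec, forall k, cvgs (fun m => u m 0 k) (x 0 k).
    have [l lP] : exists l : 'I_n -> C, forall k, cvgs (fun m => u m 0 k) (l k).
      apply: (@ex_choice _ _ (fun k l => cvgs (fun m => u m 0 k) l)) => k.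
      apply: cauchy_cvgs => e e0.
      have [m mP] := pow2_small (mulr_ge0 (ler0n _ 2) (mulr_ge0 (ler0n _ 2) t0)) e0.
      exists m => i j im jm.
      have := cau m (i - m)%N; have := cau m (j - m)%N; rewrite !subnKC// => h1 h2.
      have h3 := le_trans (nm_coord _ k) h1; have h4 := le_trans (nm_coord _ k) h2.
      rewrite !mxE in h3 h4.
      rewrite (_ : _ - _ = (u i 0 k - u m 0 k) - (u j 0 k - u m 0 k)); last by ring.
      by apply: (le_trans (nmB _ _)); apply: le_trans (ltW mP); move: h3 h4; clear; lra.
    by exists (\row_k l k) => k; rewrite mxE.
  have xm m : nm (u m - x) <= 2 * t / 2 ^+ m.
    apply: nm_row_le => [|k]; first by rewrite divr_ge0 ?exprn_ge0// mulr_ge0.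
    apply/ler_addgt0Pr => e e0; have [l lP] := xP k e e0.
    have h1 := lP (m + l)%N (leq_addl _ _).
    have h2 := le_trans (nm_coord _ k) (cau m l); rewrite !mxE in h2 *.
    rewrite (_ : _ - _ = (u (m + l)%N 0 k - x 0 k) - (u (m + l)%N 0 k - u m 0 k)); last by ring.
    by apply: (le_trans (nmB _ _)); rewrite addrC; apply: lerD.
  have px : bl p r x.
    have := xm 0%N; rewrite /= expr0 divr1 nmBC => h; exact: le_lt_trans tr.
  exists x => //; apply/eqP; rewrite -subr_eq0; apply/eqP/nm_eq0/eqP.
  rewrite eq_le nm_ge0 andbT; apply/ler_addgt0Pr => e e0; rewrite add0r.
  have [m mP] := pow2_small (mulr_ge0 (ler0n _ 5) t0) e0.
  have h1 := upper _ _ px (um m); have [_ h2] := key m; have h3 := xm m.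
  rewrite (_ : phi x - z = (phi x - phi (u m)) - (u m.+1 - u m)); last first.
    by rewrite uS; apply/rowP => i; rewrite !mxE; ring.
  apply: (le_trans (nmB _ _)); rewrite nmBC in h3; move: h1 h2 h3 mP; clear; lra.
(* Cutting down to the preimage of a ball makes the image exactly that ball, so it is open without
   further argument. *)
pose V : set vec := [set x | bl p r x /\ nm (phi x - phi p) < r / 2].
have VE : phi @` V = bl (phi p) (r / 2).
  apply/seteqP; split=> [_ [x [_ xr] <-]//|z zr].
  by have [x px xz] := surj z zr; exists x => //; split=> //; rewrite xz.
exists V; split.
- apply/nm_openP => x [px xr].
  pose s := Num.min (r - nm (x - p)) ((r / 2 - nm (phi x - phi p)) / 2).
  exists s; first by rewrite lt_min subr_gt0 px divr_gt0// subr_gt0.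
  move=> y; rewrite lt_min => /andP[y1 y2].
  have py : bl p r y.
    rewrite /bl /= (_ : y - p = (y - x) + (x - p)); last by rewrite addrA subrK.
    by apply: (le_lt_trans (nmD _ _)); rewrite -ltrBrDr.
  split=> //; have h := upper y x py px.
  rewrite (_ : phi y - phi p = (phi y - phi x) + (phi x - phi p)); last by rewrite addrA subrK.
  by apply: (le_lt_trans (nmD _ _)); move: h y2; clear; lra.
- by split=> //; rewrite subrr nm0 divr_gt0.
- by move=> x [/subD].
- by rewrite VE; exact: bl_open.
have [psi psiP] : exists psi : vec -> vec, forall z, nm (z - phi p) < r / 2 ->
    bl p r (psi z) /\ phi (psi z) = z.
  apply: (@ex_choice _ _ (fun z x => nm (z - phi p) < r / 2 -> bl p r x /\ phi x = z)) => z.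
  have [zr|] := pselect (nm (z - phi p) < r / 2); last by exists p.
  by have [x px xz] := surj z zr; exists x.
have inj x y : bl p r x -> bl p r y -> phi x = phi y -> x = y.
  move=> px py xy; apply/eqP; rewrite -subr_eq0; apply/eqP/nm_eq0/eqP.
  by have := lower x y px py; rewrite xy subrr nm0 mulr0 eq_le nm_ge0 => ->.
exists psi; last first.
  by move=> x [px xr]; have [h1 h2] := psiP _ xr; exact: inj.
rewrite VE => z zr; pose x := psi z; have [px xz] := psiP z zr; rewrite -/x in px xz.
have Dx := subD _ px.
pose Mx : 'M[C]_n := \matrix_(a, k) pd [:: a] (fun x => phi x 0 k : C) x.
have MxE v k : (v *m Mx) 0 k = dotc (grad (fun x => phi x 0 k : C) x) v.
  by rewrite mxE; apply: eq_bigr => a _; rewrite mxE.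
have app e : 0 < e -> exists2 d, 0 < d & forall h, nm h < d ->
    bl p r (x + h) /\ nm (phi (x + h) - phi x - h *m Mx) <= e * nm h.
  move=> e0; have [t tP] : exists t : 'I_n -> R, forall k, 0 < t k /\ forall h, nm h < t k ->
      nm (phi (x + h) 0 k - phi x 0 k - dotc (grad (fun x => phi x 0 k : C) x) h : C) <= e * nm h.
    apply: (@ex_choice _ _ (fun k (s : R) => 0 < s /\ forall h, nm h < s ->
      nm (phi (x + h) 0 k - phi x 0 k - dotc (grad (fun x => phi x 0 k : C) x) h : C) <= e * nm h)) => k.
    by have [d d0 dP] := diff_fd (hphi k x Dx) e0; exists d.
  have r1 : 0 < r - nm (x - p) by rewrite subr_gt0.
  exists (\big[Num.min/(r - nm (x - p))]_k t k).
    by apply/bigmin_gtP; split=> // k _; case: (tP k).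
  move=> h hd; split.
    rewrite /bl /= addrAC; apply: (le_lt_trans (nmD _ _)); rewrite -ltrBrDl.
    by apply: lt_le_trans hd _; exact: bigmin_le_id.
  apply: nm_row_le => [|k]; first by rewrite mulr_ge0 ?nm_ge0 ?ltW.
  have := (tP k).2 h; rewrite -MxE !mxE; apply; apply: lt_le_trans hd _.
  exact: bigmin_le_cond.
(* Along a short kernel vector [h], differentiability lets [phi] move by at most [nm h / 4], whereas
   [lower] forces at least [nm h / 2]. *)
have Mu : Mx \in unitmx.
  rewrite -row_free_unit -kermx_eq0; apply/eqP/row_matrixP => i; rewrite row0.
  set v := row i _; have vM : v *m Mx = 0.
    by apply/sub_kermxP; exact: row_sub.
  have e4 : 0 < 1 / 4 :> R by rewrite divr_gt0.
  have [d d0 dP] := app _ e4; pose tt := d / 2 / (nm v + 1).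
  have v1 : 0 < nm v + 1 by rewrite ltr_wpDl ?nm_ge0.
  have tt0 : 0 < tt by rewrite !divr_gt0.
  have hd : nm (cofr tt *: v) < d.
    rewrite nmZ nm_cofr gtr0_norm// /tt mulrAC ltr_pdivrMr//.
    apply: (@le_lt_trans _ _ (d / 2 * (nm v + 1))).
      by rewrite ler_wpM2l ?lerDl// ltW// divr_gt0.
    by rewrite ltr_pM2r//; lra.
  have [pxh] := dP _ hd; rewrite -scalemxAl vM scaler0 subr0 => h1.
  have := lower _ _ pxh px; rewrite addrC addKr => h2.
  have : nm (cofr tt *: v) = 0.
    by apply/eqP; rewrite eq_le nm_ge0 andbT; move: h1 h2; lra.
  move=> /nm_eq0/eqP; rewrite scaler_eq0 => /orP[/eqP c0|/eqP//].
  by have := nm_cofr tt; rewrite c0 nm0 gtr0_norm// => t00; rewrite -t00 ltxx in tt0.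
pose Q : R := \sum_a \sum_k nm (invmx Mx a k : C).
have QP a k : nm (invmx Mx a k : C) <= Q.
  rewrite /Q (bigD1 a)//= (bigD1 k)//= -addrA lerDl addr_ge0//.
    by apply: sumr_ge0 => ? _; exact: nm_ge0.
  by apply: sumr_ge0 => ? _; apply: sumr_ge0 => ? _; exact: nm_ge0.
have Q0 : 0 <= Q by apply: sumr_ge0 => ? _; apply: sumr_ge0 => ? _; exact: nm_ge0.
apply: diff_rowP => k.
(* The gradient of a coordinate of the inverse is a column of the inverse Jacobian; [lower] bounds
   the increment of [psi] by twice that of its argument. *)
apply: (@fd_differentiable _ _ _ _ (fun b => invmx Mx b k)) => e e0.
pose e' := e / (2 * n%:R * Q + 1).
have den : 0 < 2 * n%:R * Q + 1 by rewrite ltr_wpDl// !mulr_ge0.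
have e'0 : 0 < e' by rewrite divr_gt0.
have [d d0 dP] := app _ e'0.
exists (Num.min (d / 2) (r / 2 - nm (z - phi p))).
  by rewrite lt_min divr_gt0//= subr_gt0.
move=> w; rewrite lt_min => /andP[wd wr].
have zw : nm (z + w - phi p) < r / 2.
  by rewrite addrAC; apply: (le_lt_trans (nmD _ _)); rewrite -ltrBrDl.
have [py yz] := psiP _ zw; set y := psi (z + w) in py yz *.
pose h := y - x; have hw : nm h <= 2 * nm w.
  by have := lower y x py px; rewrite yz xz [z + w]addrC addrK.
have hd : nm h < d by apply: (le_lt_trans hw); lra.
have [_] := dP h hd; rewrite /h subrKC yz xz [z + w]addrC addrK -/h => E.
pose err := w - h *m Mx.
have hE : h = w *m invmx Mx - err *m invmx Mx.
  by rewrite /err mulmxBl mulmxK// opprB addrC subrK.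
rewrite (_ : y 0 k - x 0 k - _ = - (err *m invmx Mx) 0 k); last first.
  have : h 0 k = y 0 k - x 0 k by rewrite !mxE.
  move=> <-; rewrite {1}hE !mxE (_ : \sum_j w 0 j * _ = dotc (fun b => invmx Mx b k) w)//.
  by ring.
rewrite nmN mxE.
have -> : \sum_j err 0 j * invmx Mx j k = dotc (fun b => invmx Mx b k) err by [].
apply: (le_trans (nm_dotc _ (fun b => QP b k))).
have E' : nm err <= e' * (2 * nm w).
  by apply: (le_trans E); rewrite ler_wpM2l// ltW.
apply: (@le_trans _ _ (n%:R * (e' * (2 * nm w) * Q))).
  by rewrite ler_wpM2l// ler_wpM2r.
rewrite (_ : n%:R * _ = e' * (2 * n%:R * Q) * nm w); last by ring.
rewrite ler_wpM2r ?nm_ge0// /e' mulrAC ler_pdivrMr//.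
by apply: ler_wpM2l; [exact: ltW|rewrite lerDl].
Qed.
End InverseFunction.

(** * Geodesic equations and projective curvature *)

Section CurvatureAlgebra.
Variable K : comPzRingType.
Implicit Types (g : nat -> nat -> nat -> K) (dg : nat -> nat -> nat -> nat -> K) (u f : nat -> K).

(* [dg d c a b] is the derivative of [g c a b] in direction [d]. *)
Definition riem g dg (c d a b : nat) : K :=
  dg a c b d - dg b c a d + \sum_(e < 3) (g c a e * g e b d - g c b e * g e a d).

Definition quadr g u c : K := \sum_(a < 3) \sum_(b < 3) g c a b * u a * u b.
Definition dquadr g u c j : K := 2 * \sum_(b < 3) g c j b * u b.

(* With [u = (1, xd1, xd2)], the system [xdd^i = geo g u i] is the equation of the
   unparametrized geodesics of the connection [g]; it is unchanged when
   [d^c_a psi_b + d^c_b psi_a] is added to [g c a b]. *)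
Definition geo g u i : K := u i * quadr g u 0%N - quadr g u i.
(** This and the following definitions are the formal derivatives of [geo] in the velocities, in the
    base point and along the system, as polynomials in the 1-jet of [g]; they are identified with
    [pd] and [Dt] further below. *)
Definition geo_d g u i j : K :=
  (i == j)%:R * quadr g u 0%N + u i * dquadr g u 0%N j - dquadr g u i j.
Definition geo_x g dg u i j : K := geo (dg j) u i.

Definition dt_quadr g dg u f c : K :=
  \sum_(d < 3) u d * quadr (dg d) u c + \sum_(j < 3) dquadr g u c j * f j.
Definition dt_dquadr g dg u f c j : K :=
  \sum_(d < 3) u d * dquadr (dg d) u c j + dquadr g f c j.
Definition dt_geo_d g dg u f i j : K :=
  (i == j)%:R * dt_quadr g dg u f 0%N
  + (f i * dquadr g u 0%N j + u i * dt_dquadr g dg u f 0%N j) - dt_dquadr g dg u f i j.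

Definition jac r u (i j : nat) : K :=
  \sum_(d < 3) \sum_(a < 3) (r i d a j - u i * r 0%N d a j) * u d * u a.

Variables (g : nat -> nat -> nat -> K) (dg : nat -> nat -> nat -> nat -> K) (u : nat -> K).
Hypothesis gS : forall c a b, g c a b = g c b a.
Hypothesis dS : forall d c a b, dg d c a b = dg d c b a.
Hypothesis u0 : u 0%N = 1.
Let f i : K := if i == 0%N then 0 else geo g u i.

(* The contractions below are the only combinations of the connection that
   occur; keeping them opaque makes the torsion identities small. *)
Let h c j : K := \sum_(b < 3) g c j b * u b.
Let dh d c j : K := \sum_(b < 3) dg d c j b * u b.
Let k c j : K := \sum_(e < 3) g c j e * quadr g u e.

Let quadr_h v c : quadr v u c = \sum_(a < 3) u a * \sum_(b < 3) v c a b * u b.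
Proof.
apply: eq_bigr => a _; rewrite mulr_sumr; apply: eq_bigr => b _.
by ring.
Qed.

Let quadrE c : quadr g u c = \sum_(a < 3) u a * h c a. Proof. exact: quadr_h. Qed.
Let dquadE d c : quadr (dg d) u c = \sum_(a < 3) u a * dh d c a. Proof. exact: quadr_h. Qed.
Let dquadrE c j : dquadr g u c j = 2 * h c j. Proof. by []. Qed.
Let ddquadrE d c j : dquadr (dg d) u c j = 2 * dh d c j. Proof. by []. Qed.

Let fE b : f b = u b * quadr g u 0%N - quadr g u b.
Proof. by rewrite /f; case: eqP => [->|//]; rewrite u0 mul1r subrr. Qed.

Let dquadr_fE c j : dquadr g f c j = 2 * (quadr g u 0%N * h c j - k c j).
Proof.
rewrite /dquadr; congr (_ * _); rewrite /h /k mulr_sumr -sumrB; apply: eq_bigr => b _.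
by rewrite fE; ring.
Qed.

Let jacE i j : jac (riem g dg) u i j = \sum_(a < 3) u a * (dh a i j - dh j i a)
  + \sum_(e < 3) h i e * h e j - k i j
  - u i * (\sum_(a < 3) u a * (dh a 0%N j - dh j 0%N a)
  + \sum_(e < 3) h 0%N e * h e j - k 0%N j).
Proof.
have E c : \sum_(d < 3) \sum_(a < 3) riem g dg c d a j * u d * u a =
    \sum_(a < 3) u a * (dh a c j - dh j c a) + \sum_(e < 3) h c e * h e j - k c j.
  have H1 : \sum_(a < 3) u a * (dh a c j - dh j c a) =
      \sum_(d < 3) \sum_(a < 3) (dg a c j d - dg j c a d) * u d * u a.
    rewrite exchange_big /=; apply: eq_bigr => a _; rewrite /dh -sumrB mulr_sumr.
    by apply: eq_bigr => d _; ring.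
  have H2 : \sum_(e < 3) h c e * h e j =
      \sum_(d < 3) \sum_(a < 3) (\sum_(e < 3) g c a e * g e j d) * u d * u a.
    transitivity (\sum_(e < 3) \sum_(d < 3) \sum_(a < 3) g c a e * g e j d * u d * u a).
      apply: eq_bigr => e _; rewrite /h mulr_suml exchange_big /=; apply: eq_bigr => a _.
      rewrite mulr_sumr; apply: eq_bigr => d _.
      by rewrite (gS c e a); ring.
    rewrite exchange_big /=; apply: eq_bigr => d _; rewrite exchange_big /=.
    by apply: eq_bigr => a _; rewrite !mulr_suml.
  have H3 : k c j = \sum_(d < 3) \sum_(a < 3) (\sum_(e < 3) g c j e * g e a d) * u d * u a.
    transitivity (\sum_(e < 3) \sum_(d < 3) \sum_(a < 3) g c j e * g e a d * u d * u a).
      apply: eq_bigr => e _; rewrite /quadr mulr_sumr exchange_big /=; apply: eq_bigr => d _.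
      rewrite mulr_sumr; apply: eq_bigr => a _.
      by ring.
    rewrite exchange_big /=; apply: eq_bigr => d _; rewrite exchange_big /=.
    by apply: eq_bigr => a _; rewrite !mulr_suml.
  rewrite H1 H2 H3 -big_split -sumrB /=; apply: eq_bigr => d _.
  rewrite -big_split -sumrB /=; apply: eq_bigr => a _.
  by rewrite /riem sumrB (dS a c j d); ring.
rewrite -!E mulr_sumr -sumrB; apply: eq_bigr => d _; rewrite mulr_sumr -sumrB.
by apply: eq_bigr => a _; ring.
Qed.

Ltac expand := rewrite /dt_geo_d /dt_dquadr /dt_quadr /geo_x /geo_d /geo;
  rewrite !jacE !dquadr_fE !dquadrE !big_ord_recl !big_ord0 /= !ddquadrE;
  rewrite ?fE !dquadE !quadrE !big_ord_recl !big_ord0 /= ?u0.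

(** The left side is 4 times the entry (1, 2) of [D_t F_v / 2 - F_v^2 / 4 - F_x], the Jacobi
    endomorphism of a second order system with velocity Jacobian [F_v]. The next two lemmas treat
    its entry (2, 1) and its diagonal difference, with factor -4. *)
Lemma torsion12 : 2 * dt_geo_d g dg u f 1%N 2%N - geo_d g u 1%N 2%N * geo_d g u 1%N 1%N
    - geo_d g u 2%N 2%N * geo_d g u 1%N 2%N - 4 * geo_x g dg u 1%N 2%N = - 4 * jac (riem g dg) u 1%N 2%N.
Proof. by expand; move: h dh k => h' dh' k'; ring. Qed.

Lemma torsion21 : - 2 * dt_geo_d g dg u f 2%N 1%N + geo_d g u 2%N 2%N * geo_d g u 2%N 1%N
    + 4 * geo_x g dg u 2%N 1%N + geo_d g u 1%N 1%N * geo_d g u 2%N 1%N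
    = 4 * jac (riem g dg) u 2%N 1%N.
Proof. by expand; move: h dh k => h' dh' k'; ring. Qed.

Lemma torsion_diag : - (geo_d g u 2%N 2%N) ^+ 2 - 2 * dt_geo_d g dg u f 1%N 1%N
    - 4 * geo_x g dg u 2%N 2%N + 4 * geo_x g dg u 1%N 1%N + 2 * dt_geo_d g dg u f 2%N 2%N
    + (geo_d g u 1%N 1%N) ^+ 2
    = 4 * (jac (riem g dg) u 1%N 1%N - jac (riem g dg) u 2%N 2%N).
Proof. by expand; move: h dh k => h' dh' k'; ring. Qed.
End CurvatureAlgebra.

(** * Vanishing of the Weyl projective curvature *)

Section WeylVanishing.
Variable R : realType.
Local Notation C := (Cplx R).

(** A polynomial of degree at most 3 with the four distinct roots [x0 + k * t], [k < 4], is zero;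
    [t = e / 4] keeps them in the disc. *)
Lemma cubic_eq0 (c0 c1 c2 c3 x0 : C) (e : R) : 0 < e ->
  (forall x, nm (x - x0 : C) < e -> c0 + c1 * x + c2 * x ^+ 2 + c3 * x ^+ 3 = 0) ->
  [/\ c0 = 0, c1 = 0, c2 = 0 & c3 = 0].
Proof.
move=> e0 h; pose q : {poly C} := Poly [:: c0; c1; c2; c3].
suff q0 : q = 0.
  have qE i : q`_i = [:: c0; c1; c2; c3]`_i by rewrite coef_Poly.
  by have := (qE 0%N, qE 1%N, qE 2%N, qE 3%N); rewrite q0 !coef0 /= => -[[[<- <-] <-] <-].
pose t : C := cofr (e / 4).
have nt : nm (t : C) = e / 4 by rewrite nm_cofr gtr0_norm// divr_gt0.
have t0 : t != 0 by rewrite -nm_gt0 nt divr_gt0.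
pose rs := [seq x0 + k%:R * t | k <- iota 0 4].
apply/eqP; apply: contrapT => /negP qn0.
have ar : all (root q) rs.
  apply/allP => z /mapP[k]; rewrite mem_iota add0n => /= k4 ->.
  have qE y : q.[y] = c0 + c1 * y + c2 * y ^+ 2 + c3 * y ^+ 3.
    by rewrite horner_Poly /=; ring.
  rewrite rootE qE h// addrC addKr nmM nt.
  have -> : (k%:R : C) = cofr k%:R.
    by elim: (k) => [//|m ih]; rewrite -!natr1 ih cofrD.
  rewrite nm_cofr normr_nat mulrCA gtr_pMr// ltr_pdivrMr// mul1r ltr_nat//.
have ur : uniq rs.
  rewrite map_inj_uniq ?iota_uniq// => i j /addrI /(mulIf t0) /eqP.
  by rewrite eqr_nat => /eqP.
by have := max_poly_roots qn0 ar ur; rewrite size_map size_iota ltnNge size_Poly.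
Qed.

Lemma cubic2_eq0 (c00 c10 c01 c20 c11 c02 c30 c21 c12 c03 x0 y0 : C) (e : R) : 0 < e ->
  (forall x y, nm (x - x0 : C) < e -> nm (y - y0 : C) < e ->
     c00 + c10 * x + c01 * y + c20 * x ^+ 2 + c11 * (x * y) + c02 * y ^+ 2
     + c30 * x ^+ 3 + c21 * (x ^+ 2 * y) + c12 * (x * y ^+ 2) + c03 * y ^+ 3 = 0) ->
  [/\ c00 = 0, c10 = 0, c01 = 0 & [/\ c20 = 0, c11 = 0, c02 = 0 &
     [/\ c30 = 0, c21 = 0, c12 = 0 & c03 = 0]]].
Proof.
move=> e0 h.
have hy y : nm (y - y0 : C) < e -> [/\ c00 + c01 * y + c02 * y ^+ 2 + c03 * y ^+ 3 = 0,
    c10 + c11 * y + c12 * y ^+ 2 = 0, c20 + c21 * y = 0 & c30 = 0].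
  by move=> ye; apply: (@cubic_eq0 _ _ _ _ x0 e e0) => x xe; rewrite -(h x y xe ye); ring.
have [-> -> -> ->] : [/\ c00 = 0, c01 = 0, c02 = 0 & c03 = 0].
  by apply: (@cubic_eq0 _ _ _ _ y0 e e0) => y /hy[].
have [-> -> -> _] : [/\ c10 = 0, c11 = 0, c12 = 0 & (0 : C) = 0].
  by apply: (@cubic_eq0 _ _ _ _ y0 e e0) => y /hy[_ H _ _]; rewrite mul0r addr0.
have [-> -> _ _] : [/\ c20 = 0, c21 = 0, (0 : C) = 0 & (0 : C) = 0].
  by apply: (@cubic_eq0 _ _ _ _ y0 e e0) => y /hy[_ _ H _]; rewrite !mul0r !addr0.
by have [] := hy y0; rewrite ?subrr ?nm0.
Qed.

(** Certificate form for linear elimination: 8 is a common denominator of the combinations used in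
    [weyl_vanish]. *)
Let lc (a b c d A B E F W : C) : A = 0 -> B = 0 -> E = 0 -> F = 0 ->
  8 * W = a * A + b * B + c * E + d * F -> W = 0.
Proof.
move=> -> -> -> ->; rewrite !mulr0 !addr0 => /eqP; rewrite mulf_eq0 pnatr_eq0 /=.
by move/eqP.
Qed.

Variable r : nat -> nat -> nat -> nat -> C.
Hypothesis anti : forall c d a b, r c d a b = - r c d b a.
Hypothesis cyclic : forall c, r c 0%N 1%N 2%N + r c 1%N 2%N 0%N + r c 2%N 0%N 1%N = 0.
Hypothesis trace : forall a b, \sum_(e < 3) r e e a b = 0.

(** The projective Schouten tensor: the Ricci contraction divided by [n - 1 = 2]. *)
Definition rho_of (b d : nat) : C := (\sum_(k < 3) r k d k b) / 2.

Let u x y (i : nat) : C := nth 0 [:: 1; x; y] i.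

(* The hypothesis is the vanishing of three cubic polynomials in [x], [y], whose
   coefficients are the components of the Weyl projective curvature. *)
Lemma weyl_vanish (x0 y0 : C) (e : R) : 0 < e ->
  (forall x y, nm (x - x0 : C) < e -> nm (y - y0 : C) < e ->
     [/\ jac r (u x y) 1%N 2%N = 0, jac r (u x y) 2%N 1%N = 0 &
       jac r (u x y) 1%N 1%N - jac r (u x y) 2%N 2%N = 0]) ->
  forall (c d a b : 'I_3), r c d a b = (c == a)%:R * rho_of b d - (c == b)%:R * rho_of a d.
Proof.
move=> e0 h.
have r00 c d a : r c d a a = 0.
  by have /eqP := anti c d a a; rewrite -addr_eq0 -mulr2n mulrn_eq0 /= => /eqP.
have a10 c d : r c d 1%N 0%N = - r c d 0%N 1%N by exact: anti.
have a20 c d : r c d 2%N 0%N = - r c d 0%N 2%N by exact: anti.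
have a21 c d : r c d 2%N 1%N = - r c d 1%N 2%N by exact: anti.
(* The letters [p], [q], [s] stand for the conditions (1, 2), (2, 1) and diagonal; the indices are
   the exponents of the two velocities. Arguments [0] of [cubic2_eq0] are coefficients that vanish
   identically. *)
have [p00 p10 p01 [p20 p11 _ [p30 p21 _ _]]] := @cubic2_eq0 (r 1%N 0%N 0%N 2%N) (- r 0%N 0%N 0%N 2%N + r 1%N 0%N 1%N 2%N + r 1%N 1%N 0%N 2%N) (r 1%N 2%N 0%N 2%N) (- r 0%N 0%N 1%N 2%N - r 0%N 1%N 0%N 2%N + r 1%N 1%N 1%N 2%N) (- r 0%N 2%N 0%N 2%N + r 1%N 2%N 1%N 2%N) (0) (- r 0%N 1%N 1%N 2%N) (- r 0%N 2%N 1%N 2%N) (0) (0) x0 y0 e e0 (fun x y xe ye => ltac:(have [hp hq hs] := h x y xe ye; rewrite -[RHS]hp /jac /u !big_ord_recl !big_ord0 /= /bump /= ?addn0 ?addn1 ?a10 ?a20 ?a21 ?r00; ring)).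
have [q00 q10 q01 [_ q11 q02 [_ _ q12 q03]]] := @cubic2_eq0 (r 2%N 0%N 0%N 1%N) (r 2%N 1%N 0%N 1%N) (- r 0%N 0%N 0%N 1%N - r 2%N 0%N 1%N 2%N + r 2%N 2%N 0%N 1%N) (0) (- r 0%N 1%N 0%N 1%N - r 2%N 1%N 1%N 2%N) (r 0%N 0%N 1%N 2%N - r 0%N 2%N 0%N 1%N - r 2%N 2%N 1%N 2%N) (0) (0) (r 0%N 1%N 1%N 2%N) (r 0%N 2%N 1%N 2%N) x0 y0 e e0 (fun x y xe ye => ltac:(have [hp hq hs] := h x y xe ye; rewrite -[RHS]hq /jac /u !big_ord_recl !big_ord0 /= /bump /= ?addn0 ?addn1 ?a10 ?a20 ?a21 ?r00; ring)).
have [s00 s10 s01 [s20 s11 s02 [_ s21 s12 _]]] := @cubic2_eq0 (r 1%N 0%N 0%N 1%N - r 2%N 0%N 0%N 2%N) (- r 0%N 0%N 0%N 1%N + r 1%N 1%N 0%N 1%N - r 2%N 0%N 1%N 2%N - r 2%N 1%N 0%N 2%N) (r 0%N 0%N 0%N 2%N - r 1%N 0%N 1%N 2%N + r 1%N 2%N 0%N 1%N - r 2%N 2%N 0%N 2%N) (- r 0%N 1%N 0%N 1%N - r 2%N 1%N 1%N 2%N) (2 * r 0%N 0%N 1%N 2%N + r 0%N 1%N 0%N 2%N - r 0%N 2%N 0%N 1%N - r 1%N 1%N 1%N 2%N - r 2%N 2%N 1%N 2%N) (r 0%N 2%N 0%N 2%N - r 1%N 2%N 1%N 2%N) (0) (2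 * r 0%N 1%N 1%N 2%N) (2 * r 0%N 2%N 1%N 2%N) (0) x0 y0 e e0 (fun x y xe ye => ltac:(have [hp hq hs] := h x y xe ye; rewrite -[RHS]hs /jac /u !big_ord_recl !big_ord0 /= /bump /= ?addn0 ?addn1 ?a10 ?a20 ?a21 ?r00; ring)).
have cyc c : r c 0%N 1%N 2%N - r c 1%N 0%N 2%N + r c 2%N 0%N 1%N = 0.
  by rewrite -[RHS](cyclic c) a20.
have tr01 := trace 0%N 1%N; have tr02 := trace 0%N 2%N; have tr12 := trace 1%N 2%N.
rewrite !big_ord_recl !big_ord0 /= /bump /= !addn0 !addn1 !addr0 in tr01 tr02 tr12.
(* The components with [a < b]; antisymmetry yields the others. Each is a combination of coefficient
   relations, the cyclic identity and the trace identity. *)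
have key : forall c d : 'I_3, [/\ r c d 0%N 1%N = (c == 0%N :> nat)%:R * rho_of 1%N d - (c == 1%N :> nat)%:R * rho_of 0%N d,
    r c d 0%N 2%N = (c == 0%N :> nat)%:R * rho_of 2%N d - (c == 2%N :> nat)%:R * rho_of 0%N d &
    r c d 1%N 2%N = (c == 1%N :> nat)%:R * rho_of 2%N d - (c == 2%N :> nat)%:R * rho_of 1%N d].
  case=> [[|[|[|//]]] ?] [[|[|[|//]]] ?]; rewrite /rho_of !big_ord_recl !big_ord0 /= /bump /= ?addn0 ?addn1 ?a10 ?a20 ?a21 ?r00;
    split; apply/eqP; rewrite -subr_eq0; apply/eqP.
  - by apply: (@lc 1 1 (-2) (-1) _ _ _ _ _ (cyc 2%N) tr01 q01 s10); field.
  - by apply: (@lc (-1) 1 (-2) 1 _ _ _ _ _ (cyc 1%N) tr02 p10 s01); field.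
  - by apply: (@lc 2 2 (-2) 2 _ _ _ _ _ (cyc 0%N) tr12 p20 q02); field.
  - by apply: (@lc (-4) 0 0 0 _ _ _ _ _ q11 q11 q11 q11); field.
  - by apply: (@lc (-1) (-1) (-3) (-1) _ _ _ _ _ (cyc 0%N) tr12 p20 q02); field.
  - by apply: (@lc (-8) 0 0 0 _ _ _ _ _ p30 p30 p30 p30); field.
  - by apply: (@lc 1 1 (-1) (-3) _ _ _ _ _ (cyc 0%N) tr12 p20 q02); field.
  - by apply: (@lc (-4) 0 0 0 _ _ _ _ _ p11 p11 p11 p11); field.
  - by apply: (@lc (-8) 0 0 0 _ _ _ _ _ p21 p21 p21 p21); field.
  - by apply: (@lc 4 0 0 0 _ _ _ _ _ s00 s00 s00 s00); field.
  - by apply: (@lc 8 0 0 0 _ _ _ _ _ p00 p00 p00 p00); field.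
  - by apply: (@lc 1 (-1) 2 (-1) _ _ _ _ _ (cyc 1%N) tr02 p10 s01); field.
  - by apply: (@lc 1 1 (-2) 3 _ _ _ _ _ (cyc 2%N) tr01 q01 s10); field.
  - by apply: (@lc (-2) 2 4 2 _ _ _ _ _ (cyc 1%N) tr02 p10 s01); field.
  - by apply: (@lc 1 1 3 1 _ _ _ _ _ (cyc 0%N) tr12 p20 q02); field.
  - by apply: (@lc 1 (-1) 2 3 _ _ _ _ _ (cyc 1%N) tr02 p10 s01); field.
  - by apply: (@lc 8 0 0 0 _ _ _ _ _ p01 p01 p01 p01); field.
  - by apply: (@lc 4 0 0 0 _ _ _ _ _ p11 p11 p11 p11); field.
  - by apply: (@lc 8 0 0 0 _ _ _ _ _ q00 q00 q00 q00); field.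
  - by apply: (@lc (-4) 0 0 0 _ _ _ _ _ s00 s00 s00 s00); field.
  - by apply: (@lc 1 1 (-2) (-1) _ _ _ _ _ (cyc 2%N) tr01 q01 s10); field.
  - by apply: (@lc 8 0 0 0 _ _ _ _ _ q10 q10 q10 q10); field.
  - by apply: (@lc (-1) (-1) 2 (-3) _ _ _ _ _ (cyc 2%N) tr01 q01 s10); field.
  - by apply: (@lc (-4) 0 0 0 _ _ _ _ _ q11 q11 q11 q11); field.
  - by apply: (@lc 2 2 4 (-2) _ _ _ _ _ (cyc 2%N) tr01 q01 s10); field.
  - by apply: (@lc (-1) 1 (-2) (-3) _ _ _ _ _ (cyc 1%N) tr02 p10 s01); field.
  - by apply: (@lc 1 1 (-1) (-3) _ _ _ _ _ (cyc 0%N) tr12 p20 q02); field.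
move=> c d [[|[|[|//]]] ?] [[|[|[|//]]] ?]; have [k1 k2 k3] := key c d;
  by rewrite -!val_eqE /= ?r00 ?a10 ?a20 ?a21 ?k1 ?k2 ?k3; ring.
Qed.
End WeylVanishing.

(** * Calculus on the first jet space *)

Section Jets.
Variable R : realType.
Local Notation C := (Cplx R).
Local Notation base := 'rV[C]_3.
Local Notation jet := 'rV[C]_5.
Implicit Types (p q v : jet) (x : base) (k : base -> C) (f : jet -> C).

Definition bi (d : nat) : 'I_3 := nth bt [:: bt; bx1; bx2] d.
(** Index 0 is filler: the velocity coordinates are numbered 1 and 2, like the space coordinates,
    and the time component of the velocity is the constant 1. *)
Definition jd (j : nat) : 'I_5 := nth jd1 [:: jd1; jd1; jd2] j.
Definition jx (j : nat) : 'I_5 := nth jt [:: jt; jx1; jx2] j.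
Definition vel p (i : nat) : C := nth 0 [:: 1; p 0 jd1; p 0 jd2] i.
Definition dvel v (i : nat) : C := nth 0 [:: 0; v 0 jd1; v 0 jd2] i.

Lemma jet_baseE p d : (d < 3)%N -> jet_base p 0 (bi d) = p 0 (jx d).
Proof.
by case: d => [|[|[|//]]] _; rewrite mxE; congr (p 0 _); apply: val_inj.
Qed.

Lemma nm_jet_base p : nm (jet_base p) <= nm p.
Proof. by apply: nm_row_le => [|i]; [exact: nm_ge0|rewrite mxE nm_coord]. Qed.

Lemma jet_baseD p v : jet_base (p + v) = jet_base p + jet_base v.
Proof. by apply/rowP => i; rewrite !mxE. Qed.

Lemma jet_baseB p v : jet_base (p - v) = jet_base p - jet_base v.
Proof. by apply/rowP => i; rewrite !mxE. Qed.

Lemma dotc5 (c : 'I_5 -> C) (h : jet) : dotc c h =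
  h 0 jt * c jt + h 0 jx1 * c jx1 + h 0 jx2 * c jx2 + h 0 jd1 * c jd1 + h 0 jd2 * c jd2.
Proof.
rewrite /dotc !big_ord_recl big_ord0 addr0 !addrA.
by do !congr (_ + _); congr (h 0 _ * c _); exact: val_inj.
Qed.

Lemma dotc3 (c : 'I_3 -> C) (h : base) : dotc c h =
  h 0 bt * c bt + h 0 bx1 * c bx1 + h 0 bx2 * c bx2.
Proof.
rewrite /dotc !big_ord_recl big_ord0 addr0 !addrA.
by do !congr (_ + _); congr (h 0 _ * c _); exact: val_inj.
Qed.

Lemma jb_fd k p : differentiable k (jet_base p) -> fd (fun q => k (jet_base q)) p
  (fun i => nth 0 [:: pd [:: bt] k (jet_base p); pd [:: bx1] k (jet_base p); pd [:: bx2] k (jet_base p); 0; 0] i).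
Proof.
move=> dk e e0; have [d d0 dP] := diff_fd dk e0; exists d => // h hd.
have := dP (jet_base h) (le_lt_trans (nm_jet_base h) hd).
have -> : dotc (fun i : 'I_5 => nth 0 [:: pd [:: bt] k (jet_base p); pd [:: bx1] k (jet_base p);
    pd [:: bx2] k (jet_base p); 0; 0] i) h = dotc (grad k (jet_base p)) (jet_base h).
  rewrite dotc3 dotc5 /grad.
  move: (pd [:: bt] k _) (pd [:: bx1] k _) (pd [:: bx2] k _) => c0 c1 c2.
  have -> : jet_base h 0 bt = h 0 jt by exact: (@jet_baseE h 0%N).
  have -> : jet_base h 0 bx1 = h 0 jx1 by exact: (@jet_baseE h 1%N).
  have -> : jet_base h 0 bx2 = h 0 jx2 by exact: (@jet_baseE h 2%N).
  by rewrite /= !mulr0 !addr0.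
rewrite (jet_baseD p h) => H; apply: (le_trans H).
by apply: ler_wpM2l; [exact: ltW|exact: nm_jet_base].
Qed.

Lemma sum3nat (F : nat -> C) : \sum_(d < 3) F d = F 0%N + F 1%N + F 2%N.
Proof. by rewrite !big_ord_recl big_ord0 addr0 addrA. Qed.

Lemma deriv_jb k p v : differentiable k (jet_base p) ->
  'D_v (fun q => k (jet_base q)) p = \sum_(d < 3) v 0 (jx d) * pd [:: bi d] k (jet_base p).
Proof.
move=> dk; have [df g] := fd_diff (jb_fd dk).
rewrite deriveE// gradE// g dotc5 (sum3nat (fun d => v 0 (jx d) * pd [:: bi d] k (jet_base p))) /bi /jx.
move: (pd _ _ _) (pd _ _ _) (pd _ _ _) => c0 c1 c2.
by rewrite /= !mulr0 !addr0.
Qed.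

Lemma diff_jb k p : differentiable k (jet_base p) -> differentiable (fun q => k (jet_base q)) p.
Proof. by move=> dk; have [] := fd_diff (jb_fd dk). Qed.

Lemma diff_vel p i : differentiable (fun q => vel q i : C) p.
Proof.
by case: i => [|[|[|i]]]; [exact: differentiable_cst|exact: differentiable_coord|
  exact: differentiable_coord|rewrite /vel /=; case: i => [|i]; exact: differentiable_cst].
Qed.

Lemma deriv_coord p v b : 'D_v (fun q : jet => q 0 b : C) p = v 0 b.
Proof.
have [df g] := fd_diff (coord_fd b p).
rewrite deriveE// gradE// g /dotc (bigD1 b)//= eqxx mulr1 big1 ?addr0// => i /negPf ->.
by rewrite mulr0.
Qed.

Lemma deriv_vel p v i : 'D_v (fun q => vel q i : C) p = dvel v i.
Proof.
have cst0 (c : C) : 'D_v (fun _ : jet => c) p = 0 by rewrite derive_cst.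
case: i => [|[|[|i]]].
- exact: cst0.
- exact: deriv_coord.
- exact: deriv_coord.
- have -> : (fun q => vel q i.+3) = fun=> 0 by apply/funext => q; rewrite /vel nth_default.
  by rewrite cst0 /dvel nth_default.
Qed.

Lemma derivD f g p v : differentiable f p -> differentiable g p ->
  'D_v (fun q => f q + g q) p = 'D_v f p + 'D_v g p.
Proof. by move=> df dg; rewrite (@deriveD _ _ _ f g)//; exact: diff_derivable. Qed.

Lemma derivB f g p v : differentiable f p -> differentiable g p ->
  'D_v (fun q => f q - g q) p = 'D_v f p - 'D_v g p.
Proof. by move=> df dg; rewrite (@deriveB _ _ _ f g)//; exact: diff_derivable. Qed.

Lemma derivM f g p v : differentiable f p -> differentiable g p ->
  'D_v (fun q => f q * g q) p = f p * 'D_v g p + g p * 'D_v f p.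
Proof. by move=> df dg; rewrite (@deriveM _ _ f g)//; exact: diff_derivable. Qed.

Lemma derivZ (c : C) f p v : differentiable f p -> 'D_v (fun q => c * f q) p = c * 'D_v f p.
Proof. by move=> df; rewrite (@deriveZ _ _ _ f)//; exact: diff_derivable. Qed.

Lemma deriv_sum m (f : 'I_m -> jet -> C) p v : (forall i, differentiable (f i) p) ->
  'D_v (fun q => \sum_i f i q) p = \sum_i 'D_v (f i) p.
Proof.
move=> df; rewrite -derive_sum; last by move=> i; exact: diff_derivable.
by congr ('D_v _ p); apply/funext => q; rewrite fct_sumE.
Qed.

Lemma eq_deriv (W : set jet) f g p v : open W -> W p -> (forall q, W q -> f q = g q) ->
  'D_v f p = 'D_v g p.
Proof.
move=> oW Wp fg; apply: (@near_eq_derive C jet C f g p v); apply/nm_nbhsP.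
have [r r0 rP] := (nm_openP W).1 oW p Wp; exists r => // z zr.
exact/fg/rP.
Qed.

Lemma DtE (F1 F2 : jet -> C) f p (v := \row_i nth 0 [:: 1; p 0 jd1; p 0 jd2; F1 p; F2 p] i) :
  differentiable f p -> Dt F1 F2 f p = 'D_v f p.
Proof.
move=> df; rewrite deriveE// gradE// dotc5 /v !mxE /= /Dt mul1r.
by rewrite /grad.
Qed.

Variables (D : set base) (g : nat -> nat -> nat -> base -> C).
Hypothesis oD : open D.
Hypothesis gH : forall c a b, holomorphic_on D (g c a b).
Hypothesis gS : forall c a b x, D x -> g c a b x = g c b a x.

Definition val_at x (c a b : nat) : C := g c a b x.
Definition der_at x (d c a b : nat) : C := pd [:: bi d] (g c a b) x.
Local Notation G q := (val_at (jet_base q)).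
Local Notation dG q := (der_at (jet_base q)).

Lemma val_atS x c a b : D x -> val_at x c a b = val_at x c b a.
Proof. exact: gS. Qed.

Lemma der_atS x d c a b : D x -> der_at x d c a b = der_at x d c b a.
Proof. by move=> Dx; rewrite /der_at; apply: (@eq_pd _ _ D) => // y; exact: gS. Qed.

Lemma diff_g q c a b : D (jet_base q) -> differentiable (fun q => G q c a b) q.
Proof. by move=> Dq; apply: (@diff_jb (g c a b)); exact: gH. Qed.

Lemma diff_quadr q c : D (jet_base q) -> differentiable (fun q => quadr (G q) (vel q) c) q.
Proof.
move=> Dq; apply: diff_sum => a; apply: diff_sum => b; apply: differentiableM; last exact: diff_vel.
by apply: differentiableM; [exact: diff_g|exact: diff_vel].
Qed.

Lemma diff_dquadr q c j : D (jet_base q) -> differentiable (fun q => dquadr (G q) (vel q) c j) q.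
Proof.
move=> Dq; apply: differentiableM; first exact: differentiable_cst.
by apply: diff_sum => b; apply: differentiableM; [exact: diff_g|exact: diff_vel].
Qed.

Lemma deriv_g q v c a b : D (jet_base q) ->
  'D_v (fun q => G q c a b) q = \sum_(d < 3) v 0 (jx d) * dG q d c a b.
Proof. by move=> Dq; apply: (@deriv_jb (g c a b)); exact: gH. Qed.

Lemma deriv_quadr q v c : D (jet_base q) ->
  'D_v (fun q => quadr (G q) (vel q) c) q =
  \sum_(d < 3) v 0 (jx d) * quadr (dG q d) (vel q) c + \sum_(j < 3) dquadr (G q) (vel q) c j * dvel v j.
Proof.
move=> Dq; have dg a b := diff_g c a b Dq; have du i := diff_vel q i.
have d1 a b : differentiable (fun q => G q c a b * vel q a) q by apply: differentiableM.
have d2 a b : differentiable (fun q => G q c a b * vel q a * vel q b) q by apply: differentiableM.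
rewrite /quadr deriv_sum; last by move=> a; apply: diff_sum => b; exact: d2.
transitivity (\sum_(a < 3) \sum_(b < 3) ((\sum_(d < 3) v 0 (jx d) * dG q d c a b) * vel q a * vel q b
   + (G q c a b * vel q b * dvel v a + G q c a b * vel q a * dvel v b))).
  apply: eq_bigr => a _; rewrite deriv_sum//; apply: eq_bigr => b _.
  rewrite (derivM _ (d1 a b) (du b)) (derivM _ (dg a b) (du a)) deriv_g// !deriv_vel.
  by move: (\sum_(d < 3) _) => S; ring.
have E1 : \sum_(d < 3) v 0 (jx d) * (\sum_(a < 3) \sum_(b < 3) dG q d c a b * vel q a * vel q b) =
   \sum_(a < 3) \sum_(b < 3) (\sum_(d < 3) v 0 (jx d) * dG q d c a b) * vel q a * vel q b.
  transitivity (\sum_(d < 3) \sum_(a < 3) \sum_(b < 3) v 0 (jx d) * dG q d c a b * vel q a * vel q b).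
    apply: eq_bigr => d _; rewrite mulr_sumr; apply: eq_bigr => a _; rewrite mulr_sumr.
    by apply: eq_bigr => b _; ring.
  rewrite exchange_big /=; apply: eq_bigr => a _; rewrite exchange_big /=.
  by apply: eq_bigr => b _; rewrite !mulr_suml.
have E2 : \sum_(j < 3) dquadr (G q) (vel q) c j * dvel v j = \sum_(a < 3) \sum_(b < 3)
    (G q c a b * vel q b * dvel v a + G q c a b * vel q a * dvel v b).
  transitivity (\sum_(j < 3) \sum_(b < 3) G q c j b * vel q b * dvel v j
     + \sum_(j < 3) \sum_(b < 3) G q c j b * vel q b * dvel v j).
    rewrite -big_split; apply: eq_bigr => j _; rewrite /dquadr -mulrA mulr_suml mulr_natl mulr2n.
    by congr (_ + _); apply: eq_bigr => b _.
  rewrite [X in _ + X]exchange_big -big_split /=; apply: eq_bigr => a _.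
  by rewrite -big_split /=; apply: eq_bigr => b _; rewrite (val_atS c b a Dq).
rewrite E1 E2 -big_split; apply: eq_bigr => a _; rewrite -big_split /=.
by apply: eq_bigr => b _.
Qed.

Lemma deriv_dquadr q v c j : D (jet_base q) ->
  'D_v (fun q => dquadr (G q) (vel q) c j) q =
  \sum_(d < 3) v 0 (jx d) * dquadr (dG q d) (vel q) c j + dquadr (G q) (dvel v) c j.
Proof.
move=> Dq; have dg a b := diff_g c a b Dq; have du i := diff_vel q i.
have d1 a b : differentiable (fun q => G q c a b * vel q b) q by apply: differentiableM.
rewrite /dquadr derivZ; last by apply: diff_sum => b; exact: d1.
rewrite deriv_sum//.
transitivity (2 * \sum_(b < 3) ((\sum_(d < 3) v 0 (jx d) * dG q d c j b) * vel q b + G q c j b * dvel v b)).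
  congr (_ * _); apply: eq_bigr => b _.
  by rewrite (derivM _ (dg j b) (du b)) deriv_g// deriv_vel addrC mulrC.
rewrite big_split mulrDr /=; congr (_ + _).
transitivity (\sum_(d < 3) \sum_(b < 3) 2 * (v 0 (jx d) * dG q d c j b * vel q b)).
  rewrite exchange_big mulr_sumr /=; apply: eq_bigr => b _.
  by rewrite mulr_suml mulr_sumr.
apply: eq_bigr => d _; rewrite !mulr_sumr; apply: eq_bigr => b _.
by ring.
Qed.
End Jets.

(** * Derivatives and torsion of systems in geodesic form *)

Section Geodesics.
Variable R : realType.
Local Notation C := (Cplx R).
Local Notation base := 'rV[C]_3.
Local Notation jet := 'rV[C]_5.
Implicit Types (p q v : jet) (x : base) (k : base -> C) (f : jet -> C).
Variables (D : set base) (g : nat -> nat -> nat -> base -> C) (W : set jet).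
Hypothesis oD : open D.
Hypothesis gH : forall c a b, holomorphic_on D (g c a b).
Hypothesis gS : forall c a b x, D x -> g c a b x = g c b a x.
Hypothesis oW : open W.
Hypothesis WD : forall q, W q -> D (jet_base q).

Local Notation G q := (val_at g (jet_base q)).
Local Notation dG q := (der_at g (jet_base q)).

Lemma dvel_jd (j i : nat) : (0 < j < 3)%N -> (i < 3)%N -> dvel (delta_mx 0 (jd j) : jet) i = (i == j)%:R.
Proof. by case: j => [|[|[|//]]] // _; case: i => [|[|[|//]]] // _; rewrite /dvel /= ?mxE. Qed.

Lemma jx_jd (j d : nat) : (0 < j < 3)%N -> (delta_mx 0 (jd j) : jet) 0 (jx d) = 0.
Proof.
by case: j => [|[|[|//]]] // _; case: d => [|[|[|d]]] //; rewrite /jx /= ?nth_nil mxE.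
Qed.

Lemma dvel_jx (j i : nat) : dvel (delta_mx 0 (jx j) : jet) i = 0.
Proof.
case: j => [|[|[|j]]] //; case: i => [|[|[|i]]] //; rewrite /dvel /jx /= ?nth_nil ?mxE //.
Qed.

Lemma jx_jx (j d : nat) : (j < 3)%N -> (d < 3)%N -> (delta_mx 0 (jx j) : jet) 0 (jx d) = (d == j)%:R.
Proof. by case: j => [|[|[|//]]] _; case: d => [|[|[|//]]] _; rewrite mxE. Qed.

Lemma sum_delta (j : nat) (F : nat -> C) : (j < 3)%N -> \sum_(d < 3) F d * (d == j :> nat)%:R = F j.
Proof.
move=> j3; rewrite (bigD1 (Ordinal j3))//= eqxx mulr1 big1 ?addr0// => d /negPf.
by rewrite -val_eqE /= => ->; rewrite mulr0.
Qed.

Lemma eq_dquadr (h : nat -> nat -> nat -> C) (u w : nat -> C) c j :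
  (forall i, (i < 3)%N -> u i = w i) -> dquadr h u c j = dquadr h w c j.
Proof. by move=> uw; congr (_ * _); apply: eq_bigr => b _; rewrite uw. Qed.

Lemma diff_geo q i : D (jet_base q) -> differentiable (fun q => geo (G q) (vel q) i) q.
Proof.
move=> Dq; apply: differentiableB; last exact: (diff_quadr gH).
by apply: differentiableM; [exact: diff_vel|exact: (diff_quadr gH)].
Qed.

Lemma deriv_geo q v i : D (jet_base q) -> 'D_v (fun q => geo (G q) (vel q) i) q =
  dvel v i * quadr (G q) (vel q) 0%N
  + vel q i * 'D_v (fun q => quadr (G q) (vel q) 0%N) q - 'D_v (fun q => quadr (G q) (vel q) i) q.
Proof.
move=> Dq; have dq c := diff_quadr gH c Dq; have du := diff_vel q i.
have dm : differentiable (fun q => vel q i * quadr (G q) (vel q) 0%N) q by apply: differentiableM.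
rewrite (derivB v dm (dq i)) (derivM v du (dq 0%N)) deriv_vel.
by congr (_ - _); rewrite addrC [dvel v i * _]mulrC.
Qed.

Lemma deriv_quadr_jd q c j : D (jet_base q) -> (0 < j < 3)%N ->
  'D_(delta_mx 0 (jd j)) (fun q => quadr (G q) (vel q) c) q = dquadr (G q) (vel q) c j.
Proof.
move=> Dq j3; rewrite (deriv_quadr gH gS)// big1 ?add0r; last by move=> d _; rewrite jx_jd// mul0r.
have /andP[_ j3'] := j3; rewrite -[RHS](sum_delta _ j3'); apply: eq_bigr => d _.
by rewrite dvel_jd.
Qed.

Lemma geo_jd q i j : D (jet_base q) -> (0 < j < 3)%N -> (i < 3)%N ->
  'D_(delta_mx 0 (jd j)) (fun q => geo (G q) (vel q) i) q = geo_d (G q) (vel q) i j.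
Proof. by move=> Dq j3 i3; rewrite deriv_geo// !deriv_quadr_jd// dvel_jd. Qed.

Lemma geo_jx q i j : D (jet_base q) -> (j < 3)%N -> (i < 3)%N ->
  'D_(delta_mx 0 (jx j)) (fun q => geo (G q) (vel q) i) q = geo_x (G q) (dG q) (vel q) i j.
Proof.
move=> Dq j3 i3; rewrite deriv_geo// dvel_jx mul0r add0r.
have E c : 'D_(delta_mx 0 (jx j)) (fun q => quadr (G q) (vel q) c) q = quadr (dG q j) (vel q) c.
  rewrite (deriv_quadr gH gS)// [X in _ + X]big1 ?addr0; last by move=> d _; rewrite dvel_jx mulr0.
  rewrite -[RHS](sum_delta (fun d => quadr (dG q d) (vel q) c) j3); apply: eq_bigr => d _.
  by rewrite jx_jx// mulrC.
by rewrite !E.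
Qed.

Lemma diff_geo_d q i j : D (jet_base q) -> differentiable (fun q => geo_d (G q) (vel q) i j) q.
Proof.
move=> Dq; apply: differentiableB; last exact: (diff_dquadr gH).
apply: differentiableD; apply: differentiableM;
  [exact: differentiable_cst|exact: (diff_quadr gH)|exact: diff_vel|exact: (diff_dquadr gH)].
Qed.

Lemma deriv_geo_d q v i j : D (jet_base q) -> 'D_v (fun q => geo_d (G q) (vel q) i j) q =
  (i == j)%:R * 'D_v (fun q => quadr (G q) (vel q) 0%N) q
  + (dvel v i * dquadr (G q) (vel q) 0%N j + vel q i * 'D_v (fun q => dquadr (G q) (vel q) 0%N j) q)
  - 'D_v (fun q => dquadr (G q) (vel q) i j) q.
Proof.
move=> Dq; have dq c := diff_quadr gH c Dq; have du := diff_vel q i.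
have dd c := diff_dquadr gH c j Dq.
have d1 : differentiable (fun q => (i == j)%:R * quadr (G q) (vel q) 0%N) q.
  by apply: differentiableM => //; exact: differentiable_cst.
have d2 : differentiable (fun q => vel q i * dquadr (G q) (vel q) 0%N j) q.
  exact: differentiableM.
have d12 : differentiable (fun q => (i == j)%:R * quadr (G q) (vel q) 0%N
   + vel q i * dquadr (G q) (vel q) 0%N j) q by exact: differentiableD.
rewrite (derivB v d12 (dd i)) (derivD v d1 d2) (derivZ _ v (dq 0%N)) (derivM v du (dd 0%N)) deriv_vel.
by congr (_ + _ - _); rewrite addrC [dvel v i * _]mulrC.
Qed.

Definition acc q (i : nat) : C := if i == 0%N then 0 else geo (G q) (vel q) i.

Lemma Dt_geo_d (F1 F2 : jet -> C) q i j : D (jet_base q) ->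
  F1 q = geo (G q) (vel q) 1%N -> F2 q = geo (G q) (vel q) 2%N -> (i < 3)%N ->
  Dt F1 F2 (fun q => geo_d (G q) (vel q) i j) q = dt_geo_d (G q) (dG q) (vel q) (acc q) i j.
Proof.
move=> Dq e1 e2 i3; rewrite DtE; last exact: diff_geo_d.
set v := \row_i _.
have vx d : (d < 3)%N -> v 0 (jx d) = vel q d by case: d => [|[|[|//]]] _; rewrite mxE.
have vd d : (d < 3)%N -> dvel v d = acc q d.
  by case: d => [|[|[|//]]] _; rewrite /dvel /acc /= ?mxE /= ?e1 ?e2.
rewrite deriv_geo_d// vd//.
have Q c : 'D_v (fun q => quadr (G q) (vel q) c) q = dt_quadr (G q) (dG q) (vel q) (acc q) c.
  rewrite (deriv_quadr gH gS)//; congr (_ + _); apply: eq_bigr => d _; first by rewrite vx.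
  by rewrite vd.
have Qd c : 'D_v (fun q => dquadr (G q) (vel q) c j) q = dt_dquadr (G q) (dG q) (vel q) (acc q) c j.
  rewrite (deriv_dquadr gH)//; congr (_ + _); last exact: eq_dquadr.
  by apply: eq_bigr => d _; rewrite vx.
by rewrite Q !Qd.
Qed.

Variables (F1 F2 : jet -> C).
Hypothesis F1E : forall q, W q -> F1 q = geo (G q) (vel q) 1%N.
Hypothesis F2E : forall q, W q -> F2 q = geo (G q) (vel q) 2%N.

Let F (i : nat) : jet -> C := if i == 1%N then F1 else F2.

Let FE i q : (0 < i < 3)%N -> W q -> F i q = geo (G q) (vel q) i.
Proof. by case: i => [|[|[|//]]] // _ Wq; [exact: F1E|exact: F2E]. Qed.

Let F_jd i j q : (0 < i < 3)%N -> (0 < j < 3)%N -> W q -> pd [:: jd j] (F i) q = geo_d (G q) (vel q) i j.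
Proof.
move=> i3 j3 Wq; have /andP[_ i3'] := i3.
rewrite -(geo_jd (WD Wq) j3 i3').
by apply: (eq_deriv _ oW Wq) => z; exact: FE.
Qed.

Let F_jx i j q : (0 < i < 3)%N -> (j < 3)%N -> W q -> pd [:: jx j] (F i) q = geo_x (G q) (dG q) (vel q) i j.
Proof.
move=> i3 j3 Wq; have /andP[_ i3'] := i3.
rewrite -(geo_jx (WD Wq) j3 i3').
by apply: (eq_deriv _ oW Wq) => z; exact: FE.
Qed.

Lemma eq_Dt f h q : W q -> (forall z, W z -> f z = h z) -> Dt F1 F2 f q = Dt F1 F2 h q.
Proof.
move=> Wq fh; have E b : pd [:: b] f q = pd [:: b] h q by apply: (@eq_pd _ _ W).
by rewrite /Dt !E.
Qed.

Let F_Dt i j q : (0 < i < 3)%N -> (0 < j < 3)%N -> W q ->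
  Dt F1 F2 (pd [:: jd j] (F i)) q = dt_geo_d (G q) (dG q) (vel q) (acc q) i j.
Proof.
move=> i3 j3 Wq; have /andP[_ i3'] := i3.
rewrite -(Dt_geo_d j (WD Wq) (F1E Wq) (F2E Wq) i3').
by apply: eq_Dt => // z Wz; exact: F_jd.
Qed.

Lemma torsion_geodesic q (r := riem (G q) (dG q)) : W q ->
  [/\ 2 * Dt F1 F2 (pd [:: jd2] F1) q - pd [:: jd2] F1 q * pd [:: jd1] F1 q
       - pd [:: jd2] F2 q * pd [:: jd2] F1 q - 4 * pd [:: jx2] F1 q = - 4 * jac r (vel q) 1%N 2%N,
     - (pd [:: jd2] F2 q) ^+ 2 - 2 * Dt F1 F2 (pd [:: jd1] F1) q
       - 4 * pd [:: jx2] F2 q + 4 * pd [:: jx1] F1 q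
       + 2 * Dt F1 F2 (pd [:: jd2] F2) q + (pd [:: jd1] F1 q) ^+ 2
       = 4 * (jac r (vel q) 1%N 1%N - jac r (vel q) 2%N 2%N) &
     - 2 * Dt F1 F2 (pd [:: jd1] F2) q + pd [:: jd2] F2 q * pd [:: jd1] F2 q
       + 4 * pd [:: jx1] F2 q + pd [:: jd1] F1 q * pd [:: jd1] F2 q
       = 4 * jac r (vel q) 2%N 1%N].
Proof.
move=> Wq; have Dq := WD Wq.
have a11 : pd [:: jd1] F1 q = geo_d (G q) (vel q) 1%N 1%N by exact: (@F_jd 1 1).
have b11 : pd [:: jx1] F1 q = geo_x (G q) (dG q) (vel q) 1%N 1%N by exact: (@F_jx 1 1).
have c11 : Dt F1 F2 (pd [:: jd1] F1) q = dt_geo_d (G q) (dG q) (vel q) (acc q) 1%N 1%N by exact: (@F_Dt 1 1).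
have a12 : pd [:: jd2] F1 q = geo_d (G q) (vel q) 1%N 2%N by exact: (@F_jd 1 2).
have b12 : pd [:: jx2] F1 q = geo_x (G q) (dG q) (vel q) 1%N 2%N by exact: (@F_jx 1 2).
have c12 : Dt F1 F2 (pd [:: jd2] F1) q = dt_geo_d (G q) (dG q) (vel q) (acc q) 1%N 2%N by exact: (@F_Dt 1 2).
have a21 : pd [:: jd1] F2 q = geo_d (G q) (vel q) 2%N 1%N by exact: (@F_jd 2 1).
have b21 : pd [:: jx1] F2 q = geo_x (G q) (dG q) (vel q) 2%N 1%N by exact: (@F_jx 2 1).
have c21 : Dt F1 F2 (pd [:: jd1] F2) q = dt_geo_d (G q) (dG q) (vel q) (acc q) 2%N 1%N by exact: (@F_Dt 2 1).
have a22 : pd [:: jd2] F2 q = geo_d (G q) (vel q) 2%N 2%N by exact: (@F_jd 2 2).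
have b22 : pd [:: jx2] F2 q = geo_x (G q) (dG q) (vel q) 2%N 2%N by exact: (@F_jx 2 2).
have c22 : Dt F1 F2 (pd [:: jd2] F2) q = dt_geo_d (G q) (dG q) (vel q) (acc q) 2%N 2%N by exact: (@F_Dt 2 2).
have S1 c a b := val_atS gS c a b Dq.
have S2 d c a b := der_atS oD gS d c a b Dq.
split.
- apply: etrans (torsion12 S1 S2 erefl).
  by congr (2 * _ - _ * _ - _ * _ - 4 * _); [exact: c12|exact: a12|exact: a11|exact: a22|exact: a12|exact: b12].
- apply: etrans (torsion_diag S1 S2 erefl).
  by congr (- _ ^+ 2 - 2 * _ - 4 * _ + 4 * _ + 2 * _ + _ ^+ 2);
    [exact: a22|exact: c11|exact: b22|exact: b11|exact: c22|exact: a11].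
- apply: etrans (torsion21 S1 S2 erefl).
  by congr (- 2 * _ + _ * _ + 4 * _ + _ * _);
    [exact: c21|exact: a22|exact: a21|exact: b21|exact: a11|exact: a21].
Qed.

Let F_jd2 i j l q : (0 < i < 3)%N -> (0 < j < 3)%N -> (0 < l < 3)%N -> W q ->
  pd [:: jd j; jd l] (F i) q = (i == j)%:R * dquadr (G q) (vel q) 0%N l
   + ((i == l)%:R * dquadr (G q) (vel q) 0%N j + vel q i * (2 * G q 0%N j l)) - 2 * G q i j l.
Proof.
move=> i3 j3 l3 Wq; have /andP[_ i3'] := i3; have /andP[_ l3'] := l3; have Dq := WD Wq.
transitivity ('D_(delta_mx 0 (jd l)) (fun q => geo_d (G q) (vel q) i j) q).
  by apply: (eq_deriv _ oW Wq) => z Wz; exact: F_jd.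
have E c : 'D_(delta_mx 0 (jd l)) (fun q => dquadr (G q) (vel q) c j) q = 2 * G q c j l.
  rewrite (deriv_dquadr gH)// big1 ?add0r; last by move=> d _; rewrite jx_jd// mul0r.
  congr (2 * _); rewrite -[RHS](sum_delta (fun b => G q c j b) l3'); apply: eq_bigr => b _.
  by rewrite dvel_jd.
by rewrite deriv_geo_d// !E deriv_quadr_jd// dvel_jd.
Qed.

(** Only [u^i g^0(u,u)] is cubic in the velocities, so the third derivatives involve the components
    [g^0] alone. *)
Lemma geodesic_jd3 i j l m q : (0 < i < 3)%N -> (0 < j < 3)%N -> (0 < l < 3)%N -> (0 < m < 3)%N -> W q ->
  pd [:: jd j; jd l; jd m] (F i) q = (i == j)%:R * (2 * G q 0%N l m)
   + (i == l)%:R * (2 * G q 0%N j m) + (i == m)%:R * (2 * G q 0%N j l).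
Proof.
move=> i3 j3 l3 m3 Wq; have /andP[_ i3'] := i3; have /andP[_ m3'] := m3; have Dq := WD Wq.
have dd c (k : nat) := diff_dquadr gH c k Dq.
have dg c a b := diff_g gH c a b Dq.
have Z c a b : 'D_(delta_mx 0 (jd m)) (fun q => 2 * G q c a b) q = 0.
  rewrite derivZ// (deriv_g gH)// big1 ?mulr0// => d _; by rewrite jx_jd// mul0r.
have d2g c a b : differentiable (fun q => 2 * G q c a b) q.
  by apply: differentiableM => //; exact: differentiable_cst.
have E c (k : nat) : 'D_(delta_mx 0 (jd m)) (fun q => dquadr (G q) (vel q) c k) q = 2 * G q c k m.
  rewrite (deriv_dquadr gH)// big1 ?add0r; last by move=> d _; rewrite jx_jd// mul0r.
  congr (2 * _); rewrite -[RHS](sum_delta (fun b => G q c k b) m3'); apply: eq_bigr => b _.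
  by rewrite dvel_jd.
transitivity ('D_(delta_mx 0 (jd m)) (fun q => (i == j)%:R * dquadr (G q) (vel q) 0%N l
   + ((i == l)%:R * dquadr (G q) (vel q) 0%N j + vel q i * (2 * G q 0%N j l)) - 2 * G q i j l) q).
  by apply: (eq_deriv _ oW Wq) => z Wz; exact: F_jd2.
have zd (a : C) c (k : nat) : differentiable (fun q => a * dquadr (G q) (vel q) c k) q.
  by apply: differentiableM => //; exact: differentiable_cst.
have vd : differentiable (fun q => vel q i * (2 * G q 0%N j l)) q.
  by apply: differentiableM => //; exact: diff_vel.
have s1 : differentiable (fun q => (i == l)%:R * dquadr (G q) (vel q) 0%N j + vel q i * (2 * G q 0%N j l)) q.
  exact: differentiableD.
have s2 : differentiable (fun q => (i == j)%:R * dquadr (G q) (vel q) 0%N l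
   + ((i == l)%:R * dquadr (G q) (vel q) 0%N j + vel q i * (2 * G q 0%N j l))) q.
  exact: differentiableD.
rewrite (derivB _ s2 (d2g _ _ _)) (derivD _ (zd _ _ _) s1) (derivD _ (zd _ _ _) vd).
rewrite (derivZ (i == j)%:R _ (dd 0%N l)) (derivZ (i == l)%:R _ (dd 0%N j)) !E (derivM _ (diff_vel q i) (d2g _ _ _)) !Z deriv_vel dvel_jd//.
by ring.
Qed.

Lemma third_order_geodesic q : W q ->
  [/\ pd [:: jd1; jd1; jd1] F2 q = 0, pd [:: jd2; jd2; jd2] F1 q = 0,
    pd [:: jd2; jd2; jd2] F2 q - 3 * pd [:: jd1; jd2; jd2] F1 q = 0,
    pd [:: jd1; jd1; jd1] F1 q - 3 * pd [:: jd1; jd1; jd2] F2 q = 0 &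
    pd [:: jd1; jd1; jd2] F1 q - pd [:: jd1; jd2; jd2] F2 q = 0].
Proof.
move=> Wq; have Dq := WD Wq.
have e (i j l m : nat) := @geodesic_jd3 i j l m q.
have s1 (a b a' b' : C) : a = a' -> b = b' -> a - b = a' - b' by move=> -> ->.
have s3 (a b a' b' : C) : a = a' -> b = b' -> a - 3 * b = a' - 3 * b' by move=> -> ->.
split.
- by apply: etrans (e 2 1 1 1 isT isT isT isT Wq) _; rewrite /=; ring.
- by apply: etrans (e 1 2 2 2 isT isT isT isT Wq) _; rewrite /=; ring.
- apply: etrans (s3 _ _ _ _ (e 2 2 2 2 isT isT isT isT Wq) (e 1 1 2 2 isT isT isT isT Wq)) _; rewrite /=; ring.
- apply: etrans (s3 _ _ _ _ (e 1 1 1 1 isT isT isT isT Wq) (e 2 1 1 2 isT isT isT isT Wq)) _; rewrite /=; ring.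
- apply: etrans (s1 _ _ _ _ (e 1 1 1 2 isT isT isT isT Wq) (e 2 1 2 2 isT isT isT isT Wq)) _.
  by rewrite /=; ring.
Qed.
End Geodesics.

(** * The tractor connection *)

(** Here [zx] stands for the derivative of the matrix [x] in direction [z]; [p], [q], [r] are second
    derivatives, which cancel cyclically. *)
Lemma bianchi_alg (K : comPzRingType) N (x y z xy xz yx yz zx zy : 'M[K]_N) (p q r : K) (i j : 'I_N) :
  p - q + (zx *m y + x *m zy - (zy *m x + y *m zx)) i j
  + (q - r + (xy *m z + y *m xz - (xz *m y + z *m xy)) i j)
  + (r - p + (yz *m x + z *m yx - (yx *m z + x *m yz)) i j) =
  (z *m (yx - xy + (x *m y - y *m x)) - (yx - xy + (x *m y - y *m x)) *m z) i j
  + (x *m (zy - yz + (y *m z - z *m y)) - (zy - yz + (y *m z - z *m y)) *m x) i j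
  + (y *m (xz - zx + (z *m x - x *m z)) - (xz - zx + (z *m x - x *m z)) *m y) i j.
Proof.
have mD (Y Z : 'M[K]_N) : (Y + Z) i j = Y i j + Z i j by rewrite mxE.
have mN (Y : 'M[K]_N) : (- Y) i j = - Y i j by rewrite mxE.
rewrite !(mulmxDl, mulmxDr, mulmxN, mulNmx, mulmxA).
rewrite !(mD, mN).
by ring.
Qed.

(** * The Bianchi identity for a connection matrix *)

Section Bianchi.
Variable R : realType.
Local Notation C := (Cplx R).
Variables (n N : nat).
Local Notation vec := 'rV[C]_n.
Variables (D : set vec) (A : 'I_n -> 'I_N -> 'I_N -> vec -> C).
Hypothesis oD : open D.
Hypothesis AH : forall a i j, holomorphic_on D (A a i j).

(** The expression whose vanishing is the integrability condition in [flat_system]. *)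
Definition curv (a b : 'I_n) (i j : 'I_N) (x : vec) : C :=
  pd [:: b] (A a i j) x - pd [:: a] (A b i j) x
  + \sum_k (A a i k x * A b k j x - A b i k x * A a k j x).

Let X (x : vec) a : 'M[C]_N := \matrix_(i, j) A a i j x.
Let dX (x : vec) c a : 'M[C]_N := \matrix_(i, j) pd [:: c] (A a i j) x.

Let curvE a b i j x : curv a b i j x = (dX x b a - dX x a b + (X x a *m X x b - X x b *m X x a)) i j.
Proof.
rewrite /curv sumrB !mxE; congr (_ + (_ - _)); by apply: eq_bigr => k _; rewrite !mxE.
Qed.

Let pd_mul c a b i j x : D x -> pd [:: c] (fun x => \sum_k A a i k x * A b k j x) x =
  (dX x c a *m X x b + X x a *m dX x c b) i j.
Proof.
move=> Dx; rewrite pd_sum; last by move=> k; apply: differentiableM; exact: AH.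
have E (Y Z Y' Z' : 'M[C]_N) : (Y *m Z + Y' *m Z') i j = \sum_k (Y i k * Z k j + Y' i k * Z' k j).
  by rewrite !mxE -big_split.
rewrite E; apply: eq_bigr => k _.
rewrite (pdM c (AH a i k Dx) (AH b k j Dx)).
rewrite /X /dX [X in _ = X * _ + _]mxE [X in _ = _ * X + _]mxE [X in _ = _ + X * _]mxE [X in _ = _ + _ * X]mxE.
by rewrite addrC [A b k j x * _]mulrC.
Qed.

Let pd_curv c a b i j x : D x -> pd [:: c] (curv a b i j) x =
  pd [:: b; c] (A a i j) x - pd [:: a; c] (A b i j) x
  + ((dX x c a *m X x b + X x a *m dX x c b) - (dX x c b *m X x a + X x b *m dX x c a)) i j.
Proof.
move=> Dx.
have dm a' b' : differentiable (fun x => \sum_k A a' i k x * A b' k j x) x.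
  by apply: diff_sum => k; apply: differentiableM; exact: AH.
have d1 a' b' : differentiable (pd [:: b'] (A a' i j)) x.
  by apply: (@holo_pd _ _ D _ b' oD (@AH a' i j)).
have -> : curv a b i j = fun x => (pd [:: b] (A a i j) x - pd [:: a] (A b i j) x)
   + (\sum_k A a i k x * A b k j x - \sum_k A b i k x * A a k j x).
  by apply/funext => y; rewrite /curv sumrB.
have d2 : differentiable (fun x => pd [:: b] (A a i j) x - pd [:: a] (A b i j) x) x.
  exact: differentiableB.
have d3 : differentiable (fun x => \sum_k A a i k x * A b k j x - \sum_k A b i k x * A a k j x) x.
  exact: differentiableB.
rewrite (pdD _ d2 d3) (pdB _ (d1 _ _) (d1 _ _)) (pdB _ (dm _ _) (dm _ _)) !pd_mul//.
congr (_ + _); rewrite [in RHS]mxE; congr (_ + _); by rewrite [in RHS]mxE.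
Qed.

Lemma bianchi a b c i j x : D x ->
  pd [:: c] (curv a b i j) x + pd [:: a] (curv b c i j) x + pd [:: b] (curv c a i j) x =
    \sum_k (A c i k x * curv a b k j x - curv a b i k x * A c k j x)
  + \sum_k (A a i k x * curv b c k j x - curv b c i k x * A a k j x)
  + \sum_k (A b i k x * curv c a k j x - curv c a i k x * A b k j x).
Proof.
move=> Dx; rewrite !pd_curv//.
pose F a b := dX x b a - dX x a b + (X x a *m X x b - X x b *m X x a).
have XE a' i' j' : X x a' i' j' = A a' i' j' x by rewrite mxE.
have E a' b' c' : \sum_k (A c' i k x * curv a' b' k j x - curv a' b' i k x * A c' k j x)
   = (X x c' *m F a' b' - F a' b' *m X x c') i j.
  rewrite sumrB !mxE; congr (_ - _); by apply: eq_bigr => k _; rewrite curvE XE.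
rewrite !E /F (@pd_comm _ _ D (A a i j) b c)// (@pd_comm _ _ D (A b i j) c a)// (@pd_comm _ _ D (A c i j) a b)//.
exact: bianchi_alg.
Qed.
End Bianchi.

(** * Flatness of the projective tractor connection *)

Section Tractor.
Variable R : realType.
Local Notation C := (Cplx R).
Local Notation base := 'rV[C]_3.
Variables (D : set base) (g : nat -> nat -> nat -> base -> C).
Hypothesis oD : open D.
Hypothesis gH : forall c a b, holomorphic_on D (g c a b).
Hypothesis gS : forall c a b x, D x -> g c a b x = g c b a x.
Hypothesis gT : forall a x, D x -> \sum_(c < 3) g c c a x = 0.

Definition riem_at x := riem (val_at g x) (der_at g x).
Definition schouten (a b : nat) x : C := rho_of (riem_at x) a b.

Hypothesis gW : forall (c d a b : 'I_3) x, D x ->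
  riem_at x c d a b = (c == a)%:R * schouten b d x - (c == b)%:R * schouten a d x.

(* Parallel sections are the pairs (s, mu) with d_a s = mu_a and
   d_a mu_b = g^c_ab mu_c - P_ab s, where P is the Schouten tensor. *)
Definition tractor (a i j : nat) x : C :=
  match i, j with
  | 0, _ => (j == a.+1)%:R
  | b.+1, 0 => - schouten a b x
  | b.+1, c.+1 => g c a b x
  end.

Lemma bi_id (a : 'I_3) : bi a = a.
Proof. by case: a => -[|[|[|//]]] ?; exact: val_inj. Qed.

Lemma der_trace d a x : D x -> \sum_(c < 3) der_at g x d c c a = 0.
Proof.
move=> Dx; transitivity (pd [:: bi d] (fun y => \sum_(c < 3) g c c a y) x).
  by rewrite pd_sum// => c; exact: gH.
transitivity (pd [:: bi d] (fun _ : base => 0 : C) x); last exact: pd_cst.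
by apply: (@eq_pd _ _ D) => // y; exact: gT.
Qed.

(** For a trace-free connection the Ricci tensor reduces to [d_k g^k_ab - g^k_ae g^e_kb], and both
    terms are symmetric in [a] and [b]. *)
Lemma schouten_sym a b x : D x -> schouten a b x = schouten b a x.
Proof.
move=> Dx; have S c a' b' := val_atS gS c a' b' Dx; have dS d c a' b' := der_atS oD gS d c a' b' Dx.
have E a' b' : schouten a' b' x =
    (\sum_(k < 3) der_at g x k k a' b' - \sum_(k < 3) \sum_(e < 3) val_at g x k a' e * val_at g x e k b') / 2.
  rewrite /schouten /rho_of /riem_at /riem; congr (_ / _).
  transitivity (\sum_(k < 3) der_at g x k k a' b' - \sum_(k < 3) der_at g x a' k k b'
     + (\sum_(k < 3) \sum_(e < 3) val_at g x k k e * val_at g x e a' b'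
        - \sum_(k < 3) \sum_(e < 3) val_at g x k a' e * val_at g x e k b')).
    rewrite -!sumrB -big_split; apply: eq_bigr => k _; congr (_ + _); by rewrite sumrB.
  have Z : \sum_(k < 3) \sum_(e < 3) val_at g x k k e * val_at g x e a' b' = 0.
    rewrite exchange_big big1// => e _.
    transitivity ((\sum_(k < 3) g k k e x) * g e a' b' x); first by rewrite mulr_suml.
    by rewrite (gT _ Dx) mul0r.
  have al (w y z t : C) : y = 0 -> z = 0 -> w - y + (z - t) = w - t by move=> -> ->; rewrite subr0 sub0r.
  exact: al (der_trace a' b' Dx) Z.
have cg (w y w' y' : C) : w = w' -> y = y' -> (w - y) / 2 = (w' - y') / 2 by move=> -> ->.
rewrite (E a b) (E b a); apply: cg.
  by apply: eq_bigr => k _; exact: dS.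
rewrite exchange_big /=; apply: eq_bigr => k _; apply: eq_bigr => e _.
by rewrite mulrC S [X in _ * X]S.
Qed.

Lemma schouten_hol a b : holomorphic_on D (schouten a b).
Proof.
move=> x Dx; rewrite /schouten /rho_of /riem_at /riem.
have dG c a' b' : differentiable (fun x => val_at g x c a' b') x by exact: (@gH c a' b' x Dx).
have ddG d c a' b' : differentiable (fun x => der_at g x d c a' b') x.
  exact: (@holo_pd _ _ D _ (bi d) oD (@gH c a' b')).
apply: differentiableM; last exact: differentiable_cst.
apply: diff_sum => k; apply: differentiableD; first exact: differentiableB.
by apply: diff_sum => e; apply: differentiableB; apply: differentiableM.
Qed.

Lemma tractor_hol a i j : holomorphic_on D (tractor a i j).
Proof.
move=> x Dx; case: i => [|b]; first exact: differentiable_cst.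
case: j => [|c]; last exact: gH.
by apply: differentiableN; exact: schouten_hol.
Qed.

Let A (a : 'I_3) (i j : 'I_4) : base -> C := tractor a i j.

Let AH a i j : holomorphic_on D (A a i j). Proof. exact: tractor_hol. Qed.

Lemma sum4 (F : nat -> C) : \sum_(k < 4) F k = F 0%N + \sum_(e < 3) F e.+1.
Proof. by rewrite big_ord_recl; congr (_ + _). Qed.

Lemma sum3_delta (F : nat -> C) (a : 'I_3) : \sum_(e < 3) (e == a :> nat)%:R * F e = F a.
Proof.
rewrite (bigD1 a)//= eqxx mul1r big1 ?addr0// => e /negPf; rewrite -val_eqE /= => ->.
by rewrite mul0r.
Qed.

Let curv_sum a b i j x : curv A a b i j x = pd [:: b] (A a i j) x - pd [:: a] (A b i j) x
  + (tractor a i 0%N x * tractor b 0%N j x - tractor b i 0%N x * tractor a 0%N j x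
   + \sum_(e < 3) (tractor a i e.+1 x * tractor b e.+1 j x - tractor b i e.+1 x * tractor a e.+1 j x)).
Proof.
by rewrite /curv (sum4 (fun k => tractor a i k x * tractor b k j x - tractor b i k x * tractor a k j x)).
Qed.

(** The [s] row of the curvature consists of the skew part of [schouten] and the torsion of [g]. *)
Let curv_top a b (i j : 'I_4) x : D x -> i = 0%N :> nat -> curv A a b i j x = 0.
Proof.
move=> Dx i0; rewrite curv_sum.
have -> : A a i j = fun=> (j == a.+1 :> nat)%:R by apply/funext => y; rewrite /A i0.
have -> : A b i j = fun=> (j == b.+1 :> nat)%:R by apply/funext => y; rewrite /A i0.
rewrite !pd_cst subrr add0r i0 {1 2}/tractor !mul0r subrr add0r sumrB.
rewrite (sum3_delta (fun e => tractor b e.+1 j x) a) (sum3_delta (fun e => tractor a e.+1 j x) b).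
case: (nat_of_ord j) => [|c] /=; first by rewrite (schouten_sym a b Dx) subrr.
by rewrite (gS c a b Dx) subrr.
Qed.

(** Up to sign, the (mu, mu) block of the curvature is the Weyl tensor, which [gW] sets to zero. *)
Let curv_mid a b (i j : 'I_4) (d c : nat) x : D x -> i = d.+1 :> nat -> j = c.+1 :> nat -> curv A a b i j x = 0.
Proof.
move=> Dx id jc; rewrite curv_sum id jc.
have d3 : (d < 3)%N by have := ltn_ord i; rewrite id.
have c3 : (c < 3)%N by have := ltn_ord j; rewrite jc.
have := @gW (Ordinal c3) (Ordinal d3) a b x Dx.
have AE a' : A a' i j = g c a' d by apply/funext => y; rewrite /A id jc.
rewrite !AE /riem_at /riem /der_at !bi_id /val_at /=.
have al (p q s t k l v w : C) : p - q + (s - t) = k * v - l * w ->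
    q - p + (- w * l - - v * k + (t - s)) = 0.
  move=> h; transitivity (k * v - l * w - (p - q + (s - t))); first by ring.
  by rewrite h subrr.
rewrite -!val_eqE /= !eqSS !sumrB.
have sw a' b' : \sum_(e < 3) g e a' d x * g c b' e x = \sum_(e < 3) g c b' e x * g e a' d x.
  by apply: eq_bigr => e _; rewrite mulrC.
rewrite !sw; exact: al.
Qed.

Let curv_flat_row a b (i j : 'I_4) x : D x -> j != 0%N :> nat -> curv A a b i j x = 0.
Proof.
move=> Dx; case ei : (nat_of_ord i) => [|d] j0; first exact: curv_top.
by case ej : (nat_of_ord j) j0 => [//|c] _; exact: (curv_mid a b Dx ei ej).
Qed.

(* Only the (mu, s) entries of the curvature are not killed by [gW]; the Bianchi
   identity for [a], [b] and the third index [c] kills them: this is the vanishing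
   of the Cotton tensor of a Weyl-flat connection in dimension 3. *)
Lemma tractor_flat a b i j x : D x -> curv A a b i j x = 0.
Proof.
move=> Dx; have [j0|] := eqVneq (nat_of_ord j) 0%N; last exact: curv_flat_row.
have [ab|ab] := eqVneq a b.
  by rewrite ab /curv subrr add0r big1// => k _; rewrite subrr.
have [c ca cb] : exists2 c : 'I_3, c != a & c != b.
  have [c /andP[ca cb]|h] := pickP (fun c : 'I_3 => (c != a) && (c != b)); first by exists c.
  have : (#|'I_3| <= #|pred2 a b|)%N.
    apply: subset_leq_card; apply/fintype.subsetP => c _; rewrite !inE.
    by have := h c; rewrite -negb_or => /negbFE.
  by rewrite card_ord card2; case: (a != b).
(* The column of [mu_c]. In the Bianchi identity at [(i, l)] the derivative terms vanish, since this
   column of the curvature is zero on all of [D]; of the products only the one through [A c j l = 1]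
   remains. *)
pose l : 'I_4 := lift ord0 c.
have l0 : l != 0%N :> nat by rewrite lift0.
have Al a' k y : nat_of_ord k = 0%N -> A a' k l y = (c == a')%:R.
  by move=> k0; rewrite /A k0 /tractor lift0 eqSS val_eqE.
have pd0 (e a' b' : 'I_3) : pd [:: e] (curv A a' b' i l) x = 0.
  transitivity (pd [:: e] (fun _ : base => 0 : C) x); last exact: pd_cst.
  by apply: (@eq_pd _ _ D) => // y Dy; exact: curv_flat_row.
have S e a' b' : \sum_k (A e i k x * curv A a' b' k l x - curv A a' b' i k x * A e k l x)
    = - (curv A a' b' i j x * (c == e)%:R).
  rewrite (bigD1 j)//= big1 ?addr0.
    by rewrite curv_flat_row// mulr0 sub0r Al.
  move=> k kj; rewrite !curv_flat_row//; first by rewrite mulr0 mul0r subrr.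
  by apply: contra kj => /eqP k0; apply/eqP/val_inj; rewrite /= k0 j0.
have := @bianchi _ _ _ D A oD AH a b c i l x Dx.
rewrite !pd0 !S eqxx (negPf ca) (negPf cb) !mulr0 mulr1 !oppr0 !addr0 => /esym/eqP.
by rewrite oppr_eq0 => /eqP.
Qed.
End Tractor.

(** * Straightening a flat projective connection *)

Section ChainRule.
Variable R : realType.
Local Notation C := (Cplx R).
Variables (n m : nat).

Lemma pd_comp (h : 'rV[C]_m -> C) (phi : 'rV[C]_n -> 'rV[C]_m) a x :
  differentiable phi x -> differentiable h (phi x) ->
  pd [:: a] (fun x => h (phi x)) x =
  \sum_k pd [:: k] h (phi x) * pd [:: a] (fun x => phi x 0 k) x.
Proof.
move=> dphi dh; have dc : differentiable (fun x => h (phi x)) x by exact: differentiable_comp.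
transitivity ('d (fun x => h (phi x)) x (delta_mx 0 a)); first by rewrite /pd /= deriveE.
have -> : 'd (fun x => h (phi x)) x (delta_mx 0 a) = 'd h (phi x) ('d phi x (delta_mx 0 a)).
  by rewrite -[fun x => h (phi x)]/(h \o phi) (diff_comp dphi dh).
rewrite (gradE dh) /dotc; apply: eq_bigr => k _.
by rewrite mulrC diff_row_coord// dotc_delta.
Qed.
End ChainRule.

Lemma sum_mx_comm (K : comUnitRingType) n (M1 M2 : 'I_n -> 'I_n -> K) :
  (forall i j, \sum_k M1 i k * M2 k j = (i == j)%:R) ->
  forall i j, \sum_k M2 i k * M1 k j = (i == j)%:R.
Proof.
move=> h i j.
have E (A B : 'I_n -> 'I_n -> K) i' j' :
    ((\matrix_(i, j) A i j) *m (\matrix_(i, j) B i j)) i' j' = \sum_k A i' k * B k j'.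
  by rewrite mxE; apply: eq_bigr => k _; rewrite !mxE.
have /mulmx1C/matrixP/(_ i j) : (\matrix_(i, j) M1 i j) *m (\matrix_(i, j) M2 i j) = 1%:M.
  by apply/matrixP => i' j'; rewrite E h mxE.
by rewrite E mxE.
Qed.

Section InverseJacobian.
Variable R : realType.
Local Notation C := (Cplx R).
Local Notation base := 'rV[C]_3.

(** [N] is the Jacobian of the inverse map read at [phi x]. The chain rule makes it a left inverse,
    and for square matrices also a right inverse. *)
Lemma inverse_jacobian (V : set base) (phi : base -> base) : biholomorphic_on V phi ->
  exists N : 'I_3 -> 'I_3 -> base -> C,
    [/\ forall c k, holomorphic_on V (N c k),
      forall x c a, V x -> \sum_k N c k x * pd [:: a] (fun y => phi y 0 k) x = (c == a)%:R &
      forall x k l, V x -> \sum_c pd [:: c] (fun y => phi y 0 k) x * N c l x = (k == l)%:R].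
Proof.
case=> oV oI hphi [psi hpsi psiK].
pose N (c k : 'I_3) x := pd [:: k] (fun y => psi y 0 c : C) (phi x).
have hc c : holomorphic_on (phi @` V) (fun y => psi y 0 c : C).
  by move=> y Iy; apply: diff_coord; exact: hpsi.
have NM x c a : V x -> \sum_k N c k x * pd [:: a] (fun y => phi y 0 k) x = (c == a)%:R.
  move=> Vx; have Ix : (phi @` V) (phi x) by exists x.
  rewrite -(pd_comp a (hphi x Vx) (hc c _ Ix)).
  transitivity (pd [:: a] (fun y : base => (y - 0) 0 c : C) x).
    by apply: (@eq_pd _ _ V) => // y Vy; rewrite psiK// subr0.
  by rewrite pd_coordB eq_sym.
exists N; split; [|by move=> x c a; exact: NM|].
- move=> c k x Vx; have Ix : (phi @` V) (phi x) by exists x.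
  apply: (@differentiable_comp _ _ _ _ phi (pd [:: k] (fun y => psi y 0 c : C))); first exact: hphi.
  exact: (@holo_pd _ _ _ _ k oI (hc c)).
- move=> x k l Vx;  have := @sum_mx_comm C 3 (fun c k => N c k x) (fun k a => pd [:: a] (fun y => phi y 0 k : C) x).
  by apply => c a; exact: NM.
Qed.
End InverseJacobian.

Lemma ker2 (K : idomainType) (x y p q r s : K) :
  x * p + y * r = 0 -> x * q + y * s = 0 -> p * s - q * r != 0 -> x = 0 /\ y = 0.
Proof.
move=> h1 h2 d0; split; apply/eqP.
  have : x * (p * s - q * r) = s * (x * p + y * r) - r * (x * q + y * s) by ring.
  by rewrite h1 h2 !mulr0 subrr => /eqP; rewrite mulf_eq0 (negPf d0) orbF.
have : y * (p * s - q * r) = p * (x * q + y * s) - q * (x * p + y * r) by ring.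
by rewrite h1 h2 !mulr0 subrr => /eqP; rewrite mulf_eq0 (negPf d0) orbF.
Qed.

Section Det3.
Variable (K : comPzRingType).
(** Written out so that [det_b] can compare it with a 2 by 2 minor by [field]. *)
Definition det3 (m : nat -> nat -> K) : K :=
  m 0%N 0%N * (m 1%N 1%N * m 2%N 2%N - m 1%N 2%N * m 2%N 1%N)
  - m 0%N 1%N * (m 1%N 0%N * m 2%N 2%N - m 1%N 2%N * m 2%N 0%N)
  + m 0%N 2%N * (m 1%N 0%N * m 2%N 1%N - m 1%N 1%N * m 2%N 0%N).

Lemma det3M (m l : nat -> nat -> K) :
  det3 (fun i j => m i 0%N * l 0%N j + m i 1%N * l 1%N j + m i 2%N * l 2%N j) = det3 m * det3 l.
Proof. by rewrite /det3; ring. Qed.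

Lemma det3_inv (m l : nat -> nat -> K) :
  (forall i j, (i < 3)%N -> (j < 3)%N ->
     m i 0%N * l 0%N j + m i 1%N * l 1%N j + m i 2%N * l 2%N j = (i == j)%:R) ->
  det3 m * det3 l = 1.
Proof. by move=> h; rewrite -det3M /det3 !h//=; ring. Qed.
End Det3.

(** * The coframe equation for a prolonged point transformation *)

Section Structure.
Variable R : realType.
Local Notation C := (Cplx R).
Local Notation jet := 'rV[C]_5.

Lemma derivV (f : jet -> C) p v : f p != 0 -> differentiable f p ->
  'D_v (fun q => (f q)^-1) p = - (f p)^-1 ^+ 2 * 'D_v f p.
Proof.
move=> f0 df; rewrite deriveV//; last exact: diff_derivable.
by rewrite /GRing.scale /= exprVn.
Qed.

Lemma sum5nat (K : nmodType) (F : nat -> K) : \sum_(d < 5) F d = F 0%N + F 1%N + F 2%N + F 3%N + F 4%N.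
Proof. by rewrite !big_ord_recr big_ord0 /= add0r. Qed.

(** The matrix is block triangular with diagonal blocks of sizes 2, 2 and 1, so a left kernel vector
    dies block by block. *)
Lemma structure_unit (a : nat -> C) : a 1%N * a 6%N - a 2%N * a 5%N != 0 ->
  a 9%N * a 12%N - a 10%N * a 11%N != 0 -> a 15%N != 0 -> structure_mx a \in unitmx.
Proof.
move=> d1 d2 d3; rewrite unitmxE unitfE; apply/negP => /det0P[v v0 vA].
have [x xE] : exists x : nat -> C, forall i : 'I_5, v 0 i = x i.
  by exists (fun i => v 0 (inord i)) => i; rewrite inord_val.
have h (j : 'I_5) : \sum_(i < 5) x i * structure_mx a i j = 0.
  have /rowP/(_ j) := vA; rewrite !mxE => {2}<-; by apply: eq_bigr => i _; rewrite xE.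
have e (j : 'I_5) : x 0%N * structure_mx a jt j + x 1%N * structure_mx a jx1 j + x 2%N * structure_mx a jx2 j
    + x 3%N * structure_mx a jd1 j + x 4%N * structure_mx a jd2 j = 0.
  have := h j; rewrite !big_ord_recl big_ord0 addr0 !addrA => <-.
  by do !congr (_ + _); congr (_ * structure_mx a _ _); exact: val_inj.
move: (e jt) (e jx1) (e jx2) (e jd1) (e jd2).
rewrite !mxE /= !mulr0 !(addr0, add0r) => e1 e2 e3 e4 e5.
have [x0 x1] := ker2 e1 e2 d1.
have x4 : x 4%N = 0 by apply/eqP; move/eqP: e5; rewrite mulf_eq0 (negPf d3) orbF.
rewrite x0 x1 x4 !mul0r !addr0 !add0r in e3 e4.
have [x2 x3] := ker2 e3 e4 d2.
move/eqP: v0; apply; apply/rowP => i; rewrite xE mxE.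
by case: i => -[|[|[|[|[|//]]]]].
Qed.

Lemma coframe_mul (a : nat -> C) (F1 F2 : jet -> C) (q v : jet)
  (e1 := v 0 jd1 - F1 q * v 0 jt) (e2 := v 0 jd2 - F2 q * v 0 jt)
  (e3 := v 0 jx1 - q 0 jd1 * v 0 jt) (e4 := v 0 jx2 - q 0 jd2 * v 0 jt) (e5 := v 0 jt) :
  structure_mx a *m coframe F1 F2 q v = \col_i nth 0 [::
    a 1%N * e1 + a 2%N * e2 + a 3%N * e3 + a 4%N * e4;
    a 5%N * e1 + a 6%N * e2 + a 7%N * e3 + a 8%N * e4;
    a 9%N * e3 + a 10%N * e4; a 11%N * e3 + a 12%N * e4;
    a 13%N * e3 + a 14%N * e4 + a 15%N * e5] i.
Proof.
apply/colP => i; rewrite !mxE.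
transitivity (\sum_(j < 5) nth 0 (nth [::]
      [:: [:: a 1%N; a 2%N; a 3%N; a 4%N; 0];
          [:: a 5%N; a 6%N; a 7%N; a 8%N; 0];
          [:: 0; 0; a 9%N; a 10%N; 0];
          [:: 0; 0; a 11%N; a 12%N; 0];
          [:: 0; 0; a 13%N; a 14%N; a 15%N]] i) j * nth 0 [:: e1; e2; e3; e4; e5] j).
  by apply: eq_bigr => j _; rewrite !mxE.
rewrite (sum5nat (fun j => nth 0 (nth [::] _ i) j * nth 0 [:: e1; e2; e3; e4; e5] j)).
by case: i => -[|[|[|[|[|//]]]]] ?; rewrite /= ?mul0r ?(addr0, add0r).
Qed.

Local Notation base := 'rV[C]_3.

Lemma total_derivE (h : base -> C) q :
  total_deriv h q = \sum_(d < 3) vel q d * pd [:: bi d] h (jet_base q).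
Proof. by rewrite (sum3nat (fun d => vel q d * pd [:: bi d] h (jet_base q))) /vel /= mul1r. Qed.

Variables (V : set base) (phi : base -> base) (W U : set jet) (F1 F2 : jet -> C) (p : jet).
Hypothesis phiV : biholomorphic_on V phi.
Hypothesis oW : open W.
Hypothesis Wp : W p.
Let f (k : nat) : base -> C := fun x => phi x 0 (bi k).
Let T k q := total_deriv (f k) q.
Let Y k q := T k q / T 0%N q.
Let m k a q := pd [:: bi a] (f k) (jet_base q).
Hypothesis WU : forall q, W q -> [/\ U q, V (jet_base q) & T 0%N q != 0].

Let oV : open V. Proof. by case: phiV. Qed.
Let fH k : holomorphic_on V (f k).
Proof. by case: phiV => _ _ h _ x Vx; apply: diff_coord; exact: h. Qed.
Let mH k a q : V (jet_base q) -> differentiable (m k a) q.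
Proof. by move=> Vq; apply: diff_jb; exact: (@holo_pd _ _ V _ (bi a) oV (@fH k)). Qed.
Let TE k : T k = fun q => \sum_(d < 3) vel q d * m k d q.
Proof. by apply/funext => q; exact: total_derivE. Qed.
Let TH k q : V (jet_base q) -> differentiable (T k) q.
Proof.
move=> Vq; rewrite TE; apply: diff_sum => d.
by apply: differentiableM; [exact: diff_vel|exact: mH].
Qed.
Let YH k q : W q -> differentiable (Y k) q.
Proof.
move=> /WU[_ Vq T0]; apply: differentiableM; first exact: TH.
have t0 := TH 0%N Vq; exact: differentiableV.
Qed.

Let h (k : nat) : jet -> C :=
  match k with
  | 0 => fun q => f 0%N (jet_base q)
  | 1 => fun q => f 1%N (jet_base q)
  | 2 => fun q => f 2%N (jet_base q)
  | 3 => Y 1%N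
  | _ => Y 2%N
  end.

Let hE (k : 'I_5) : (fun q => prolong phi q 0 k : C) = h k.
Proof. by apply/funext => z; rewrite mxE; case: k => -[|[|[|[|[|//]]]]]. Qed.

Let pE (k : 'I_5) (z : jet) : prolong phi z 0 k = h k z.
Proof. by rewrite -hE. Qed.

Let prolong_diff q v : W q -> forall k : 'I_5, ('d (prolong phi) q v : jet) 0 k = 'D_v (h k) q.
Proof.
move=> Wq k; have [_ Vq T0] := WU Wq.
have fq (l : nat) : differentiable (fun q => f l (jet_base q)) q by apply: diff_jb; exact: fH.
have hd (l : nat) : differentiable (h l) q.
  move: l => [|[|[|[|l]]]];
    [exact: (fq 0%N)|exact: (fq 1%N)|exact: (fq 2%N)|exact: (YH 1%N Wq)|exact: (YH 2%N Wq)].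
have dP : differentiable (prolong phi) q by apply: diff_rowP => l; rewrite hE.
by rewrite diff_row_coord// hE deriveE// (gradE (hd k)).
Qed.

Lemma prolong_vel1 q v : W q -> ('d (prolong phi) q v : jet) 0 jd1 = 'D_v (Y 1%N) q.
Proof. by move=> Wq; exact: prolong_diff. Qed.

Lemma prolong_vel2 q v : W q -> ('d (prolong phi) q v : jet) 0 jd2 = 'D_v (Y 2%N) q.
Proof. by move=> Wq; exact: prolong_diff. Qed.

Let T_jd k j q : (0 < j < 3)%N -> V (jet_base q) -> pd [:: jd j] (T k) q = m k j q.
Proof.
move=> j3 Vq; have /andP[_ j3'] := j3; rewrite /pd /= TE.
have mh d := mH k d Vq; have vh d := diff_vel q d.
rewrite deriv_sum; last by move=> d; apply: differentiableM.
transitivity (\sum_(d < 3) m k d q * (d == j :> nat)%:R).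
  apply: eq_bigr => d _; rewrite (derivM _ (vh d) (mh d)) deriv_vel.
  have -> : 'D_(delta_mx 0 (jd j)) (m k d) q = 0.
    rewrite deriv_jb; last exact: (@holo_pd _ _ V _ (bi d) oV (@fH k)).
    by rewrite big1// => e _; rewrite jx_jd// mul0r.
  by rewrite mulr0 add0r dvel_jd.
exact: (sum_delta (fun d => m k d q) j3').
Qed.

Let Y_jd k j q : (0 < j < 3)%N -> W q ->
  pd [:: jd j] (Y k) q = (m k j q - Y k q * m 0%N j q) / T 0%N q.
Proof.
move=> j3 Wq; have [_ Vq T0] := WU Wq; have tk := TH k Vq; have t0 := TH 0%N Vq.
have t0V : differentiable (fun q => (T 0%N q)^-1) q by exact: differentiableV.
have al (x y z a b t s : C) : s != 0 -> x = - s^-1 ^+ 2 * z -> z = b -> y = a ->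
    t * x + s^-1 * y = (a - t / s * b) / s.
  by move=> s0 -> -> ->; field.
apply: etrans (pdM (jd j) tk t0V) _.
exact: (al _ _ _ _ _ _ _ T0 (pdV (jd j) T0 t0) (T_jd 0%N j3 Vq) (T_jd k j3 Vq)).
Qed.

Let det_phi q : V (jet_base q) -> det3 (fun k a => m k a q) != 0.
Proof.
move=> Vq; have [N [_ NM _]] := inverse_jacobian phiV.
pose n c k := N (bi c) (bi k) (jet_base q).
have e (c a : nat) : (c < 3)%N -> (a < 3)%N ->
    n c 0%N * m 0%N a q + n c 1%N * m 1%N a q + n c 2%N * m 2%N a q = (c == a)%:R.
  move=> c3 a3; rewrite -(sum3nat (fun k => n c k * m k a q)).
  have -> : (c == a)%:R = (bi c == bi a)%:R :> C.
    by case: c c3 => [|[|[|//]]]; case: a a3 => [|[|[|//]]].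
  rewrite -(NM _ (bi c) (bi a) Vq).
  by apply: eq_bigr => k _; rewrite /n /m /f !bi_id.
have d1 := @det3_inv C n (fun k a => m k a q) e.
apply/negP => /eqP d0; have : (1 : C) = 0 by rewrite -d1 d0 mulr0.
by move/eqP; rewrite oner_eq0.
Qed.

(** The coefficients [a_9] to [a_12]; by [Y_jd] also [T 0] times the velocity Jacobian of the new
    velocities. *)
Let b k j q := m k j q - Y k q * m 0%N j q.

(** The Jacobian determinant of [phi] equals [T 0] times this minor: a column operation turns the
    time column into the [T k], and one elimination step does the rest. *)
Let det_b q : W q -> b 1%N 1%N q * b 2%N 2%N q - b 1%N 2%N q * b 2%N 1%N q != 0.
Proof.
move=> Wq; have [_ Vq T0] := WU Wq; have := det_phi Vq.
have tE k : T k q = m k 0%N q + vel q 1%N * m k 1%N q + vel q 2%N * m k 2%N q.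
  by rewrite TE (sum3nat (fun d => vel q d * m k d q)) /vel /= mul1r.
rewrite /b /Y !tE; move: T0; rewrite tE => T0; apply: contra_neq.
move: T0; rewrite /det3.
move: (vel q 1%N) (vel q 2%N) (m 0%N 0%N q) (m 0%N 1%N q) (m 0%N 2%N q) (m 1%N 0%N q) (m 1%N 1%N q)
  (m 1%N 2%N q) (m 2%N 0%N q) (m 2%N 1%N q) (m 2%N 2%N q) => u1 u2 a0 a1 a2 b0 b1 b2 c0 c1 c2 T0 det0.
transitivity ((a0 + u1 * a1 + u2 * a2) *
   ((b1 - (b0 + u1 * b1 + u2 * b2) / (a0 + u1 * a1 + u2 * a2) * a1) *
    (c2 - (c0 + u1 * c1 + u2 * c2) / (a0 + u1 * a1 + u2 * a2) * a2) -
    (b2 - (b0 + u1 * b1 + u2 * b2) / (a0 + u1 * a1 + u2 * a2) * a2) *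
    (c1 - (c0 + u1 * c1 + u2 * c2) / (a0 + u1 * a1 + u2 * a2) * a1))); first by field.
by rewrite det0 mulr0.
Qed.

(** Entry 0 is filler, since the coefficients are numbered from 1. *)
Definition coef (n : nat) q : C := nth 0 [:: 0;
  pd [:: jd1] (Y 1%N) q; pd [:: jd2] (Y 1%N) q; pd [:: jx1] (Y 1%N) q; pd [:: jx2] (Y 1%N) q;
  pd [:: jd1] (Y 2%N) q; pd [:: jd2] (Y 2%N) q; pd [:: jx1] (Y 2%N) q; pd [:: jx2] (Y 2%N) q;
  b 1%N 1%N q; b 1%N 2%N q; b 2%N 1%N q; b 2%N 2%N q;
  m 0%N 1%N q; m 0%N 2%N q; T 0%N q] n.

Let coef_unit q : W q -> structure_mx (coef^~ q) \in unitmx.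
Proof.
move=> Wq; have [_ Vq T0] := WU Wq; have db := det_b Wq.
apply: structure_unit; [|exact: db|exact: T0].
have al (x y z t x' y' z' t' s : C) : s != 0 -> x' * y' - z' * t' != 0 -> x = x' / s -> y = y' / s ->
   z = z' / s -> t = t' / s -> x * y - z * t != 0.
  move=> s0 st0 -> -> -> ->; have -> : x' / s * (y' / s) - z' / s * (t' / s) = (x' * y' - z' * t') / (s * s).
    by field.
  by rewrite mulf_neq0// invr_neq0// mulf_neq0.
exact: (al _ _ _ _ _ _ _ _ _ T0 db (@Y_jd 1 1 q isT Wq) (@Y_jd 2 2 q isT Wq)
  (@Y_jd 1 2 q isT Wq) (@Y_jd 2 1 q isT Wq)).
Qed.

Let f_diff k q v : V (jet_base q) -> 'D_v (fun q => f k (jet_base q)) q =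
  m k 1%N q * (v 0 jx1 - q 0 jd1 * v 0 jt) + m k 2%N q * (v 0 jx2 - q 0 jd2 * v 0 jt) + T k q * v 0 jt.
Proof.
move=> Vq; rewrite (deriv_jb _ (@fH k _ Vq)) (sum3nat (fun d => v 0 (jx d) * m k d q)) TE.
rewrite (sum3nat (fun d => vel q d * m k d q)) /vel /jx /=.
by move: (m k 0%N q) (m k 1%N q) (m k 2%N q) => a0 a1 a2; ring.
Qed.

Let dv (q : jet) : jet := \row_i nth 0 [:: 1; q 0 jd1; q 0 jd2; F1 q; F2 q] i.
Hypothesis dY : forall i q, (0 < i < 3)%N -> W q -> 'D_(dv q) (Y i) q = 0.

Let Y_diff i q v : (0 < i < 3)%N -> W q -> 'D_v (Y i) q =
  pd [:: jd1] (Y i) q * (v 0 jd1 - F1 q * v 0 jt) + pd [:: jd2] (Y i) q * (v 0 jd2 - F2 q * v 0 jt)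
  + pd [:: jx1] (Y i) q * (v 0 jx1 - q 0 jd1 * v 0 jt) + pd [:: jx2] (Y i) q * (v 0 jx2 - q 0 jd2 * v 0 jt).
Proof.
move=> i3 Wq; have dy := YH i Wq; have := dY i3 Wq.
have E w : 'D_w (Y i) q = w 0 jt * pd [:: jt] (Y i) q + w 0 jx1 * pd [:: jx1] (Y i) q
    + w 0 jx2 * pd [:: jx2] (Y i) q + w 0 jd1 * pd [:: jd1] (Y i) q + w 0 jd2 * pd [:: jd2] (Y i) q.
  by rewrite deriveE// (gradE dy) dotc5.
rewrite !E.
have al (a0 a1 a2 a3 a4 w0 w1 w2 w3 w4 : C) :
  dv q 0 jt * a0 + dv q 0 jx1 * a1 + dv q 0 jx2 * a2 + dv q 0 jd1 * a3 + dv q 0 jd2 * a4 = 0 ->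
  w0 * a0 + w1 * a1 + w2 * a2 + w3 * a3 + w4 * a4 = a3 * (w3 - F1 q * w0) + a4 * (w4 - F2 q * w0)
    + a1 * (w1 - q 0 jd1 * w0) + a2 * (w2 - q 0 jd2 * w0).
  rewrite /dv !mxE /= => e0; rewrite -[LHS]subr0 -(mulr0 w0) -e0; ring.
exact: al.
Qed.

(** As the new velocities are constant along the old solutions, their differentials have no [dt]
    term in the old coframe. So the partial derivatives themselves serve as coefficients, and the
    target system is flat. *)
Lemma straightened : point_equivalent_at U F1 F2 setT (fun=> 0) (fun=> 0) p.
Proof.
exists V, phi, W, coef; split=> //; first by move=> q /WU[Uq Vq T0]; split.
move=> q v Wq; have [_ Vq T0] := WU Wq; rewrite coframe_mul.
have dE := prolong_diff v Wq.
apply/colP => i; rewrite [LHS]mxE [RHS]mxE.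
have g0 := f_diff 0 v Vq; have g1 := f_diff 1 v Vq; have g2 := f_diff 2 v Vq.
have y1 := @Y_diff 1 q v isT Wq; have y2 := @Y_diff 2 q v isT Wq.
have al (k : nat) (x y : C) : x = m k 1%N q * (v 0 jx1 - q 0 jd1 * v 0 jt) +
      m k 2%N q * (v 0 jx2 - q 0 jd2 * v 0 jt) + T k q * v 0 jt ->
    y = m 0%N 1%N q * (v 0 jx1 - q 0 jd1 * v 0 jt) +
      m 0%N 2%N q * (v 0 jx2 - q 0 jd2 * v 0 jt) + T 0%N q * v 0 jt ->
    x - Y k q * y = b k 1%N q * (v 0 jx1 - q 0 jd1 * v 0 jt) + b k 2%N q * (v 0 jx2 - q 0 jd2 * v 0 jt).
  move=> -> ->; rewrite /b /Y; move: T0.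
  move: (m k 1%N q) (m k 2%N q) (m 0%N 1%N q) (m 0%N 2%N q) (T k q) (T 0%N q) => a1 a2 a3 a4 t t0 ?.
  by field.
have ed1 (z : jet) : prolong phi z 0 jd1 = Y 1%N z by exact: pE.
have ed2 (z : jet) : prolong phi z 0 jd2 = Y 2%N z by exact: pE.
have z0 (x c y : C) : x = y -> x - 0 * c = y by move=> ->; rewrite mul0r subr0.
case: i => -[|[|[|[|[|//]]]]] ?; rewrite [LHS]/= [RHS]/=.
- exact: z0 (etrans (dE jd1) y1).
- exact: z0 (etrans (dE jd2) y2).
- rewrite ed1; exact: (al 1%N _ _ (etrans (dE jx1) g1) (etrans (dE jt) g0)).
- rewrite ed2; exact: (al 2%N _ _ (etrans (dE jx2) g2) (etrans (dE jt) g0)).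
- exact: etrans (dE jt) g0.
Qed.
End Structure.

Section OpenSets.
Variable R : realType.
Local Notation C := (Cplx R).

Lemma open_neq0 n (E : set 'rV[C]_n) (f : 'rV[C]_n -> C) : open E -> holomorphic_on E f ->
  open (E `&` [set x | f x != 0]).
Proof.
move=> oE fE; apply/nm_openP => x [Ex fx0].
have [r r0 rE] := (nm_openP E).1 oE x Ex.
have fx : 0 < nm (f x : C) by rewrite nm_gt0.
have [d d0 dP] := fd_cont (diff_fd (fE x Ex)) fx.
exists (Num.min r d); first by rewrite lt_min r0.
move=> z; rewrite lt_min => /andP[zr zd]; split; first exact: rE.
apply/eqP => fz0; have := dP z zd.
by rewrite fz0 sub0r nmN ltxx.
Qed.

Lemma open_jet_base (V : set 'rV[C]_3) : open V -> open [set q : 'rV[C]_5 | V (jet_base q)].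
Proof.
move=> oV; apply/nm_openP => q Vq; have [r r0 rV] := (nm_openP V).1 oV _ Vq.
exists r => // z zr; apply: rV; apply: le_lt_trans zr.
by rewrite -jet_baseB; exact: nm_jet_base.
Qed.
End OpenSets.

(** * Parallel frames of the tractor connection *)

Section Frame.
Variable R : realType.
Local Notation C := (Cplx R).
Local Notation base := 'rV[C]_3.
Local Notation jet := 'rV[C]_5.
Variables (D : set base) (g : nat -> nat -> nat -> base -> C).
Hypothesis oD : open D.
Hypothesis gH : forall c a b, holomorphic_on D (g c a b).
Hypothesis gS : forall c a b x, D x -> g c a b x = g c b a x.
Hypothesis gT : forall a x, D x -> \sum_(c < 3) g c c a x = 0.
Hypothesis gW : forall (c d a b : 'I_3) x, D x ->
  riem_at g x c d a b = (c == a)%:R * schouten g b d x - (c == b)%:R * schouten g a d x.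

(** Unit initial values are chosen so that the later coordinate map has identity Jacobian at
    [x0]. *)
Lemma tractor_frame x0 : D x0 -> exists (E : set base) (s : nat -> base -> C) (mu : nat -> nat -> base -> C),
  [/\ open E, E x0, E `<=` D &
   forall m, (m < 4)%N -> [/\ holomorphic_on E (s m), forall b, holomorphic_on E (mu m b),
     s m x0 = (m == 0%N)%:R, forall b, (b < 3)%N -> mu m b x0 = (m == b.+1)%:R &
     forall x a, E x -> (a < 3)%N -> pd [:: bi a] (s m) x = mu m a x /\
       forall b, (b < 3)%N -> pd [:: bi a] (mu m b) x =
         - schouten g a b x * s m x + \sum_(c < 3) g c a b x * mu m c x]].
Proof.
move=> Dx0.
have [r h] := ex_choice (fun m : 'I_4 => flat_system (fun i => (i == m)%:R) oD Dx0
   (fun a i j => @tractor_hol _ D g oD gH a i j)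
   (fun x a b i j Dx => tractor_flat oD gH gS gT gW a b i j Dx)).
have [X hX] := ex_choice h.
have r0 m : 0 < (r m)^-1 :> R by rewrite invr_gt0; have [] := hX m.
(* [S^-1] is below each of the four radii [r m]. *)
pose S := \sum_m (r m)^-1.
have rS m : (r m)^-1 <= S by rewrite /S (bigD1 m)//= lerDl sumr_ge0// => k _; exact: ltW.
have S0 : 0 < S := lt_le_trans (r0 ord0) (rS ord0).
have sub m x : bl x0 S^-1 x -> bl x0 (r m) x.
  move=> h1; apply: (lt_le_trans h1); rewrite -[leRHS]invrK lef_pV2//.
  by rewrite posrE.
exists (bl x0 S^-1), (fun m => X (inord m) ord0), (fun m b => X (inord m) (inord b.+1)).
split; [exact: bl_open|by apply: bl_center; rewrite invr_gt0| |].
  by move=> x /(sub ord0); have [_ h1 _ _ _] := hX ord0; exact: h1.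
move=> m m4; have [_ _ hol ini der] := hX (inord m).
split.
- by move=> x /(sub (inord m)); exact: hol.
- by move=> b x /(sub (inord m)); exact: hol.
- by rewrite ini -val_eqE /= inordK// eq_sym.
- by move=> b b3; rewrite ini -val_eqE /= !inordK// eq_sym.
move=> x a /(sub (inord m)) Ex a3; split.
  rewrite der//.
  transitivity (\sum_(j < 4) (j == (inord a.+1 : 'I_4))%:R * X (inord m) j x).
    apply: eq_bigr => j _; congr (_%:R * _).
    rewrite -val_eqE /= inordK//; congr (_ == _.+1).
    by case: a a3 => [|[|[|]]].
  rewrite (bigD1 (inord a.+1))//= eqxx mul1r big1 ?addr0// => j /negPf ->.
  by rewrite mul0r.
move=> b b3; rewrite der// big_ord_recl.
have aE : bi a = a :> nat by case: a a3 => [|[|[|]]].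
rewrite inordK// aE; congr (_ + _); apply: eq_bigr => c _; rewrite lift0.
congr (_ * X _ _ x); apply: val_inj => /=; by rewrite inordK// ltnS.
Qed.
End Frame.

(** The scalar equation [s'' = g^0(u,u) s' - P(u,u) s] along a solution: the terms [mu_c g^c(u,u)]
    coming from [d mu] cancel against those of the geodesic acceleration. *)
Lemma frame_acceleration (K : comPzRingType) (u mu : nat -> K) (P : nat -> nat -> K) (g : nat -> nat -> nat -> K) s :
  \sum_(b < 3) (u b * (\sum_(a < 3) u a * (- P a b * s + \sum_(c < 3) g c a b * mu c))
     + mu b * (u b * quadr g u 0%N - quadr g u b)) =
  - (\sum_(a < 3) \sum_(b < 3) u a * u b * P a b) * s + quadr g u 0%N * \sum_(b < 3) u b * mu b.
Proof.
by rewrite /quadr !big_ord_recl !big_ord0 /= /bump /= ?addn0 ?addn1; ring.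
Qed.

(** * Constancy of the new velocities *)

Section Straighten.
Variable R : realType.
Local Notation C := (Cplx R).
Local Notation base := 'rV[C]_3.
Local Notation jet := 'rV[C]_5.
Implicit Types (p q v : jet).
Variables (D : set base) (g : nat -> nat -> nat -> base -> C).
Hypothesis gH : forall c a b, holomorphic_on D (g c a b).
Variables (E : set base) (s : nat -> base -> C) (mu : nat -> nat -> base -> C) (P : nat -> nat -> base -> C).
Hypothesis oE : open E.
Hypothesis ED : E `<=` D.
Hypothesis sH : forall k, (k < 4)%N -> holomorphic_on E (s k).
Hypothesis muH : forall k b, (k < 4)%N -> holomorphic_on E (mu k b).
Hypothesis ds : forall k x a, (k < 4)%N -> E x -> (a < 3)%N -> pd [:: bi a] (s k) x = mu k a x.
Hypothesis dmu : forall k x a b, (k < 4)%N -> E x -> (a < 3)%N -> (b < 3)%N ->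
  pd [:: bi a] (mu k b) x = - P a b x * s k x + \sum_(c < 3) g c a b x * mu k c x.

Local Notation G q := (val_at g (jet_base q)).
Let S k q := s k (jet_base q).
Let M k q := \sum_(b < 3) vel q b * mu k b (jet_base q).

Variables (F1 F2 : jet -> C).
Let dv (q : jet) : jet := \row_i nth 0 [:: 1; q 0 jd1; q 0 jd2; F1 q; F2 q] i.

Let dvx q d : (d < 3)%N -> dv q 0 (jx d) = vel q d.
Proof. by case: d => [|[|[|//]]] _; rewrite mxE. Qed.

Let S_hol k q : (k < 4)%N -> E (jet_base q) -> differentiable (S k) q.
Proof. by move=> k4 Eq; apply: diff_jb; exact: sH. Qed.

Let M_hol k q : (k < 4)%N -> E (jet_base q) -> differentiable (M k) q.
Proof.
move=> k4 Eq; apply: diff_sum => b; apply: differentiableM; first exact: diff_vel.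
by apply: diff_jb; exact: muH.
Qed.

Let DS k q : (k < 4)%N -> E (jet_base q) -> 'D_(dv q) (S k) q = M k q.
Proof.
move=> k4 Eq; rewrite (deriv_jb _ (sH k4 Eq)); apply: eq_bigr => d _.
by rewrite dvx// ds.
Qed.

Let DM k q : (k < 4)%N -> E (jet_base q) ->
  F1 q = geo (G q) (vel q) 1%N -> F2 q = geo (G q) (vel q) 2%N ->
  'D_(dv q) (M k) q = - (\sum_(a < 3) \sum_(b < 3) vel q a * vel q b * P a b (jet_base q)) * S k q
    + quadr (G q) (vel q) 0%N * M k q.
Proof.
move=> k4 Eq e1 e2; set x := jet_base q.
have mh b : differentiable (fun q => mu k b (jet_base q)) q by apply: diff_jb; exact: muH.
have vh d := diff_vel q d.
have dvd d : (d < 3)%N -> dvel (dv q) d = vel q d * quadr (G q) (vel q) 0%N - quadr (G q) (vel q) d.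
  by case: d => [|[|[|//]]] _; rewrite /dvel /= ?mxE /= ?e1 ?e2// /vel /= mul1r subrr.
rewrite deriv_sum; last by move=> b; apply: differentiableM.
transitivity (\sum_(b < 3) (vel q b * (\sum_(a < 3) vel q a * (- P a b x * s k x + \sum_(c < 3) g c a b x * mu k c x))
  + mu k b x * (vel q b * quadr (G q) (vel q) 0%N - quadr (G q) (vel q) b))).
  apply: eq_bigr => b _; rewrite (derivM _ (vh b) (mh b)) deriv_vel dvd//; congr (_ * _ + _).
  rewrite (deriv_jb _ (muH b k4 Eq)); apply: eq_bigr => a _.
  by rewrite dvx// dmu.
exact: (frame_acceleration (vel q) (fun c => mu k c x) (fun a b => P a b x) (G q) (s k x)).
Qed.

(** Wronskian of [s k.+1] and [s 0] along a solution, [M] being the derivative of [S]; the terms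
    with [P] drop out of its derivative. *)
Let w k q := M k.+1 q * S 0%N q - S k.+1 q * M 0%N q.

Let w_hol k q : (k < 3)%N -> E (jet_base q) -> differentiable (w k) q.
Proof.
move=> k3 Eq; have k4 : (k.+1 < 4)%N by [].
have m1 := M_hol k4 Eq; have s1 := S_hol k4 Eq.
have m0 := @M_hol 0 q isT Eq; have s0 := @S_hol 0 q isT Eq.
by apply: differentiableB; exact: differentiableM.
Qed.

Let Dw k q : (k < 3)%N -> E (jet_base q) ->
  F1 q = geo (G q) (vel q) 1%N -> F2 q = geo (G q) (vel q) 2%N ->
  'D_(dv q) (w k) q = quadr (G q) (vel q) 0%N * w k q.
Proof.
move=> k3 Eq e1 e2; have k4 : (k.+1 < 4)%N by [].
have m1 := M_hol k4 Eq; have s1 := S_hol k4 Eq.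
have m0 := @M_hol 0 q isT Eq; have s0 := @S_hol 0 q isT Eq.
have p1 : differentiable (fun q => M k.+1 q * S 0%N q) q by exact: differentiableM.
have p2 : differentiable (fun q => S k.+1 q * M 0%N q) q by exact: differentiableM.
have a1 := DS k4 Eq; have a2 := DM k4 Eq e1 e2.
have b1 := @DS 0 q isT Eq; have b2 := @DM 0 q isT Eq e1 e2.
rewrite (derivB _ p1 p2) (derivM _ m1 s0) (derivM _ s1 m0) a1 a2 b1 b2 /w.
by move: (\sum_(a < 3) _) (quadr _ _ _) (M k.+1 q) (M 0%N q) (S k.+1 q) (S 0%N q) => *; ring.
Qed.

Lemma frame_straight k q : (k < 3)%N -> E (jet_base q) -> w 0%N q != 0 ->
  F1 q = geo (G q) (vel q) 1%N -> F2 q = geo (G q) (vel q) 2%N ->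
  'D_(dv q) (fun q => w k q / w 0%N q) q = 0.
Proof.
move=> k3 Eq w0 e1 e2; have wk := w_hol k3 Eq; have wz := @w_hol 0 q isT Eq.
have wV : differentiable (fun q => (w 0%N q)^-1) q by exact: differentiableV.
have dk := Dw k3 Eq e1 e2; have dz := @Dw 0 q isT Eq e1 e2.
have dV : 'D_(dv q) (fun q => (w 0%N q)^-1) q = - (w 0%N q)^-1 ^+ 2 * 'D_(dv q) (w 0%N) q.
  exact: derivV.
rewrite (derivM _ wk wV) dV dk dz.
by move: (w k q) (w 0%N q) (quadr _ _ _) w0 => *; field.
Qed.

(** Consequently the new velocities, which are quotients of total derivatives, are the [w k / w 0]
    of [frame_straight]. *)
Lemma total_deriv_frame k q : (k < 3)%N -> E (jet_base q) -> S 0%N q != 0 ->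
  total_deriv (fun x => s k.+1 x / s 0%N x) q = w k q / S 0%N q ^+ 2.
Proof.
move=> k3 Eq s0; have k4 : (k.+1 < 4)%N by [].
rewrite total_derivE.
have E1 d : (d < 3)%N -> pd [:: bi d] (fun x => s k.+1 x / s 0%N x) (jet_base q) =
    (mu k.+1 d (jet_base q) * S 0%N q - S k.+1 q * mu 0%N d (jet_base q)) / S 0%N q ^+ 2.
  move=> d3; have sk := sH k4 Eq; have sz := @sH 0%N isT _ Eq.
  have sV : differentiable (fun x => (s 0%N x)^-1) (jet_base q) by exact: differentiableV.
  have al (x y z a b t c : C) : c != 0 -> x = - c^-1 ^+ 2 * z -> z = b -> y = a ->
      t * x + c^-1 * y = (a * c - t * b) / c ^+ 2.
    by move=> c0 -> -> ->; field.
  apply: etrans (pdM (bi d) sk sV) _.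
  exact: (al _ _ _ _ _ _ _ s0 (pdV (bi d) s0 sz) (@ds 0%N _ d isT Eq d3) (ds k4 Eq d3)).
transitivity (\sum_(d < 3) vel q d * ((mu k.+1 d (jet_base q) * S 0%N q - S k.+1 q * mu 0%N d (jet_base q)) / S 0%N q ^+ 2)).
  by apply: eq_bigr => d _; rewrite E1.
rewrite /w /M mulr_suml mulr_sumr -sumrB mulr_suml; apply: eq_bigr => d _.
by move: (vel q d) (mu _ _ _) (mu _ _ _) (S _ _) (S _ _) s0 => *; field.
Qed.
End Straighten.

(** * The linearizing coordinates *)

Section Construct.
Variable R : realType.
Local Notation C := (Cplx R).
Local Notation base := 'rV[C]_3.
Local Notation jet := 'rV[C]_5.
Implicit Types (p q v : jet).
Variables (D : set base) (g : nat -> nat -> nat -> base -> C).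
Hypothesis oD : open D.
Hypothesis gH : forall c a b, holomorphic_on D (g c a b).
Hypothesis gS : forall c a b x, D x -> g c a b x = g c b a x.
Hypothesis gT : forall a x, D x -> \sum_(c < 3) g c c a x = 0.
Hypothesis gW : forall (c d a b : 'I_3) x, D x ->
  riem_at g x c d a b = (c == a)%:R * schouten g b d x - (c == b)%:R * schouten g a d x.
Local Notation G q := (val_at g (jet_base q)).

Lemma flat_connection_equivalent (U W : set jet) (F1 F2 : jet -> C) p :
  open W -> W p -> W `<=` U -> (forall q, W q -> D (jet_base q)) ->
  (forall q, W q -> F1 q = geo (G q) (vel q) 1%N) ->
  (forall q, W q -> F2 q = geo (G q) (vel q) 2%N) ->
  point_equivalent_at U F1 F2 setT (fun=> 0) (fun=> 0) p.
Proof.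
move=> oW Wp WU WD e1 e2.
have [E [s [mu [oE Ep ED h]]]] := tractor_frame oD gH gS gT gW (WD p Wp).
have sH k : (k < 4)%N -> holomorphic_on E (s k) by move=> /h[].
have muH k b : (k < 4)%N -> holomorphic_on E (mu k b) by move=> /h[].
have ds k x a : (k < 4)%N -> E x -> (a < 3)%N -> pd [:: bi a] (s k) x = mu k a x.
  by move=> /h[_ _ _ _ d] Ex a3; have [] := d x a Ex a3.
have dmu k x a b : (k < 4)%N -> E x -> (a < 3)%N -> (b < 3)%N ->
    pd [:: bi a] (mu k b) x = - schouten g a b x * s k x + \sum_(c < 3) g c a b x * mu k c x.
  by move=> /h[_ _ _ _ d] Ex a3 b3; have [_] := d x a Ex a3; apply.
have s_ini k : (k < 4)%N -> s k (jet_base p) = (k == 0%N)%:R by move=> /h[].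
have mu_ini k b : (k < 4)%N -> (b < 3)%N -> mu k b (jet_base p) = (k == b.+1)%:R.
  by move=> /h[_ _ _ i _]; exact: i.
pose E0 := E `&` [set x | s 0%N x != 0].
have oE0 : open E0 by apply: open_neq0 => //; exact: sH.
have E0p : E0 (jet_base p) by split => //=; rewrite s_ini// oner_neq0.
pose phi (x : base) : base := \row_k (s k.+1 x / s 0%N x).
have phiE k : (fun x => phi x 0 k : C) = fun x => s k.+1 x / s 0%N x.
  by apply/funext => x; rewrite mxE.
have phiH k : holomorphic_on E0 (fun x => phi x 0 k : C).
  move=> x [Ex x0]; rewrite phiE.
  have sk : differentiable (s k.+1) x by apply: sH => //; exact: ltn_ord k.
  have sz : differentiable (s 0%N) x by apply: sH.
  by apply: differentiableM => //; exact: differentiableV.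
(* At the base point [s 0 = 1], [s k.+1 = 0] and the [mu] are unit vectors, so the Jacobian is the
   identity, as [inverse_function] requires. *)
have dphi k a : pd [:: a] (fun x => phi x 0 k : C) (jet_base p) = (a == k)%:R.
  rewrite phiE -{1}(bi_id a).
  have k4 : (k.+1 < 4)%N by exact: ltn_ord k.
  have sk : differentiable (s k.+1) (jet_base p) by apply: sH.
  have sz : differentiable (s 0%N) (jet_base p) by apply: sH.
  have sV : differentiable (fun x => (s 0%N x)^-1) (jet_base p).
    by apply: differentiableV => //; rewrite s_ini// oner_neq0.
  have s0 : s 0%N (jet_base p) != 0 by rewrite s_ini// oner_neq0.
  have al (x y b t c : C) : c = 1 -> t = 0 -> y = b -> t * x + c^-1 * y = b.
    by move=> -> -> ->; rewrite mul0r add0r invr1 mul1r.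
  apply: etrans (pdM (bi a) sk sV) _.
  apply: etrans (al _ _ _ _ _ (s_ini 0%N isT) (s_ini k.+1 k4) (ds k.+1 _ a k4 Ep (ltn_ord a))) _.
  by rewrite mu_ini// eqSS eq_sym.
have [V [oV Vp VE oI inv]] := inverse_function oE0 E0p phiH (fun a k => dphi k a).
have biV : biholomorphic_on V phi.
  split => // x Vx; apply: diff_rowP => k; apply: phiH; exact: VE.
have fE k : (k < 3)%N -> (fun x => phi x 0 (bi k) : C) = fun x => s k.+1 x / s 0%N x.
  by case: k => [|[|[|//]]] _; exact: phiE.
pose w k q := (\sum_(b < 3) vel q b * mu k.+1 b (jet_base q)) * s 0%N (jet_base q)
  - s k.+1 (jet_base q) * \sum_(b < 3) vel q b * mu 0%N b (jet_base q).
pose T k q := total_deriv (fun x => phi x 0 (bi k) : C) q.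
have TE k q : (k < 3)%N -> V (jet_base q) -> T k q = w k q / s 0%N (jet_base q) ^+ 2.
  move=> k3 /VE[Eq s0]; rewrite /T fE//.
  exact: (total_deriv_frame sH ds k3 Eq s0).
pose W0 := W `&` [set q | V (jet_base q)].
have oW0 : open W0 by apply: openI => //; exact: open_jet_base.
have T0H : holomorphic_on W0 (T 0%N).
  move=> q [_ Vq].
  have -> : T 0%N = fun q => \sum_(d < 3) vel q d * pd [:: bi d] (fun x => phi x 0 (bi 0%N) : C) (jet_base q).
    by apply/funext => z; exact: total_derivE.
  apply: diff_sum => d; apply: differentiableM; first exact: diff_vel.
  apply: diff_jb.
  exact: (@holo_pd _ _ E0 _ (bi d) oE0 (phiH (bi 0%N)) _ (VE _ Vq)).
(* Only the time component [vel p 0 = 1] survives, so the new time is transversal to the solution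
   whatever the velocity of [p]. *)
have wp : w 0%N p = 1.
  rewrite /w !s_ini//= mulr1 mul0r subr0.
  rewrite (sum3nat (fun b => vel p b * mu 1%N b (jet_base p))) !mu_ini//=.
  by rewrite !mulr0 !addr0 mulr1.
have T0p : T 0%N p != 0.
  by rewrite TE// wp s_ini//= expr1n invr1 mulr1 oner_neq0.
pose W1 := W0 `&` [set q | T 0%N q != 0].
have oW1 : open W1 by exact: open_neq0.
apply: (@straightened R V phi W1 U F1 F2 p biV oW1 _ _ _).
- by split.
- by move=> q [[Wq Vq] Tq]; split => //; exact: WU.
move=> i q /andP[_ i3] W1q; have [[Wq Vq] Tq] := W1q; have [Eq s0] := VE _ Vq.
have w0 : w 0%N q != 0.
  by move: Tq; rewrite /= TE// mulf_eq0 negb_or => /andP[].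
apply: etrans (frame_straight sH muH ds dmu i3 Eq w0 (e1 _ Wq) (e2 _ Wq)).
apply: (eq_deriv _ oW1 W1q) => z [[_ Vz] Tz]; have [_ sz] := VE _ Vz.
have al (x y a b c : C) : c != 0 -> x = a / c -> y = b / c -> b != 0 -> x / y = a / b.
  by move=> c0 -> -> b0; field; rewrite b0.
have wz : w 0%N z != 0.
  by move: Tz; rewrite /= TE// mulf_eq0 negb_or => /andP[].
apply: (al _ _ _ _ (s 0%N (jet_base z) ^+ 2)); [by rewrite expf_neq0|exact: TE|exact: TE|exact: wz].
Qed.
End Construct.

(** * Necessity *)

Lemma delta_sum (K : pzSemiRingType) n (k : 'I_n) (F : 'I_n -> K) : \sum_l (k == l)%:R * F l = F k.
Proof.
rewrite (bigD1 k)//= eqxx mul1r big1 ?addr0// => l /negPf.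
by rewrite eq_sym => ->; rewrite mul0r.
Qed.

(** * The flat connection pulled back along a transformation *)

Section Necessity.
Variable R : realType.
Local Notation C := (Cplx R).
Local Notation base := 'rV[C]_3.
Local Notation jet := 'rV[C]_5.

Variables (V : set base) (f : 'I_3 -> base -> C) (N : 'I_3 -> 'I_3 -> base -> C).
Hypothesis oV : open V.
Hypothesis fH : forall k, holomorphic_on V (f k).
Hypothesis NH : forall c k, holomorphic_on V (N c k).
Hypothesis NM : forall x c a, V x -> \sum_k N c k x * pd [:: a] (f k) x = (c == a)%:R.
Hypothesis MN : forall x k l, V x -> \sum_c pd [:: c] (f k) x * N c l x = (k == l)%:R.

(** Christoffel symbols of the flat connection in the old coordinates, [N] being the inverse
    Jacobian. *)
Definition pullback_conn (c a b : nat) x : C :=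
  \sum_k N (bi c) k x * pd [:: bi a; bi b] (f k) x.
Local Notation g := pullback_conn.

Let f1 a k : holomorphic_on V (pd [:: a] (f k)).
Proof. exact: (@holo_pd _ _ V _ a oV (@fH k)). Qed.

Let f2 a b k : holomorphic_on V (pd [:: a; b] (f k)).
Proof. exact: (@holo_pd _ _ V _ b oV (@f1 a k)). Qed.

Lemma pullback_hol c a b : holomorphic_on V (g c a b).
Proof.
move=> x Vx; apply: diff_sum => k; apply: differentiableM; first exact: NH.
exact: f2.
Qed.

Lemma pullback_sym c a b x : V x -> g c a b x = g c b a x.
Proof. by move=> Vx; apply: eq_bigr => k _; rewrite (pd_comm (bi a) (bi b) oV (@fH k) Vx). Qed.

Lemma pullback_hess k a b x : V x -> \sum_(c < 3) pd [:: c] (f k) x * g c a b x = pd [:: bi a; bi b] (f k) x.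
Proof.
move=> Vx.
transitivity (\sum_(l < 3) (\sum_(c < 3) pd [:: c] (f k) x * N c l x) * pd [:: bi a; bi b] (f l) x).
  transitivity (\sum_(c < 3) \sum_(l < 3) pd [:: c] (f k) x * N c l x * pd [:: bi a; bi b] (f l) x).
    apply: eq_bigr => c _; rewrite /g mulr_sumr bi_id; apply: eq_bigr => l _; exact: mulrA.
  by rewrite exchange_big /=; apply: eq_bigr => l _; rewrite mulr_suml.
transitivity (\sum_(l < 3) (k == l)%:R * pd [:: bi a; bi b] (f l) x).
  by apply: eq_bigr => l _; rewrite (MN k l Vx).
exact: (delta_sum k (fun l => pd [:: bi a; bi b] (f l) x)).
Qed.

(** One more derivative of [pullback_hess]. Third derivatives are symmetric, so exchanging two
    indices turns this formula into the vanishing of the curvature. *)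
Let Md k a b e x : V x ->
  \sum_(l < 3) pd [:: l] (f k) x * (der_at g x e l a b + \sum_(c < 3) g l e c x * g c a b x)
  = pd [:: bi a; bi b; bi e] (f k) x.
Proof.
move=> Vx.
have h1 c := f1 c k Vx; have h2 c := pullback_hol c a b Vx.
transitivity (pd [:: bi e] (fun y => \sum_(c < 3) pd [:: c] (f k) y * g c a b y) x); last first.
  by apply: (@eq_pd _ _ V) => // y Vy; exact: pullback_hess.
rewrite pd_sum; last by move=> c; apply: differentiableM.
transitivity (\sum_(c < 3) (pd [:: c] (f k) x * der_at g x e c a b + g c a b x * pd [:: c; bi e] (f k) x)); last first.
  by apply: eq_bigr => c _; apply: esym; exact: (pdM (bi e) (h1 c) (h2 c)).
transitivity (\sum_(c < 3) pd [:: c] (f k) x * der_at g x e c a b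
   + \sum_(c < 3) g c a b x * \sum_(l < 3) pd [:: l] (f k) x * g l c e x); last first.
  rewrite -big_split; apply: eq_bigr => c _; congr (_ + _ * _).
  by have /esym := pullback_hess k c e Vx; rewrite (bi_id c).
transitivity (\sum_(c < 3) pd [:: c] (f k) x * der_at g x e c a b
   + \sum_(l < 3) \sum_(c < 3) pd [:: l] (f k) x * g l e c x * g c a b x).
  rewrite -big_split; apply: eq_bigr => l _ /=; rewrite mulrDr; congr (_ + _).
  by rewrite mulr_sumr; apply: eq_bigr => c _; rewrite mulrA.
congr (_ + _); rewrite exchange_big /=; apply: eq_bigr => c _; rewrite mulr_sumr.
apply: eq_bigr => l _; rewrite (pullback_sym l c e Vx).
by rewrite mulrC.
Qed.

Lemma pullback_flat (c d a b : 'I_3) x : V x -> riem_at g x c d a b = 0.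
Proof.
move=> Vx.
have M0 k : \sum_(l < 3) pd [:: l] (f k) x * riem_at g x l d a b = 0.
  have cm : pd [:: bi b; bi d; bi a] (f k) x = pd [:: bi a; bi d; bi b] (f k) x.
    have hb := @f1 (bi b) k; have ha := @f1 (bi a) k.
    transitivity (pd [:: bi b; bi a; bi d] (f k) x).
      exact: (pd_comm (bi d) (bi a) oV hb Vx).
    transitivity (pd [:: bi a; bi b; bi d] (f k) x); last exact: (pd_comm (bi b) (bi d) oV ha Vx).
    apply: (@eq_pd _ _ V [:: bi d] (pd [:: bi b; bi a] (f k)) (pd [:: bi a; bi b] (f k)) x oV Vx) => y Vy.
    exact: (pd_comm (bi b) (bi a) oV (@fH k) Vy).
  transitivity (pd [:: bi b; bi d; bi a] (f k) x - pd [:: bi a; bi d; bi b] (f k) x); last by rewrite cm subrr.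
  rewrite -(Md k b d a Vx) -(Md k a d b Vx) -sumrB; apply: eq_bigr => l _.
  rewrite /riem_at /riem sumrB -mulrBr /val_at; congr (_ * _).
  rewrite !opprD !addrA; congr (_ + _); rewrite -!addrA; congr (_ + _); exact: addrC.
transitivity (\sum_(l < 3) (c == l)%:R * riem_at g x l d a b).
  exact: esym (delta_sum c (fun l => riem_at g x l d a b)).
transitivity (\sum_k N c k x * \sum_(l < 3) pd [:: l] (f k) x * riem_at g x l d a b); last first.
  by rewrite big1// => k _; rewrite M0 mulr0.
transitivity (\sum_(l < 3) \sum_k N c k x * pd [:: l] (f k) x * riem_at g x l d a b).
  by apply: eq_bigr => l _; rewrite -(NM c l Vx) mulr_suml.
rewrite exchange_big /=; apply: eq_bigr => k _; rewrite mulr_sumr; apply: eq_bigr => l _.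
by rewrite mulrA.
Qed.
End Necessity.

(** A straight image means that the new acceleration [m (q + acc)] is parallel to the new velocity
    [m u]. As [m] is invertible, [q + acc = l * u], and the time component, with [u 0 = 1] and
    [acc 0 = 0], gives [l = q 0]. *)
Lemma geo_of_straight (K : fieldType) (m : nat -> nat -> K) (n : nat -> nat -> K) (q u acc : nat -> K) (t : nat -> K) :
  (forall c a, (c < 3)%N -> (a < 3)%N -> \sum_(k < 3) n c k * m k a = (c == a)%:R) ->
  u 0%N = 1 -> acc 0%N = 0 -> t 0%N != 0 ->
  (forall k, (k < 3)%N -> t k = \sum_(a < 3) u a * m k a) ->
  (forall k, (k < 3)%N -> t k * \sum_(a < 3) m 0%N a * (q a + acc a) = t 0%N * \sum_(a < 3) m k a * (q a + acc a)) ->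
  forall i, (i < 3)%N -> acc i = u i * q 0%N - q i.
Proof.
move=> nm u0 a0 t0 tE h.
pose l := (\sum_(a < 3) m 0%N a * (q a + acc a)) / t 0%N.
have hk k : (k < 3)%N -> \sum_(a < 3) m k a * (q a + acc a - l * u a) = 0.
  move=> k3; transitivity (\sum_(a < 3) m k a * (q a + acc a) - l * t k).
    rewrite tE// mulr_sumr -sumrB; apply: eq_bigr => a _; ring.
  apply: (mulfI t0); rewrite mulrBr -h// /l mulr0.
  by move: (\sum_(a < 3) _) => s; field.
have e c : (c < 3)%N -> q c + acc c - l * u c = 0.
  move=> c3; transitivity (\sum_(a < 3) (\sum_(k < 3) n c k * m k a) * (q a + acc a - l * u a)).
    transitivity (\sum_(a < 3) (Ordinal c3 == a)%:R * (q a + acc a - l * u a)).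
      by rewrite (delta_sum (Ordinal c3) (fun a : 'I_3 => q a + acc a - l * u a)).
    by apply: eq_bigr => a _; rewrite nm.
  transitivity (\sum_(k < 3) n c k * \sum_(a < 3) m k a * (q a + acc a - l * u a)).
    transitivity (\sum_(a < 3) \sum_(k < 3) n c k * m k a * (q a + acc a - l * u a)).
      by apply: eq_bigr => a _; rewrite mulr_suml.
    rewrite exchange_big /=; apply: eq_bigr => k _; rewrite mulr_sumr.
    by apply: eq_bigr => a _; rewrite mulrA.
  by rewrite big1// => k _; rewrite hk// mulr0.
have l0 : q 0%N = l by apply: subr0_eq; rewrite -[RHS](e 0%N isT) a0 u0 addr0 mulr1.
move=> i i3; rewrite l0; apply/eqP; rewrite -subr_eq0; apply/eqP.
rewrite -[RHS](e i i3); ring.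
Qed.

Lemma hess_quadr (K : comPzRingType) (u m acc : nat -> K) (g : nat -> nat -> nat -> K) :
  \sum_(d < 3) (u d * (\sum_(e < 3) u e * \sum_(c < 3) m c * g c d e) + m d * acc d)
  = \sum_(c < 3) m c * (quadr g u c + acc c).
Proof. by rewrite /quadr !big_ord_recl !big_ord0 /= /bump /= ?addn0 ?addn1; ring. Qed.

(** * From equivalence to the identities *)

Section NecessityMain.
Variable R : realType.
Local Notation C := (Cplx R).
Local Notation base := 'rV[C]_3.
Local Notation jet := 'rV[C]_5.

Lemma equivalent_geodesic (U : set jet) (F1 F2 : jet -> C) p :
  point_equivalent_at U F1 F2 setT (fun=> 0) (fun=> 0) p ->
  exists (V : set base) (g : nat -> nat -> nat -> base -> C) (W : set jet),
   [/\ open V, open W, W p, forall q, W q -> V (jet_base q) &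
   [/\ forall c a b, holomorphic_on V (g c a b),
     forall c a b x, V x -> g c a b x = g c b a x,
     forall (c d a b : 'I_3) x, V x -> riem_at g x c d a b = 0,
     forall q, W q -> F1 q = geo (val_at g (jet_base q)) (vel q) 1%N &
     forall q, W q -> F2 q = geo (val_at g (jet_base q)) (vel q) 2%N]].
Proof.
case=> V [phi [W [st [biV [oW Wp] WU _ co]]]].
have [oV _ phiH _] := biV.
have [N [NH NM MN]] := inverse_jacobian biV.
have fH k : holomorphic_on V (fun x => phi x 0 k : C).
  by move=> x Vx; apply: diff_coord; exact: phiH.
pose g := pullback_conn (fun k x => phi x 0 k : C) N.
exists V, g, W; split; [exact: oV|exact: oW|exact: Wp|by move=> q /WU[]|].
pose f (k : nat) : base -> C := fun x => phi x 0 (bi k).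
pose dv (q : jet) : jet := \row_i nth 0 [:: 1; q 0 jd1; q 0 jd2; F1 q; F2 q] i.
have WU' q : W q -> [/\ U q, V (jet_base q) & total_deriv (f 0%N) q != 0] by move=> /WU[].
pose Y k q := total_deriv (f k) q / total_deriv (f 0%N) q.
have dvE q : [/\ dv q 0 jt = 1, dv q 0 jx1 = q 0 jd1, dv q 0 jx2 = q 0 jd2, dv q 0 jd1 = F1 q & dv q 0 jd2 = F2 q].
  by rewrite !mxE.
(* On the total derivative vector [dv q] every form of the coframe except [dt] vanishes, so the
   first two rows say that the new velocities are constant along solutions. *)
have Y0 q i : (0 < i < 3)%N -> W q -> 'D_(dv q) (Y i) q = 0.
  have [d0 d1 d2 d3 d4] := dvE q.
  move=> i3 Wq; have := co q (dv q) Wq; rewrite coframe_mul d0 d1 d2 d3 d4 !mulr1 !subrr => /colP h.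
  have r1 : ('d (prolong phi) q (dv q) : jet) 0 jd1 = 0.
    have := h jt; rewrite [LHS]mxE [RHS]mxE [RHS]/= !mulr0 !addr0.
    by move=> <-; rewrite [RHS]/= mul0r subr0.
  have r2 : ('d (prolong phi) q (dv q) : jet) 0 jd2 = 0.
    have := h jx1; rewrite [LHS]mxE [RHS]mxE [RHS]/= !mulr0 !addr0.
    by move=> <-; rewrite [RHS]/= mul0r subr0.
  case: i i3 => [|[|[|//]]] // _.
    by rewrite -[RHS]r1; apply: esym; exact: (prolong_vel1 biV WU').
  by rewrite -[RHS]r2; apply: esym; exact: (prolong_vel2 biV WU').
pose m (k a : nat) q : C := pd [:: bi a] (f k) (jet_base q).
have fH' k : holomorphic_on V (f k) := fH (bi k).
have m1 k a q : V (jet_base q) -> differentiable (m k a) q.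
  by move=> Vq; apply: diff_jb; exact: (@holo_pd _ _ V _ (bi a) oV (@fH' k)).
pose T k q := total_deriv (f k) q.
have TE k : T k = fun q => \sum_(d < 3) vel q d * m k d q.
  by apply/funext => q; exact: total_derivE.
have TH k q : V (jet_base q) -> differentiable (T k) q.
  move=> Vq; rewrite TE; apply: diff_sum => d.
  by apply: differentiableM; [exact: diff_vel|exact: m1].
pose acc q (i : nat) := nth 0 [:: 0; F1 q; F2 q] i.
have DT k q : (k < 3)%N -> V (jet_base q) -> 'D_(dv q) (T k) q =
    \sum_(c < 3) m k c q * (quadr (val_at g (jet_base q)) (vel q) c + acc q c).
  move=> k3 Vq; set x := jet_base q.
  have mh d := m1 k d q Vq; have vh d := diff_vel q d.
  rewrite TE deriv_sum; last by move=> d; apply: differentiableM.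
  transitivity (\sum_(d < 3) (vel q d * (\sum_(e < 3) vel q e * \sum_(c < 3) m k c q * g c d e x)
     + m k d q * acc q d)).
    apply: eq_bigr => d _; rewrite (derivM _ (vh d) (mh d)) deriv_vel; congr (_ * _ + _ * _); last first.
      by have [_ _ _ d3 d4] := dvE q; case: d => -[|[|[|//]]] ?; rewrite /dvel /acc /= ?d3 ?d4.
    rewrite deriv_jb; last exact: (@holo_pd _ _ V _ (bi d) oV (@fH' k)).
    apply: eq_bigr => e _; congr (_ * _).
      by have [d0 d1 d2 _ _] := dvE q; case: e => -[|[|[|//]]] ?; rewrite /jx /vel /= ?d0 ?d1 ?d2.
    transitivity (pd [:: bi d; bi e] (f k) x); first by [].
    apply: etrans (esym (pullback_hess MN (bi k) d e Vq)) _.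
    by apply: eq_bigr => c _; rewrite /m bi_id.
  exact: (hess_quadr (vel q) (fun c => m k c q) (acc q) (val_at g x)).
suff key q i : W q -> (i < 3)%N -> acc q i = geo (val_at g (jet_base q)) (vel q) i.
  split.
  - exact: pullback_hol.
  - exact: pullback_sym.
  - by move=> c d a' b x Vx; exact: (pullback_flat oV fH NH NM MN).
  - by move=> q Wq; exact: (key q 1%N).
  - by move=> q Wq; exact: (key q 2%N).
move=> Wq i3; have [_ Vq T0] := WU' q Wq.
have dvT k : (0 < k < 3)%N -> T k q * 'D_(dv q) (T 0%N) q = T 0%N q * 'D_(dv q) (T k) q.
  move=> k3.
  have t0 := TH 0%N q Vq; have tk := TH k q Vq.
  have T0' : T 0%N q != 0 by exact: T0.
  have tV : differentiable (fun q => (T 0%N q)^-1) q by exact: (differentiableV t0 T0').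
  have := Y0 q k k3 Wq.
  rewrite (derivM _ tk tV) (derivV _ T0' t0) => h.
  have al (t s dt ds : C) : s != 0 -> t * (- s^-1 ^+ 2 * ds) + s^-1 * dt = 0 -> t * ds = s * dt.
    move=> s0 e; apply/eqP; rewrite -subr_eq0; apply/eqP.
    transitivity (- s ^+ 2 * (t * (- s^-1 ^+ 2 * ds) + s^-1 * dt)); first by field.
    by rewrite e mulr0.
  exact: al T0' h.
apply: (@geo_of_straight C (fun k a => m k a q) (fun c k => N (bi c) (bi k) (jet_base q))
  (quadr (val_at g (jet_base q)) (vel q)) (vel q) (acc q) (T^~ q) _ _ _ _ _ _ i i3).
- move=> c b c3 b3.
  have -> : (c == b)%:R = (bi c == bi b)%:R :> C.
    by case: c c3 => [|[|[|//]]]; case: b b3 => [|[|[|//]]].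
  rewrite -(NM _ (bi c) (bi b) Vq).
  by apply: eq_bigr => k _; rewrite /m /f !bi_id.
- by [].
- by [].
- exact: T0.
- by move=> k k3; rewrite TE.
- move=> k k3; have dk := DT k q k3 Vq; have dz := DT 0%N q isT Vq.
  have al (t s x y x' y' : C) : x = x' -> y = y' -> t * x = s * y -> t * x' = s * y' by move=> -> ->.
  apply: (al _ _ _ _ _ _ dz dk).
  case: k k3 {dk} => [|k] k3; [exact: erefl|exact: (dvT k.+1)].
Qed.

Lemma equivalent_identities (U : set jet) (F1 F2 : jet -> C) p :
  point_equivalent_at U F1 F2 setT (fun=> 0) (fun=> 0) p ->
    (pd [:: jd1; jd1; jd1] F2 p = 0) /\
    (pd [:: jd2; jd2; jd2] F1 p = 0) /\
    (pd [:: jd2; jd2; jd2] F2 p - 3 * pd [:: jd1; jd2; jd2] F1 p = 0) /\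
    (pd [:: jd1; jd1; jd1] F1 p - 3 * pd [:: jd1; jd1; jd2] F2 p = 0) /\
    (pd [:: jd1; jd1; jd2] F1 p - pd [:: jd1; jd2; jd2] F2 p = 0) /\
    (2 * Dt F1 F2 (pd [:: jd2] F1) p
       - pd [:: jd2] F1 p * pd [:: jd1] F1 p
       - pd [:: jd2] F2 p * pd [:: jd2] F1 p
       - 4 * pd [:: jx2] F1 p = 0) /\
    (- (pd [:: jd2] F2 p) ^+ 2 - 2 * Dt F1 F2 (pd [:: jd1] F1) p
       - 4 * pd [:: jx2] F2 p + 4 * pd [:: jx1] F1 p
       + 2 * Dt F1 F2 (pd [:: jd2] F2) p + (pd [:: jd1] F1 p) ^+ 2 = 0) /\
    (- 2 * Dt F1 F2 (pd [:: jd1] F2) p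
       + pd [:: jd2] F2 p * pd [:: jd1] F2 p
       + 4 * pd [:: jx1] F2 p
       + pd [:: jd1] F1 p * pd [:: jd1] F2 p = 0).
Proof.
case/equivalent_geodesic => V [g [W [oV oW Wp WV [gH gS gR e1 e2]]]].
have [t1 t2 t3 t4 t5] := third_order_geodesic gH gS oW WV e1 e2 Wp.
have [t6 t7 t8] := torsion_geodesic oV gH gS oW WV e1 e2 Wp.
have Vp := WV _ Wp.
have j0 i (j : 'I_3) : (i < 3)%N -> jac (riem (val_at g (jet_base p)) (der_at g (jet_base p))) (vel p) i j = 0.
  move=> i3; rewrite /jac big1// => d _; rewrite big1// => a _.
  have r1 := gR (Ordinal i3) d a j _ Vp; have r2 := gR ord0 d a j _ Vp.
  by rewrite [riem _ _ i d a j]r1 [riem _ _ 0%N d a j]r2 mulr0 subrr !mul0r.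
have J12 := @j0 1%N bx2 isT; have J21 := @j0 2%N bx1 isT.
have J11 := @j0 1%N bx1 isT; have J22 := @j0 2%N bx2 isT.
have z1 (x y : C) : y = 0 -> x = - 4 * y -> x = 0 by move=> ->; rewrite mulr0.
have z2 (x y z : C) : y = 0 -> z = 0 -> x = 4 * (y - z) -> x = 0 by move=> -> ->; rewrite subrr mulr0.
have z3 (x y : C) : y = 0 -> x = 4 * y -> x = 0 by move=> ->; rewrite mulr0.
do 5 (split; first by []).
split; first exact: z1 J12 t6.
split; first exact: z2 J11 J22 t7.
exact: z3 J21 t8.
Qed.
End NecessityMain.

(** * Sufficiency *)

Section Fiber.
Variable R : realType.
Local Notation C := (Cplx R).
Local Notation base := 'rV[C]_3.
Local Notation jet := 'rV[C]_5.
Implicit Types (q v : jet) (x : base).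
Variables (p : jet) (r : R).
Local Notation B := (bl p r).
Local Notation B0 := (bl (jet_base p) r).

(** Section of [jet_base] with the velocities frozen at those of [p]; coefficients of polynomials in
    the velocities are read off along it. *)
Definition lift_jet x : jet := \row_i nth 0 [:: x 0 bt; x 0 bx1; x 0 bx2; p 0 jd1; p 0 jd2] i.

Lemma jet_base_lift x : jet_base (lift_jet x) = x.
Proof.
apply/rowP => i; rewrite !mxE; case: i => -[|[|[|//]]] ? /=;
  by congr (x 0 _); apply: val_inj.
Qed.

Lemma lift_jet_bl x : 0 < r -> B0 x -> B (lift_jet x).
Proof.
move=> r0 Bx; apply: nm_row_lt => // i.
have H (j : 'I_3) : nm ((x - jet_base p) 0 j : C) < r by apply: le_lt_trans Bx; exact: nm_coord.
have E (j : 'I_3) : (x - jet_base p) 0 j = x 0 j - p 0 (widen_ord (isT : 3 <= 5)%N j).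
  by rewrite !mxE.
have Z (z : C) : nm (z - z : C) < r by rewrite subrr nm0.
rewrite mxE [X in X + _]mxE [X in _ + X]mxE.
case: i => -[|[|[|[|[|//]]]]] ?; rewrite [nth _ _ _]/=.
- by have := H bt; rewrite E; congr (nm (_ - p 0 _) < r); apply: val_inj.
- by have := H bx1; rewrite E; congr (nm (_ - p 0 _) < r); apply: val_inj.
- by have := H bx2; rewrite E; congr (nm (_ - p 0 _) < r); apply: val_inj.
- by have := Z (p 0 jd1); congr (nm (_ - p 0 _) < r); apply: val_inj.
- by have := Z (p 0 jd2); congr (nm (_ - p 0 _) < r); apply: val_inj.
Qed.

Lemma bl_jet_base q : B q -> B0 (jet_base q).
Proof. by move=> Bq; apply: le_lt_trans Bq; rewrite -jet_baseB; exact: nm_jet_base. Qed.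

Lemma lift_jet_hol (h : jet -> C) : 0 < r -> holomorphic_on B h ->
  holomorphic_on B0 (fun x => h (lift_jet x)).
Proof.
move=> r0 hB x Bx.
have dl : differentiable lift_jet x.
  apply: diff_rowP => k.
  have -> : (fun x => lift_jet x 0 k : C) = nth (fun=> p 0 jd2) [:: fun x => x 0 bt; fun x => x 0 bx1;
     fun x => x 0 bx2; fun=> p 0 jd1] k.
    by apply/funext => y; rewrite mxE; case: k => -[|[|[|[|[|//]]]]].
  by case: k => -[|[|[|[|[|//]]]]] ?; [exact: differentiable_coord|exact: differentiable_coord
    |exact: differentiable_coord|exact: differentiable_cst|exact: differentiable_cst].
apply: (@differentiable_comp _ _ _ _ lift_jet h) => //.
by apply: hB; exact: lift_jet_bl.
Qed.

(** The segment from the lift to [q] is vertical and stays in the convex ball, so the fundamental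
    theorem along it integrates zero. *)
Lemma fiber_const (h : jet -> C) : 0 < r -> holomorphic_on B h ->
  (forall q, B q -> pd [:: jd1] h q = 0 /\ pd [:: jd2] h q = 0) ->
  forall q, B q -> h q = h (lift_jet (jet_base q)).
Proof.
move=> r0 hB h0 q Bq; set z := lift_jet _.
have Bz : B z by apply: lift_jet_bl => //; exact: bl_jet_base.
have sB s : 0 <= s <= 1 -> B (seg z q s) by exact: seg_convex.
have df s : 0 <= s <= 1 -> differentiable h (seg z q s) by move=> /sB; exact: hB.
have ddf a s : 0 <= s <= 1 -> differentiable (pd [:: a] h) (seg z q s).
  by move=> /sB Bs; move: Bs; apply: (@holo_pd _ _ B h a); [exact: bl_open|exact: hB].
apply: subr0_eq; apply: nm_eq0; apply/eqP; rewrite eq_le nm_ge0 andbT.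
rewrite (seg_FTC df ddf) -[leRHS](mulr0 2).
apply: nm_cint01; first exact: seg_ccont_dotc.
move=> s /sB /h0[e1 e2].
have zb : jet_base (q - z) = 0 by rewrite jet_baseB jet_base_lift subrr.
have zc d : (d < 3)%N -> (q - z) 0 (jx d) = 0 by move=> d3; rewrite -jet_baseE// zb mxE.
rewrite dotc5 /grad e1 e2 (zc 0%N)// (zc 1%N)// (zc 2%N)//.
by move: (pd _ _ _) (pd _ _ _) (pd _ _ _) => *; rewrite !mul0r !mulr0 !addr0 nm0.
Qed.

(** A bilinear form packed as a connection that ignores its upper index, so that the calculus of
    [quadr] applies to it. *)
Definition fib (g : nat -> nat -> base -> C) (c a b : nat) : base -> C := g a b.
Definition fib_quadr (g : nat -> nat -> base -> C) q := quadr (val_at (fib g) (jet_base q)) (vel q) 0%N.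

Section Subtract.
Variables (h : jet -> C) (g : nat -> nat -> base -> C).
Hypothesis r0 : 0 < r.
Hypothesis hB : holomorphic_on B h.
Hypothesis gH : forall a b, holomorphic_on B0 (g a b).
Hypothesis gS : forall a b x, B0 x -> g a b x = g b a x.

Let fH c a b : holomorphic_on B0 (fib g c a b). Proof. exact: gH. Qed.
Let fS c a b x : B0 x -> fib g c a b x = fib g c b a x. Proof. exact: gS. Qed.

Lemma sub_quadr_hol : holomorphic_on B (fun q => h q - fib_quadr g q).
Proof.
move=> q Bq; apply: differentiableB; first exact: hB.
by apply: (diff_quadr fH); exact: bl_jet_base.
Qed.

Lemma sub_quadr_jd q j : B q -> (0 < j < 3)%N ->
  pd [:: jd j] (fun q => h q - fib_quadr g q) q =
  pd [:: jd j] h q - dquadr (val_at (fib g) (jet_base q)) (vel q) 0%N j.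
Proof.
move=> Bq j3; have Bb := bl_jet_base Bq.
have dq : differentiable (fib_quadr g) q by exact: (diff_quadr fH).
apply: etrans (pdB (jd j) (hB Bq) dq) _; congr (_ - _).
exact: (deriv_quadr_jd fH fS 0%N Bb j3).
Qed.
End Subtract.

(** The quadratic, linear and constant parts are removed in turn. Since [u^0 = 1], a single
    quadratic form in [(1, u^1, u^2)] holds all three, the lower parts in the entries with index
    0. *)
Lemma fiber_quadratic (h : jet -> C) : 0 < r -> holomorphic_on B h ->
  (forall q j l m, B q -> (0 < j < 3)%N -> (0 < l < 3)%N -> (0 < m < 3)%N -> pd [:: jd j; jd l; jd m] h q = 0) ->
  exists g : nat -> nat -> base -> C, [/\ forall a b, holomorphic_on B0 (g a b),
    forall a b x, B0 x -> g a b x = g b a x & forall q, B q -> h q = fib_quadr g q].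
Proof.
move=> r0 hB h3; have oB : open B by exact: bl_open.
have cst k : holomorphic_on B k -> (forall q j, B q -> (0 < j < 3)%N -> pd [:: jd j] k q = 0) ->
    forall q, B q -> k q = k (lift_jet (jet_base q)).
  by move=> kB k0; apply: fiber_const => // q Bq; split; [exact: (k0 q 1%N)|exact: (k0 q 2%N)].
(* Half the Hessian, as the second derivatives of [quadr] are twice the form. *)
pose g1 (a b : nat) x : C := if (0 < a)%N && (0 < b)%N then 2^-1 * pd [:: jd a; jd b] h (lift_jet x) else 0.
have g1H a b : holomorphic_on B0 (g1 a b).
  move=> x Bx; rewrite /g1; case: (_ && _); last exact: differentiable_cst.
  apply: differentiableM; first exact: differentiable_cst.
  by apply: (@lift_jet_hol (pd [:: jd a; jd b] h)) => //; exact: holo_pds.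
have g1S a b x : B0 x -> g1 a b x = g1 b a x.
  move=> Bx; rewrite /g1 [(0 < b)%N && _]andbC; case: (_ && _); last exact: erefl.
  by rewrite (pd_comm (jd a) (jd b) oB hB (lift_jet_bl r0 Bx)).
pose h1 q := h q - fib_quadr g1 q.
have h1B : holomorphic_on B h1 by exact: sub_quadr_hol.
have h1d q j : B q -> (0 < j < 3)%N ->
    pd [:: jd j] h1 q = pd [:: jd j] h q - dquadr (val_at (fib g1) (jet_base q)) (vel q) 0%N j.
  by move=> Bq j3; exact: sub_quadr_jd.
have h1dd q j l : B q -> (0 < j < 3)%N -> (0 < l < 3)%N -> pd [:: jd l] (pd [:: jd j] h1) q = 0.
  move=> Bq j3 l3; have Bb := bl_jet_base Bq.
  have hj : holomorphic_on B (pd [:: jd j] h) by exact: holo_pds.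
  transitivity (pd [:: jd l] (fun q => pd [:: jd j] h q - dquadr (val_at (fib g1) (jet_base q)) (vel q) 0%N j) q).
    by apply: (@eq_pd _ _ B) => // z Bz; exact: h1d.
  have dd : differentiable (fun q => dquadr (val_at (fib g1) (jet_base q)) (vel q) 0%N j) q.
    by apply: (@diff_dquadr _ _ (fib g1)) Bb => c a b; exact: g1H.
  apply: etrans (pdB (jd l) (hj _ Bq) dd) _.
  have -> : pd [:: jd l] (pd [:: jd j] h) q = pd [:: jd j; jd l] h (lift_jet (jet_base q)).
    apply: (cst (pd [:: jd j; jd l] h)) Bq; first exact: holo_pds.
    by move=> z m Bz m3; exact: (h3 z j l m).
  have -> : pd [:: jd l] (fun q => dquadr (val_at (fib g1) (jet_base q)) (vel q) 0%N j) q = 2 * g1 j l (jet_base q).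
    have /andP[_ l3'] := l3.
    apply: etrans (@deriv_dquadr _ _ (fib g1) _ q (delta_mx 0 (jd l)) 0%N j Bb) _; first by move=> c a b; exact: g1H.
    rewrite big1 ?add0r; last by move=> d _; rewrite jx_jd// mul0r.
    congr (2 * _); rewrite -[RHS](sum_delta (fun b => g1 j b (jet_base q)) l3').
    by apply: eq_bigr => b _; rewrite dvel_jd.
  have /andP[j0 _] := j3; have /andP[l0 _] := l3; rewrite /g1 j0 l0 /=.
  by rewrite mulrA divff ?mul1r ?subrr// pnatr_eq0.
have half (z : C) : 2 * (2^-1 * z) = z by rewrite mulrA divff ?mul1r// pnatr_eq0.
pose beta (a : nat) x : C := if (0 < a)%N then 2^-1 * pd [:: jd a] h1 (lift_jet x) else 0.
have betaH a : holomorphic_on B0 (beta a).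
  move=> x Bx; rewrite /beta; case: (0 < a)%N; last exact: differentiable_cst.
  apply: differentiableM; first exact: differentiable_cst.
  by apply: (@lift_jet_hol (pd [:: jd a] h1)) => //; exact: holo_pds.
(* The linear part, split evenly between the entries [(0, b)] and [(b, 0)]. *)
pose g2 (a b : nat) x : C := (a == 0%N)%:R * beta b x + (b == 0%N)%:R * beta a x.
have g2H a b : holomorphic_on B0 (g2 a b).
  move=> x Bx; apply: differentiableD; apply: differentiableM;
    [exact: differentiable_cst|exact: betaH|exact: differentiable_cst|exact: betaH].
have g2S a b x : B0 x -> g2 a b x = g2 b a x by move=> _; exact: addrC.
pose h2 q := h1 q - fib_quadr g2 q.
have h2B : holomorphic_on B h2 by exact: sub_quadr_hol.
have h2d q j : B q -> (0 < j < 3)%N -> pd [:: jd j] h2 q = 0.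
  move=> Bq j3; have /andP[j0 _] := j3.
  apply: etrans (sub_quadr_jd h1B g2H g2S Bq j3) _.
  have -> : pd [:: jd j] h1 q = 2 * beta j (jet_base q).
    rewrite /beta j0 half.
    apply: (cst (pd [:: jd j] h1)) Bq; first exact: holo_pds.
    by move=> z l Bz l3; exact: h1dd.
  apply/eqP; rewrite subr_eq0; apply/eqP; rewrite /dquadr; congr (2 * _).
  have jn0 : (j == 0%N) = false by case: (j) j0.
  have b0 x : beta 0%N x = 0 by [].
  rewrite (sum3nat (fun b => g2 j b (jet_base q) * vel q b)) /g2 jn0 /=.
  by rewrite /vel /=; move: (beta _ _) (beta _ _) (beta _ _) => *; ring.
pose g3 (a b : nat) x : C := (a == 0%N)%:R * ((b == 0%N)%:R * h2 (lift_jet x)).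
have g3H a b : holomorphic_on B0 (g3 a b).
  move=> x Bx; apply: differentiableM; first exact: differentiable_cst.
  apply: differentiableM; first exact: differentiable_cst.
  exact: (@lift_jet_hol h2).
have h2E q : B q -> h2 q = fib_quadr g3 q.
  move=> Bq; rewrite (cst h2 h2B (fun z j Bz j3 => h2d z j Bz j3) q Bq).
  rewrite /fib_quadr /quadr !big_ord_recl !big_ord0 /val_at /fib /g3 /vel /= /bump /= !mul0r !mul1r !addr0 !mulr1.
  by rewrite !(mul0r, add0r, addr0).
exists (fun a b x => g1 a b x + g2 a b x + g3 a b x); split.
- move=> a b x Bx; apply: differentiableD; last exact: g3H.
  by apply: differentiableD; [exact: g1H|exact: g2H].
- move=> a b x Bx; rewrite g1S// g2S//; congr (_ + _ + _); rewrite /g3.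
  by move: (h2 _) => t; case: (a == _); case: (b == _); rewrite !(mul0r, mul1r).
move=> q Bq; have -> : h q = fib_quadr g1 q + fib_quadr g2 q + fib_quadr g3 q.
  by rewrite -h2E// /h2 /h1 addrA; ring.
rewrite /fib_quadr /quadr -!big_split /=; apply: eq_bigr => a _.
rewrite -!big_split /=; apply: eq_bigr => b _; rewrite /val_at /fib.
by ring.
Qed.
End Fiber.

(** * Normalization within the projective class *)

Section TraceFree.
Variable R : realType.
Local Notation C := (Cplx R).
Local Notation base := 'rV[C]_3.

(** The projective change by [psi] adds [(n + 1) psi] to the trace, so [psi] is minus the trace over
    [n + 1 = 4]; its contribution to [quadr] is a multiple of [u] and cancels in [geo]. *)
Lemma trace_free (D : set base) (g : nat -> nat -> nat -> base -> C) :
  (forall c a b, holomorphic_on D (g c a b)) ->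
  (forall c a b x, D x -> g c a b x = g c b a x) ->
  exists h : nat -> nat -> nat -> base -> C,
   [/\ forall c a b, holomorphic_on D (h c a b),
     forall c a b x, D x -> h c a b x = h c b a x,
     forall a x, D x -> \sum_(c < 3) h c c a x = 0 &
     forall u i x, u 0%N = 1 -> (i < 3)%N -> geo (val_at h x) u i = geo (val_at g x) u i].
Proof.
move=> gH gS.
(* Indices [a >= 3] are junk; the factor 3 makes the trace vanish for them too. *)
pose psi (a : nat) x : C := - (3 + (a < 3)%N%:R)^-1 * \sum_(c < 3) g c c a x.
have psiH a : holomorphic_on D (psi a).
  move=> x Dx; apply: differentiableM; first exact: differentiable_cst.
  by apply: diff_sum => c; exact: gH.
pose h (c a b : nat) x : C := g c a b x + ((c == a)%:R * psi b x + (c == b)%:R * psi a x).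
exists h; split.
- move=> c a b x Dx; apply: differentiableD; first exact: gH.
  apply: differentiableD; apply: differentiableM;
    [exact: differentiable_cst|exact: psiH|exact: differentiable_cst|exact: psiH].
- by move=> c a b x Dx; rewrite /h gS// [X in _ + X]addrC.
- move=> a x Dx; have E : \sum_(c < 3) g c c a x = - (3 + (a < 3)%N%:R) * psi a x.
    by rewrite /psi mulrA mulrNN divff ?mul1r// -natrD pnatr_eq0.
  have S : \sum_(c < 3) (c == a :> nat)%:R * psi c x = (a < 3)%N%:R * psi a x.
    by case: a E => [|[|[|a]]] _; rewrite !big_ord_recl big_ord0 /= /bump /=; ring.
  rewrite /h !big_split /= E S.
  under eq_bigr do rewrite eqxx mul1r.
  rewrite sumr_const card_ord -[psi a x *+ 3]mulr_natl.
  by case: (a < 3)%N => /=; ring.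
- move=> u i x u0 i3.
  have q c : (c < 3)%N -> quadr (val_at h x) u c = quadr (val_at g x) u c + 2 * u c * \sum_(b < 3) psi b x * u b.
    move=> c3; rewrite /quadr /val_at /h; case: c c3 => [|[|[|//]]] _;
      rewrite !big_ord_recl !big_ord0 /= /bump /= ?addn0 ?addn1; ring.
  by rewrite /geo !q// u0; ring.
Qed.
End TraceFree.

Section Swap.
Variable R : realType.
Local Notation C := (Cplx R).
Variable n : nat.

Lemma pd_swap (B : set 'rV[C]_n) (f : 'rV[C]_n -> C) s i j t q : open B -> holomorphic_on B f -> B q ->
  pd (s ++ i :: j :: t) f q = pd (s ++ j :: i :: t) f q.
Proof.
move=> oB fB Bq.
have E k l : pd (s ++ k :: l :: t) f = pd t (pd [:: k; l] (pd s f)).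
  by rewrite /pd foldl_cat.
rewrite (E i j) (E j i); apply: (eq_pd t oB Bq) => z Bz.
by apply: (pd_comm i j oB _ Bz); exact: holo_pds.
Qed.
End Swap.

(** * Vanishing of the fourth velocity derivatives *)

Section Cubic.
Variable R : realType.
Local Notation C := (Cplx R).
Local Notation base := 'rV[C]_3.
Local Notation jet := 'rV[C]_5.
Implicit Types (q : jet) (x : base).
Variables (B : set jet) (F1 F2 : jet -> C).
Hypothesis oB : open B.
Hypothesis H1 : holomorphic_on B F1.
Hypothesis H2 : holomorphic_on B F2.
Hypothesis I1 : forall q, B q -> pd [:: jd1; jd1; jd1] F2 q = 0.
Hypothesis I2 : forall q, B q -> pd [:: jd2; jd2; jd2] F1 q = 0.
Hypothesis I3 : forall q, B q -> pd [:: jd2; jd2; jd2] F2 q = 3 * pd [:: jd1; jd2; jd2] F1 q.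
Hypothesis I4 : forall q, B q -> pd [:: jd1; jd1; jd1] F1 q = 3 * pd [:: jd1; jd1; jd2] F2 q.
Hypothesis I5 : forall q, B q -> pd [:: jd1; jd1; jd2] F1 q = pd [:: jd1; jd2; jd2] F2 q.

Let d0 (a : 'I_5) (f : jet -> C) q : B q -> (forall z, B z -> f z = 0) -> pd [:: a] f q = 0.
Proof.
move=> Bq f0; transitivity (pd [:: a] (fun _ : jet => 0 : C) q); last exact: pd_cst.
exact: (@eq_pd _ _ B).
Qed.

Let d3 (a : 'I_5) (f h : jet -> C) q : B q -> holomorphic_on B h -> (forall z, B z -> f z = 3 * h z) ->
  pd [:: a] f q = 3 * pd [:: a] h q.
Proof.
move=> Bq hB fh; transitivity (pd [:: a] (fun z => 3 * h z) q); first exact: (@eq_pd _ _ B).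
by apply: pdZ; exact: hB.
Qed.

Let mul3 (x y : C) : x = y -> 3 * x = 3 * y. Proof. by move=> ->. Qed.

Let triple0 (x : C) : x = 3 * x -> x = 0.
Proof.
move=> e; have : 2 * x = 0.
  by transitivity (3 * x - x); [ring|rewrite -e subrr].
by move/eqP; rewrite mulf_eq0 pnatr_eq0 /= => /eqP.
Qed.

(** Commuting derivatives and passing to [F1] and back through [I5] and [I4], the quantity becomes
    three times itself. *)
Let X2 q : B q -> pd [:: jd1; jd1; jd2; jd2] F2 q = 0.
Proof.
move=> Bq; apply: triple0.
have h := holo_pds [:: jd1; jd1; jd2] oB H2.
transitivity (pd [:: jd1; jd2; jd2; jd1] F2 q).
  transitivity (pd [:: jd1; jd2; jd1; jd2] F2 q).
    exact: (@pd_swap _ _ B F2 [:: jd1] jd1 jd2 [:: jd2]).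
  exact: (@pd_swap _ _ B F2 [:: jd1; jd2] jd1 jd2 [::]).
transitivity (pd [:: jd1; jd1; jd2; jd1] F1 q).
  by apply: (@eq_pd _ _ B [:: jd1] (pd [:: jd1; jd2; jd2] F2) (pd [:: jd1; jd1; jd2] F1) q oB Bq) => z Bz; exact: esym (I5 Bz).
transitivity (pd [:: jd1; jd1; jd1; jd2] F1 q).
  exact: (@pd_swap _ _ B F1 [:: jd1; jd1] jd2 jd1 [::]).
exact: (d3 jd2 Bq h I4).
Qed.

(** The same circle for [F1], closed by [I5] and [I3]. *)
Let Y2 q : B q -> pd [:: jd1; jd1; jd2; jd2] F1 q = 0.
Proof.
move=> Bq; apply: triple0.
have h := holo_pds [:: jd1; jd2; jd2] oB H1.
transitivity (pd [:: jd1; jd2; jd2; jd2] F2 q).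
  by apply: (@eq_pd _ _ B [:: jd2] (pd [:: jd1; jd1; jd2] F1) (pd [:: jd1; jd2; jd2] F2) q oB Bq) => z Bz; exact: I5.
transitivity (pd [:: jd2; jd1; jd2; jd2] F2 q).
  exact: (@pd_swap _ _ B F2 [::] jd1 jd2 [:: jd2; jd2]).
transitivity (pd [:: jd2; jd2; jd1; jd2] F2 q).
  exact: (@pd_swap _ _ B F2 [:: jd2] jd1 jd2 [:: jd2]).
transitivity (pd [:: jd2; jd2; jd2; jd1] F2 q).
  exact: (@pd_swap _ _ B F2 [:: jd2; jd2] jd1 jd2 [::]).
transitivity (3 * pd [:: jd1; jd2; jd2; jd1] F1 q); first exact: (d3 jd1 Bq h I3).
apply: mul3.
transitivity (pd [:: jd1; jd2; jd1; jd2] F1 q).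
  exact: (@pd_swap _ _ B F1 [:: jd1; jd2] jd2 jd1 [::]).
exact: (@pd_swap _ _ B F1 [:: jd1] jd2 jd1 [:: jd2]).
Qed.

Lemma third_deriv_const q : B q ->
  [/\ pd [:: jd1] (pd [:: jd1; jd1; jd2] F2) q = 0, pd [:: jd2] (pd [:: jd1; jd1; jd2] F2) q = 0,
    pd [:: jd1] (pd [:: jd1; jd1; jd2] F1) q = 0, pd [:: jd2] (pd [:: jd1; jd1; jd2] F1) q = 0 &
    pd [:: jd1] (pd [:: jd1; jd2; jd2] F1) q = 0 /\ pd [:: jd2] (pd [:: jd1; jd2; jd2] F1) q = 0].
Proof.
move=> Bq; have h := holo_pds [:: jd1; jd1; jd2] oB H2.
split.
- transitivity (pd [:: jd1; jd1; jd1; jd2] F2 q); last exact: (d0 jd2 Bq I1).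
  exact: (@pd_swap _ _ B F2 [:: jd1; jd1] jd2 jd1 [::]).
- exact: X2.
- transitivity (pd [:: jd1; jd1; jd1; jd2] F1 q).
    exact: (@pd_swap _ _ B F1 [:: jd1; jd1] jd2 jd1 [::]).
  exact: etrans (d3 jd2 Bq h I4) (etrans (mul3 (X2 Bq)) (mulr0 3)).
- exact: Y2.
split.
  transitivity (pd [:: jd1; jd2; jd1; jd2] F1 q).
    exact: (@pd_swap _ _ B F1 [:: jd1; jd2] jd2 jd1 [::]).
  transitivity (pd [:: jd1; jd1; jd2; jd2] F1 q); last exact: Y2.
  exact: (@pd_swap _ _ B F1 [:: jd1] jd2 jd1 [:: jd2]).
transitivity (pd [:: jd2; jd1; jd2; jd2] F1 q).
  exact: (@pd_swap _ _ B F1 [::] jd1 jd2 [:: jd2; jd2]).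
transitivity (pd [:: jd2; jd2; jd1; jd2] F1 q).
  exact: (@pd_swap _ _ B F1 [:: jd2] jd1 jd2 [:: jd2]).
transitivity (pd [:: jd2; jd2; jd2; jd1] F1 q); last exact: (d0 jd1 Bq I2).
exact: (@pd_swap _ _ B F1 [:: jd2; jd2] jd1 jd2 [::]).
Qed.
End Cubic.

Lemma range12 (T : nat -> Prop) : T 1%N -> T 2%N -> forall j, (0 < j < 3)%N -> T j.
Proof. by move=> T1 T2 [|[|[|j]]]. Qed.

(** * The connection read off from a cubic system *)

Section CubicConnection.
Variable R : realType.
Local Notation C := (Cplx R).
Local Notation base := 'rV[C]_3.
Local Notation jet := 'rV[C]_5.
Implicit Types (q : jet) (x : base).

Lemma pd_subs n (B : set 'rV[C]_n) s (f h : 'rV[C]_n -> C) (q : 'rV[C]_n) : open B -> holomorphic_on B f -> holomorphic_on B h -> B q ->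
  pd s (fun z => f z - h z) q = pd s f q - pd s h q.
Proof.
move=> oB; elim: s f h q => [//|i s ih] f h q fB hB Bq.
transitivity (pd s (fun z => pd [:: i] f z - pd [:: i] h z) q).
  apply: (@eq_pd _ _ B s (pd [:: i] (fun z => f z - h z)) (fun z => pd [:: i] f z - pd [:: i] h z) q oB Bq) => z Bz.
  exact: pdB (fB _ Bz) (hB _ Bz).
by apply: ih Bq; exact: holo_pd.
Qed.

(* Third velocity derivatives of [u i * (k 1 1 u1^2 + 2 k 1 2 u1 u2 + k 2 2 u2^2)],
   indexed by the number of derivatives in the direction 2. *)
Definition cubic_tab (P Q S : C) (i j l m : nat) : C :=
  nth 0 (if i == 1%N then [:: 3 * P; Q; S; 0] else [:: 0; P; Q; 3 * S])
    ((j == 2%N) + (l == 2%N) + (m == 2%N))%N.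

(** Inverts [geodesic_jd3]: one Kronecker symbol fires for the diagonal entries, giving [2 * k], and
    two fire for the mixed entry, giving [4 * k]; hence the factors [2^-1] and [4^-1]. *)
Lemma cubic_tabE (P Q S : C) (k : nat -> nat -> C) i j l m :
  k 1%N 1%N = 2^-1 * P -> k 1%N 2%N = 4^-1 * Q -> k 2%N 1%N = 4^-1 * Q -> k 2%N 2%N = 2^-1 * S ->
  (0 < i < 3)%N -> (0 < j < 3)%N -> (0 < l < 3)%N -> (0 < m < 3)%N ->
  cubic_tab P Q S i j l m =
  (i == j)%:R * (2 * k l m) + (i == l)%:R * (2 * k j m) + (i == m)%:R * (2 * k j l).
Proof.
move=> k11 k12 k21 k22.
case: i => [|[|[|//]]] // _; case: j => [|[|[|//]]] // _; case: l => [|[|[|//]]] // _;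
  case: m => [|[|[|//]]] // _; rewrite /cubic_tab /= ?k11 ?k12 ?k21 ?k22; by field.
Qed.

Variables (p : jet) (r : R) (F1 F2 : jet -> C).
Local Notation B := (bl p r).
Local Notation B0 := (bl (jet_base p) r).
Hypothesis r0 : 0 < r.
Hypothesis H1 : holomorphic_on B F1.
Hypothesis H2 : holomorphic_on B F2.
Hypothesis I1 : forall q, B q -> pd [:: jd1; jd1; jd1] F2 q = 0.
Hypothesis I2 : forall q, B q -> pd [:: jd2; jd2; jd2] F1 q = 0.
Hypothesis I3 : forall q, B q -> pd [:: jd2; jd2; jd2] F2 q = 3 * pd [:: jd1; jd2; jd2] F1 q.
Hypothesis I4 : forall q, B q -> pd [:: jd1; jd1; jd1] F1 q = 3 * pd [:: jd1; jd1; jd2] F2 q.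
Hypothesis I5 : forall q, B q -> pd [:: jd1; jd1; jd2] F1 q = pd [:: jd1; jd2; jd2] F2 q.

Let oB : open B. Proof. exact: bl_open. Qed.
Let F i := if i == 1%N then F1 else F2.
Let FB i : holomorphic_on B (F i). Proof. by rewrite /F; case: (_ == _). Qed.
Let P := pd [:: jd1; jd1; jd2] F2.
Let Q := pd [:: jd1; jd1; jd2] F1.
Let S := pd [:: jd1; jd2; jd2] F1.

Let third_tab q : B q -> forall i, (0 < i < 3)%N -> forall j, (0 < j < 3)%N ->
  forall l, (0 < l < 3)%N -> forall m, (0 < m < 3)%N ->
  pd [:: jd j; jd l; jd m] (F i) q = cubic_tab (P q) (Q q) (S q) i j l m.
Proof.
move=> Bq.
have s12 f a b c : holomorphic_on B f -> pd [:: a; b; c] f q = pd [:: b; a; c] f q.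
  by move=> fB; exact: (pd_swap [::] a b [:: c] oB fB Bq).
have s23 f a b c : holomorphic_on B f -> pd [:: a; b; c] f q = pd [:: a; c; b] f q.
  by move=> fB; exact: (pd_swap [:: a] b c [::] oB fB Bq).
have s13 f a b c : holomorphic_on B f -> pd [:: a; b; c] f q = pd [:: c; a; b] f q.
  by move=> fB; exact: etrans (s23 _ _ _ _ fB) (s12 _ _ _ _ fB).
apply: range12; apply: range12; apply: range12; apply: range12.
- exact: I4.
- exact: erefl.
- exact: s23.
- exact: erefl.
- exact: etrans (s12 _ _ _ _ H1) (s23 _ _ _ _ H1).
- exact: s12.
- exact: s13.
- exact: I2.
- exact: I1.
- exact: erefl.
- exact: s23.
- exact: esym (I5 Bq).
- exact: etrans (s12 _ _ _ _ H2) (s23 _ _ _ _ H2).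
- transitivity (pd [:: jd1; jd2; jd2] F2 q); [exact: s12|exact: esym (I5 Bq)].
- transitivity (pd [:: jd1; jd2; jd2] F2 q); [exact: s13|exact: esym (I5 Bq)].
- exact: I3.
Qed.

Let L := lift_jet p.
Let k (a b : nat) (z : jet) : C :=
  match a, b with
  | 1, 1 => 2^-1 * P z
  | 1, 2 => 4^-1 * Q z
  | 2, 1 => 4^-1 * Q z
  | 2, 2 => 2^-1 * S z
  | _, _ => 0
  end.
(** Only [g^0] is filled in: it carries the cubic part, which is [u^i] times one quadratic form
    common to both equations. *)
Let g1 (c a b : nat) x : C := (c == 0%N)%:R * k a b (L x).

Let kB a b : holomorphic_on B (k a b).
Proof.
have cB (c : C) : holomorphic_on B (fun _ : jet => c) by move=> z _; exact: differentiable_cst.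
have mB (c : C) f : holomorphic_on B f -> holomorphic_on B (fun z => c * f z).
  by move=> fB z Bz; apply: differentiableM; [exact: differentiable_cst|exact: fB].
have PB : holomorphic_on B P by exact: (holo_pds _ oB H2).
have QB : holomorphic_on B Q by exact: (holo_pds _ oB H1).
have SB : holomorphic_on B S by exact: (holo_pds _ oB H1).
move: a b => [|[|[|a]]] [|[|[|b]]]; 
  [exact: cB|exact: cB|exact: cB|exact: cB
  |exact: cB|exact: (mB 2^-1 _ PB)|exact: (mB 4^-1 _ QB)|exact: cB
  |exact: cB|exact: (mB 4^-1 _ QB)|exact: (mB 2^-1 _ SB)|exact: cB
  |exact: cB|exact: cB|exact: cB|exact: cB].
Qed.

Let g1H c a b : holomorphic_on B0 (g1 c a b).
Proof.
move=> x Bx; apply: differentiableM; first exact: differentiable_cst.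
exact: (lift_jet_hol r0 (@kB a b)).
Qed.

Let g1S c a b x : B0 x -> g1 c a b x = g1 c b a x.
Proof. by move=> _; rewrite /g1; congr (_ * _); case: a b => [|[|[|a]]] [|[|[|b]]]. Qed.

Let geo1 i q := geo (val_at g1 (jet_base q)) (vel q) i.

Let geo1_jd3 q : B q -> forall i, (0 < i < 3)%N -> forall j, (0 < j < 3)%N ->
  forall l, (0 < l < 3)%N -> forall m, (0 < m < 3)%N ->
  pd [:: jd j; jd l; jd m] (geo1 i) q = cubic_tab (P q) (Q q) (S q) i j l m.
Proof.
move=> Bq i i3 j j3 l l3 m m3; have Bb := bl_jet_base Bq.
pose W := [set z : jet | B0 (jet_base z)].
have oW : open W by apply: open_jet_base; exact: bl_open.
have key := @geodesic_jd3 _ B0 g1 W g1H g1S oW (fun z Wz => Wz) (geo1 1%N) (geo1 2%N)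
  (fun z _ => erefl) (fun z _ => erefl) i j l m q i3 j3 l3 m3 Bb.
have -> : geo1 i = (if i == 1%N then geo1 1%N else geo1 2%N).
  by move: i i3 {key}; exact: range12.
apply: etrans key _; apply: esym.
pose z := L (jet_base q).
have cst f : holomorphic_on B f -> (forall q, B q -> pd [:: jd1] f q = 0 /\ pd [:: jd2] f q = 0) -> f q = f z.
  by move=> fB f0; exact: (fiber_const r0 fB f0 Bq).
have tc q' (Bq' : B q') := third_deriv_const oB H1 H2 I1 I2 I3 I4 I5 Bq'.
have Pz : P q = P z.
  by apply: cst => [|q1 /tc[c1 c2 _ _ _]]; [exact: (holo_pds _ oB H2)|split; [exact: c1|exact: c2]].
have Qz : Q q = Q z.
  by apply: cst => [|q' /tc[_ _ c1 c2 _]]; [exact: (holo_pds _ oB H1)|split; [exact: c1|exact: c2]].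
have Sz : S q = S z.
  by apply: cst => [|q' /tc[_ _ _ _ c12]]; [exact: (holo_pds _ oB H1)|exact: c12].
rewrite Pz Qz Sz.
have g1E a b : val_at g1 (jet_base q) 0%N a b = k a b z by exact: mul1r.
exact: (@cubic_tabE (P z) (Q z) (S z) (val_at g1 (jet_base q) 0%N) i j l m (g1E 1%N 1%N) (g1E 1%N 2%N)
  (g1E 2%N 1%N) (g1E 2%N 2%N) i3 j3 l3 m3).
Qed.

Let geo1B i : holomorphic_on B (geo1 i).
Proof. by move=> q Bq; apply: (diff_geo g1H); exact: bl_jet_base. Qed.

(** [geo1] has the same third velocity derivatives as [F], so the difference is quadratic in the
    velocities. *)
Let quad i : (0 < i < 3)%N -> exists g : nat -> nat -> base -> C, [/\ forall a b, holomorphic_on B0 (g a b),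
    forall a b x, B0 x -> g a b x = g b a x & forall q, B q -> F i q - geo1 i q = fib_quadr g q].
Proof.
move=> i3; have hB : holomorphic_on B (fun q => F i q - geo1 i q).
  by move=> q Bq; apply: differentiableB; [exact: (FB i)|exact: geo1B].
apply: (fiber_quadratic r0 hB) => q j l m Bq j3 l3 m3.
apply: etrans (pd_subs _ oB (FB i) (@geo1B i) Bq) _; apply/eqP; rewrite subr_eq0; apply/eqP.
exact: etrans (third_tab Bq i3 j3 l3 m3) (esym (geo1_jd3 Bq i3 j3 l3 m3)).
Qed.

Lemma cubic_connection : exists g : nat -> nat -> nat -> base -> C,
  [/\ forall c a b, holomorphic_on B0 (g c a b),
    forall c a b x, B0 x -> g c a b x = g c b a x,
    forall a x, B0 x -> \sum_(c < 3) g c c a x = 0,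
    forall q, B q -> F1 q = geo (val_at g (jet_base q)) (vel q) 1%N &
    forall q, B q -> F2 q = geo (val_at g (jet_base q)) (vel q) 2%N].
Proof.
have [w1 [w1H w1S w1E]] := @quad 1 isT.
have [w2 [w2H w2S w2E]] := @quad 2 isT.
(* The signs reflect that [geo] subtracts the [i]-th quadratic form. *)
pose g2 (c a b : nat) x : C :=
  match c with 0 => g1 0%N a b x | 1 => - w1 a b x | _ => - w2 a b x end.
have g2H c a b : holomorphic_on B0 (g2 c a b).
  move=> x Bx; move: c => [|[|c]]; first exact: g1H.
    by apply: differentiableN; exact: w1H.
  by apply: differentiableN; exact: w2H.
have g2S c a b x : B0 x -> g2 c a b x = g2 c b a x.
  move=> Bx; move: c => [|[|c]]; [exact: g1S|exact: congr1 (w1S a b x Bx)|exact: congr1 (w2S a b x Bx)].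
have [g [gH gS gT gE]] := trace_free g2H g2S.
have sN (f : nat -> nat -> base -> C) x u : quadr (fun _ a b => - f a b x) u 0%N = - quadr (val_at (fib f) x) u 0%N.
  rewrite /quadr -sumrN; apply: eq_bigr => a _; rewrite -sumrN; apply: eq_bigr => b _.
  by rewrite /val_at /fib !mulNr.
have g10 q i : (0 < i)%N -> quadr (val_at g1 (jet_base q)) (vel q) i = 0.
  move=> i0; have ni : (i == 0%N) = false by case: (i) i0.
  rewrite /quadr big1// => a _; rewrite big1// => b _.
  by rewrite /val_at /g1 ni !mul0r.
have al (f a t s w : C) : f - (a * t - s) = w -> s = 0 -> f = a * t - - w.
  by move=> <- ->; rewrite subr0 opprK addrC subrK.
exists g; split.
- exact: gH.
- exact: gS.
- exact: gT.
- move=> q Bq; rewrite gE//.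
  apply: etrans (al _ _ _ _ _ (w1E q Bq) (g10 q 1%N isT)) _.
  by rewrite /fib_quadr -sN.
- move=> q Bq; rewrite gE//.
  apply: etrans (al _ _ _ _ _ (w2E q Bq) (g10 q 2%N isT)) _.
  by rewrite /fib_quadr -sN.
Qed.
End CubicConnection.

(** * Algebraic symmetries of the curvature *)

Section RiemSymmetry.
Variables (K : comPzRingType) (g : nat -> nat -> nat -> K) (dg : nat -> nat -> nat -> nat -> K).

Lemma riem_anti c d a b : riem g dg c d a b = - riem g dg c d b a.
Proof.
rewrite /riem opprD opprB; congr (_ + _); rewrite -sumrN; apply: eq_bigr => e _.
by rewrite opprB.
Qed.

Lemma riem_cyclic c (gS : forall c a b, g c a b = g c b a) (dS : forall d c a b, dg d c a b = dg d c b a) :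
  riem g dg c 0%N 1%N 2%N + riem g dg c 1%N 2%N 0%N + riem g dg c 2%N 0%N 1%N = 0.
Proof.
rewrite /riem !big_ord_recl !big_ord0 /= /bump /= ?addn0 ?addn1.
rewrite (dS _ _ 1%N 0%N) (dS _ _ 2%N 0%N) (dS _ _ 2%N 1%N).
rewrite !(gS _ 1%N 0%N) !(gS _ 2%N 0%N) !(gS _ 2%N 1%N).
by ring.
Qed.

Lemma riem_trace a b (gS : forall c a b, g c a b = g c b a) (dS : forall d c a b, dg d c a b = dg d c b a) :
  (forall d a, \sum_(c < 3) dg d c c a = 0) -> \sum_(e < 3) riem g dg e e a b = 0.
Proof.
move=> dT; rewrite /riem big_split /= sumrB.
have T d a' : \sum_(e < 3) dg d e a' e = 0 by rewrite -[RHS](dT d a'); apply: eq_bigr => e _; exact: dS.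
rewrite !T subrr add0r.
transitivity (\sum_(e < 3) \sum_(f < 3) g e a f * g f b e - \sum_(e < 3) \sum_(f < 3) g e b f * g f a e).
  by rewrite -sumrB; apply: eq_bigr => e _; rewrite sumrB.
rewrite [X in _ - X]exchange_big /=; apply/eqP; rewrite subr_eq0; apply/eqP.
by apply: eq_bigr => e _; apply: eq_bigr => f _; rewrite mulrC.
Qed.
End RiemSymmetry.

(** * From the identities to equivalence *)

Section Sufficiency.
Variable R : realType.
Local Notation C := (Cplx R).
Local Notation base := 'rV[C]_3.
Local Notation jet := 'rV[C]_5.

(** In the max norm the ball is a product, so base point and velocities vary independently, as the
    polynomial argument of [weyl_vanish] requires. *)
Lemma jet_with_vel (p : jet) r (x : base) (a b : C) : 0 < r -> bl (jet_base p) r x ->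
  nm (a - p 0 jd1 : C) < r -> nm (b - p 0 jd2 : C) < r ->
  exists q : jet, [/\ bl p r q, jet_base q = x & vel q = (fun i => nth 0 [:: 1; a; b] i)].
Proof.
move=> r0 Bx ha hb.
pose q : jet := lift_jet p x + (a - p 0 jd1) *: delta_mx 0 jd1 + (b - p 0 jd2) *: delta_mx 0 jd2.
have qE i : q 0 i = nth 0 [:: x 0 bt; x 0 bx1; x 0 bx2; a; b] i.
  rewrite !mxE; case: i => -[|[|[|[|[|//]]]]] ? /=; rewrite ?mulr0 ?mulr1 ?addr0//;
    by rewrite addrC subrK.
exists q; split.
- have H (j : 'I_3) : nm (x 0 j - p 0 (widen_ord (isT : 3 <= 5)%N j) : C) < r.
    have := le_lt_trans (nm_coord (x - jet_base p) j) Bx.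
    by rewrite mxE [X in _ + X]mxE [X in _ - X]mxE.
  apply: nm_row_lt r0 _ => i; rewrite mxE [X in _ + X]mxE qE.
  case: i => -[|[|[|[|[|//]]]]] ?; rewrite [nth _ _ _]/=.
  + by have := H bt; congr (nm (_ - p 0 _) < r); apply: val_inj.
  + by have := H bx1; congr (nm (_ - p 0 _) < r); apply: val_inj.
  + by have := H bx2; congr (nm (_ - p 0 _) < r); apply: val_inj.
  + by move: ha; congr (nm (_ - p 0 _) < r); apply: val_inj.
  + by move: hb; congr (nm (_ - p 0 _) < r); apply: val_inj.
- apply/rowP => i; rewrite mxE qE; case: i => -[|[|[|//]]] ? /=;
    by congr (x 0 _); apply: val_inj.
- by apply/funext => -[|[|[|i]]]; rewrite /vel /= ?qE.
Qed.

Lemma identities_equivalent (U : set jet) (F1 F2 : jet -> C) : open U ->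
  holomorphic_on U F1 -> holomorphic_on U F2 ->
  (forall p : jet, U p ->
    (pd [:: jd1; jd1; jd1] F2 p = 0) /\
    (pd [:: jd2; jd2; jd2] F1 p = 0) /\
    (pd [:: jd2; jd2; jd2] F2 p - 3 * pd [:: jd1; jd2; jd2] F1 p = 0) /\
    (pd [:: jd1; jd1; jd1] F1 p - 3 * pd [:: jd1; jd1; jd2] F2 p = 0) /\
    (pd [:: jd1; jd1; jd2] F1 p - pd [:: jd1; jd2; jd2] F2 p = 0) /\
    (2 * Dt F1 F2 (pd [:: jd2] F1) p
       - pd [:: jd2] F1 p * pd [:: jd1] F1 p
       - pd [:: jd2] F2 p * pd [:: jd2] F1 p
       - 4 * pd [:: jx2] F1 p = 0) /\
    (- (pd [:: jd2] F2 p) ^+ 2 - 2 * Dt F1 F2 (pd [:: jd1] F1) p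
       - 4 * pd [:: jx2] F2 p + 4 * pd [:: jx1] F1 p
       + 2 * Dt F1 F2 (pd [:: jd2] F2) p + (pd [:: jd1] F1 p) ^+ 2 = 0) /\
    (- 2 * Dt F1 F2 (pd [:: jd1] F2) p
       + pd [:: jd2] F2 p * pd [:: jd1] F2 p
       + 4 * pd [:: jx1] F2 p
       + pd [:: jd1] F1 p * pd [:: jd1] F2 p = 0)) ->
  forall p, U p -> point_equivalent_at U F1 F2 setT (fun=> 0) (fun=> 0) p.
Proof.
move=> oU H1 H2 id p Up.
have [r r0 rU] := (nm_openP U).1 oU p Up.
have BU q : bl p r q -> U q by exact: rU.
have oB : open (bl p r) by exact: bl_open.
have oB0 : open (bl (jet_base p) r) by exact: bl_open.
have B1 : holomorphic_on (bl p r) F1 by move=> q /BU; exact: H1.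
have B2 : holomorphic_on (bl p r) F2 by move=> q /BU; exact: H2.
have i1 q : bl p r q -> pd [:: jd1; jd1; jd1] F2 q = 0 by move=> /BU/id[].
have i2 q : bl p r q -> pd [:: jd2; jd2; jd2] F1 q = 0 by move=> /BU/id[_ []].
have i3 q : bl p r q -> pd [:: jd2; jd2; jd2] F2 q = 3 * pd [:: jd1; jd2; jd2] F1 q.
  by move=> /BU/id[_ [_ [h _]]]; exact: subr0_eq h.
have i4 q : bl p r q -> pd [:: jd1; jd1; jd1] F1 q = 3 * pd [:: jd1; jd1; jd2] F2 q.
  by move=> /BU/id[_ [_ [_ [h _]]]]; exact: subr0_eq h.
have i5 q : bl p r q -> pd [:: jd1; jd1; jd2] F1 q = pd [:: jd1; jd2; jd2] F2 q.
  by move=> /BU/id[_ [_ [_ [_ [h _]]]]]; exact: subr0_eq h.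
have [g [gH gS gT e1 e2]] := cubic_connection r0 B1 B2 i1 i2 i3 i4 i5.
have WD q : bl p r q -> bl (jet_base p) r (jet_base q) by exact: bl_jet_base.
have gW (c d a b : 'I_3) x : bl (jet_base p) r x ->
    riem_at g x c d a b = (c == a)%:R * schouten g b d x - (c == b)%:R * schouten g a d x.
  move=> Bx.
  have S1 c' a' b' : val_at g x c' a' b' = val_at g x c' b' a' by exact: gS.
  have S2 d' c' a' b' : der_at g x d' c' a' b' = der_at g x d' c' b' a'.
    exact: (der_atS oB0 gS d' c' a' b' Bx).
  apply: (@weyl_vanish _ (riem_at g x) _ _ _ (p 0 jd1) (p 0 jd2) r r0).
  - by move=> c' d' a' b'; exact: riem_anti.
  - by move=> c'; exact: riem_cyclic.
  - by move=> a' b'; apply: riem_trace => // d' a''; exact: (der_trace oB0 gH gT).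
  (* With the base point [x] fixed, the last three identities at every nearby velocity make the
     three Jacobi components vanish on an open set of velocities. *)
  move=> y z hy hz; have [q [Bq qx qv]] := jet_with_vel r0 Bx hy hz.
  have [_ [_ [_ [_ [_ [t1 [t2 t3]]]]]]] := id q (BU q Bq).
  have [t6 t7 t8] := torsion_geodesic oB0 gH gS oB WD e1 e2 Bq.
  rewrite t1 in t6; rewrite t2 in t7; rewrite t3 in t8.
  rewrite qx qv in t6 t7 t8.
  have z4 (w : C) : 0 = 4 * w -> w = 0.
    by move/esym/eqP; rewrite mulf_eq0 pnatr_eq0 /= => /eqP.
  have z4N (w : C) : 0 = - 4 * w -> w = 0.
    by rewrite mulNr -mulrN => /z4/eqP; rewrite oppr_eq0 => /eqP.
  by split; [exact: z4N t6|exact: z4 t8|exact: z4 t7].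
apply: (flat_connection_equivalent oB0 gH gS gT gW oB _ BU WD e1 e2).
exact: bl_center.
Qed.
End Sufficiency.

Unset Implicit Arguments.

Theorem theorem2 (R : realType) (U : set 'rV[Cplx R]_5)
    (F1 F2 : 'rV[Cplx R]_5 -> Cplx R)
    (Uopen : open U) (Uconn : connected U)
    (F1hol : holomorphic_on U F1) (F2hol : holomorphic_on U F2) :
  locally_point_equivalent U F1 F2 setT (fun=> 0) (fun=> 0)
  <->
  (forall p : 'rV[Cplx R]_5, U p ->
    (pd [:: jd1; jd1; jd1] F2 p = 0) /\
    (pd [:: jd2; jd2; jd2] F1 p = 0) /\
    (pd [:: jd2; jd2; jd2] F2 p - 3 * pd [:: jd1; jd2; jd2] F1 p = 0) /\
    (pd [:: jd1; jd1; jd1] F1 p - 3 * pd [:: jd1; jd1; jd2] F2 p = 0) /\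
    (pd [:: jd1; jd1; jd2] F1 p - pd [:: jd1; jd2; jd2] F2 p = 0) /\
    (2 * Dt F1 F2 (pd [:: jd2] F1) p
       - pd [:: jd2] F1 p * pd [:: jd1] F1 p
       - pd [:: jd2] F2 p * pd [:: jd2] F1 p
       - 4 * pd [:: jx2] F1 p = 0) /\
    (- (pd [:: jd2] F2 p) ^+ 2 - 2 * Dt F1 F2 (pd [:: jd1] F1) p
       - 4 * pd [:: jx2] F2 p + 4 * pd [:: jx1] F1 p
       + 2 * Dt F1 F2 (pd [:: jd2] F2) p + (pd [:: jd1] F1 p) ^+ 2 = 0) /\
    (- 2 * Dt F1 F2 (pd [:: jd1] F2) p
       + pd [:: jd2] F2 p * pd [:: jd1] F2 p
       + 4 * pd [:: jx1] F2 p
       + pd [:: jd1] F1 p * pd [:: jd1] F2 p = 0)).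
Proof.
split; last exact: identities_equivalent.
by move=> eqv p /eqv; exact: equivalent_identities.
Qed.
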